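(* Let $a\in[0.3,0.6]$, $\lambda=0.8$, let $P=P_a$ be the convex quadrilateral with vertices $A=(0,1)$, $B=(a,1)$, $C=(1,0.2)$, $D=(0,0)$, and let $T$ be the outer billiards map with contraction $\lambda$ outside $P$. For all sufficiently small $\epsilon>0$ the following holds for the rectangles $R_1,R_2$ and the map $g$ described in the context. (i) If the rotation number $\rho(g)$ is rational, there is a unique attracting $T$-periodic orbit such that every orbit starting from a point of $X\cap(R_1\cup R_2)$ is asymptotic to it. (ii) If $\rho(g)$ is irrational, there is a unique invariant Cantor set such that every orbit starting from a point of $X\cap(R_1\cup R_2)$ is asymptotic to it.
   Context: Outer billiards with contraction: for a convex polygon $P$ and $0<\lambda<1$, given a generic $x\in\mathbb R^2\setminus P$ there is a unique vertex $v$ of $P$ such that $P$ lies on the left of the ray from $x$ through $v$; set $Tx=(1+\lambda)v-\lambda x$ (the point on this ray beyond $v$ with $|xv|:|v\,Tx|=1:\lambda$). If $A_1,\dots,A_n$ are the vertices of $P$ in clockwise order, let $S$ be the union of the rays $\overrightarrow{A_1A_2},\dots,\overrightarrow{A_nA_1}$ (starting at the first point and containing the side); $T$ is defined on $\mathbb R^2\setminus(P\cup S)$. Let $X=\mathbb R^2\setminus\big(P\cup\bigcup_{i\ge0}T^{-i}S\big)$, the set of points whose whole forward orbit is defined. Periodic orbits: an ordered tuple $(w_1,\dots,w_n)$ (with $w_{n+1}:=w_1$) is a $T$-periodic orbit if for each $i$ either $w_i\notin P\cup S$ and $Tw_i=w_{i+1}$, or $w_i\in S$ and $w_{i+1}$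 is one of the (at most two) natural values of $T$ at $w_i$, i.e. a limit of $T(z)$ as $z\to w_i$ from one side of the singular ray. It is attracting if it has a neighborhood $U$ such that every point of $U\cap X$ is asymptotic to it. A point $x\in X$ is asymptotic to a closed set $K$ if its $\omega$-limit set $\omega_T(x)$ equals $K$ (all orbits are bounded). A Cantor set is a set homeomorphic to the middle-thirds set. A closed set $K$ is invariant if every $w\in K$ has a value of $T$ at $w$ (one-sided limit value if $w\in S$) lying in $K$, and every point of $K$ is such a value for a point of $K$. Rectangles: let $\mu=1/\lambda$, $l=\mu+(1-a)\mu^2$, $E=(-l,1)$. For $\epsilon>0$ small, $R_1=[-l+\epsilon,0]\times[1,1+\epsilon^2]$ and $R_2=[-l+\epsilon,0]\times[1-\epsilon^2,1]$. The map $g$: let $\hat g$ be the first-return map of $T$ to $R_2$. For $p=(p_1,1)$ on the segment $\overline{EA}$, $g(p)$ is the vertical projection onto $\overline{EA}$ of $\hat g(p_1,1-\delta)$, for small $\delta>0$ (and small $\epsilon$); this does not depend on $\delta$ or $\epsilon$. After identifying $\overline{EA}$ with $[0,1]$ by the affine map $E\mapsto0$, $A\mapsto1$, and gluing $0$ to $1$, $g$ is a (discontinuous) circle map having a lift $G:\mathbb R\to\mathbb R$ that is strictly increasing with $G(x+1)=G(x)+1$. Its rotation number is $\rho(g)=\lim_{n\to\infty}(G^n(x)-x)/n \bmod 1$. Values of $g$ at its points of discontinuity are irrelevant. *)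

(* Defs.v *)
(* MathComp-Analysis *)
From HB Require Import structures.
From mathcomp Require Import all_boot all_order all_algebra.
From mathcomp Require Import all_classical all_reals all_analysis.

Set Implicit Arguments.
Unset Strict Implicit.
Unset Printing Implicit Defensive.

Import Order.TTheory GRing.Theory Num.Theory.
Import numFieldNormedType.Exports.

Local Open Scope classical_set_scope.
Local Open Scope ring_scope.

Definition cross (R : realType) (u v : R * R) : R := u.1 * v.2 - u.2 * v.1.

Definition ray (R : realType) (u v : R * R) : set (R * R) :=
  [set x | exists2 t : R, 0 <= t & x = u + t *: (v - u)].

(* In all that follows [V] lists the vertices in clockwise order, and [ordS] is
   the cyclic successor, so that [V (ordS i)] is the vertex following [V i]. *)

Definition polygon (R : realType) (n : nat) (V : 'I_n -> R * R) : set (R * R) :=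
  [set p | exists t : 'I_n -> R,
     [/\ forall i, 0 <= t i, \sum_i t i = 1 & p = \sum_i t i *: V i]].

Definition singular_set (R : realType) (n : nat) (V : 'I_n -> R * R) :
    set (R * R) :=
  \bigcup_(i in [set: 'I_n]) ray (V i) (V (ordS i)).

(* The polygon lies on the left of the ray from [x] through [v]; the half-plane
   is closed since it contains [v] on its boundary. *)
Definition left_tangent (R : realType) (n : nat) (V : 'I_n -> R * R)
    (x v : R * R) : Prop :=
  range V v /\ polygon V `<=` [set p | 0 <= cross (v - x) (p - x)].

(* The map T, as a total function: [left_tangent V x] is a singleton when [x] is
   outside [polygon V `|` singular_set V]; elsewhere the value is meaningless
   and must not be used. *)
Definition outer_billiard (R : realType) (n : nat) (V : 'I_n -> R * R) (lam : R)
    (x : R * R) : R * R :=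
  let v := xget 0 (left_tangent V x) in (1 + lam) *: v - lam *: x.

Definition defined_at (R : realType) (n : nat) (V : 'I_n -> R * R) :
    set (R * R) :=
  ~` (polygon V `|` singular_set V).

(* The set X. Meaningless values of T play no role: T maps [defined_at V] to the
   complement of the polygon, hence the first point of an orbit starting off the
   polygon where T is not defined lies in [singular_set V]. *)
Definition regular_points (R : realType) (n : nat) (V : 'I_n -> R * R)
    (lam : R) : set (R * R) :=
  ~` (polygon V `|`
      \bigcup_(i in [set: nat])
        iter i (outer_billiard V lam) @^-1` singular_set V).

(* [y] is the limit of T at [w] from one side (given by [b]) of a singular ray
   through [w]. The closure condition says that T is defined at points
   arbitrarily close to [w] on that side. It fails when [w] is interior to an
   edge and the side is that of the polygon; without it any [y] would be such
   a limit. *)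
Definition one_sided_value (R : realType) (n : nat) (V : 'I_n -> R * R)
    (lam : R) (w y : R * R) : Prop :=
  exists (i : 'I_n) (b : bool),
    let D := [set z | 0 < (-1) ^+ b * cross (V (ordS i) - V i) (z - w)]
             `&` defined_at V in
    [/\ ray (V i) (V (ordS i)) w,
        closure D w &
        outer_billiard V lam z @[z --> within D (nbhs w)] --> y].

Definition T_value (R : realType) (n : nat) (V : 'I_n -> R * R) (lam : R)
    (w y : R * R) : Prop :=
  (defined_at V w /\ outer_billiard V lam w = y) \/
  (singular_set V w /\ one_sided_value V lam w y).

Definition omega_limit (R : realType) (n : nat) (V : 'I_n -> R * R) (lam : R)
    (x : R * R) : set (R * R) :=
  cluster (iter k (outer_billiard V lam) x @[k --> \oo]).

Definition asymptotic_to (R : realType) (n : nat) (V : 'I_n -> R * R) (lam : R)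
    (x : R * R) (K : set (R * R)) : Prop :=
  closed K /\ omega_limit V lam x = K.

(* The points of the tuple need not be distinct: a point of a singular ray may
   be visited several times, with different one-sided values. *)
Definition periodic_tuple (R : realType) (n : nat) (V : 'I_n -> R * R) (lam : R)
    (m : nat) (w : 'I_m.+1 -> R * R) : Prop :=
  forall i, T_value V lam (w i) (w (ordS i)).

Definition attracting (R : realType) (n : nat) (V : 'I_n -> R * R) (lam : R)
    (K : set (R * R)) : Prop :=
  exists U : set (R * R),
    [/\ open U, K `<=` U &
        forall x, (U `&` regular_points V lam) x -> asymptotic_to V lam x K].

(* Orbits are identified with their sets of points, so that changing the starting
   point, or running several times through the same tuple, does not count as
   giving another orbit. *)
Definition attracting_periodic_orbit (R : realType) (n : nat)
    (V : 'I_n -> R * R) (lam : R) (K : set (R * R)) : Prop :=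
  exists (m : nat) (w : 'I_m.+1 -> R * R),
    [/\ periodic_tuple V lam w, K = range w & attracting V lam K].

Definition invariant_set (R : realType) (n : nat) (V : 'I_n -> R * R) (lam : R)
    (K : set (R * R)) : Prop :=
  [/\ closed K,
      forall w, K w -> exists2 y, T_value V lam w y & K y &
      forall y, K y -> exists2 w, T_value V lam w y & K w].

Fixpoint thirds (R : realType) (n : nat) : set R :=
  if n is m.+1 then
    [set x | exists2 y, @thirds R m y & x = y / 3 \/ x = (y + 2) / 3]
  else [set x | 0 <= x <= 1].

Definition middle_thirds (R : realType) : set R :=
  \bigcap_(n in [set: nat]) @thirds R n.

Definition homeomorphic_sets (S T : topologicalType) (A : set S) (B : set T) :
    Prop :=
  exists (f : S -> T) (g : T -> S),
    [/\ set_fun A B f /\ set_fun B A g,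
        {in A, cancel f g}, {in B, cancel g f},
        {within A, continuous f} & {within B, continuous g}].

Definition cantor_set (R : realType) (K : set (R * R)) : Prop :=
  homeomorphic_sets (@middle_thirds R) K.

Definition quad (R : realType) (a : R) : 'I_4 -> R * R :=
  tnth [tuple (0, 1); (a, 1); (1, 1 / 5); (0, 0)].

Definition ell (R : realType) (lam a : R) : R :=
  let mu := lam^-1 in mu + (1 - a) * mu ^+ 2.

Definition rect1 (R : realType) (lam a eps : R) : set (R * R) :=
  [set x | - ell lam a + eps <= x.1 <= 0 /\ 1 <= x.2 <= 1 + eps ^+ 2].

Definition rect2 (R : realType) (lam a eps : R) : set (R * R) :=
  [set x | - ell lam a + eps <= x.1 <= 0 /\ 1 - eps ^+ 2 <= x.2 <= 1].

Definition first_return (R : realType) (n : nat) (V : 'I_n -> R * R) (lam : R)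
    (A : set (R * R)) (x y : R * R) : Prop :=
  let T := outer_billiard V lam in
  A x /\ exists k : nat,
    [/\ (0 < k)%N,
        forall i, (i < k)%N -> defined_at V (iter i T x),
        forall i, (0 < i < k)%N -> ~ A (iter i T x),
        A (iter k T x) & y = iter k T x].

(* The segment EA is parametrized by the first coordinate, in [- ell lam a, 0]. *)
Definition g_value (R : realType) (lam a p q : R) : Prop :=
  \forall eps \near 0^'+, \forall delta \near 0^'+,
    exists2 y, first_return (quad a) lam (rect2 lam a eps) (p, 1 - delta) y &
               q = y.1.

Definition g_map (R : realType) (lam a p : R) : R := xget 0 (g_value lam a p).

(* The affine coordinate on EA sending E to 0 and A to 1. *)
Definition EA_coord (R : realType) (lam a p : R) : R :=
  (p + ell lam a) / ell lam a.

(* The values of g at its discontinuities, or where [g_value] gives none, impose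
   no condition on the lift. *)
Definition is_lift (R : realType) (lam a : R) (G : R -> R) : Prop :=
  [/\ forall x y, x < y -> G x < G y,
      forall x, G (x + 1) = G x + 1 &
      forall p, - ell lam a < p < 0 ->
        (\forall p' \near p, exists q, g_value lam a p' q) ->
        {for p, continuous (g_map lam a)} ->
        exists k : int,
          G (EA_coord lam a p) = EA_coord lam a (g_map lam a p) + k%:~R].

(* The rotation number is defined modulo 1; [rho] is its representative in
   [0, 1). *)
Definition is_rotation_number (R : realType) (lam a rho : R) : Prop :=
  0 <= rho < 1 /\
  exists (G : R -> R) (k : int), is_lift lam a G /\
    forall x, (iter n G x - x) / n%:R @[n --> \oo] --> rho + k%:~R.

Definition rotation_number (R : realType) (lam a : R) : R :=
  xget 0 (is_rotation_number lam a).

(* Main.v *)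
Require Import Defs.
From HB Require Import structures.
From mathcomp Require Import all_boot all_order all_algebra.
From mathcomp Require Import all_classical all_reals all_analysis.
From mathcomp Require Import ring lra zify.

(** Coordinates are chosen so that the line [AB] is the horizontal line at height 1. To
   the left of [A] two steps of the map, about [D] and then about [C], send [(x, 1 + h)]
   to [(9/5 + 16/25 x, 1 + 16/25 h)]: the position of [C] makes the line invariant, and
   the distance to it contracts. From there a point above the line is reflected in [A] and
   a point below it in [B]. An orbit starting near [EA] is therefore a sequence of
   excursions, each one starting just above the line at some abscissa [s]; it has four
   steps if [0 < s] and six steps if [s < 0], and its end is an affine contraction
   [exc_end] of [s] that depends on the sign of [s] only ([exc_defined]). Gluing the ends
   of the interval that contains the starts, one gets a circle map with an increasing lift
   [quad_lift], which has a single discontinuity and contracts distances elsewhere. Each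
   excursion passes exactly once through [R2], so that [g] is conjugate to this circle map
   by a decreasing affine map, and their rotation numbers are opposite modulo 1
   ([rotation_number_excursions]).

   Since the heights tend to 0, the omega-limit set of an orbit is the union of the
   excursions, at height 0, of the accumulation points of its starts
   ([omega_exc_union]). An accumulation point is recorded together with the sign seen
   along the way ([accum]): at the discontinuity it tells which one-sided value of the map
   is followed. It remains to show that all orbits of the lift have the same accumulation
   points, and to describe them.

   If the rotation number is irrational, the interval between two points of an orbit is
   entered by all orbits infinitely often, because some integer translate of an iterate
   drifts in one direction and is increasing, hence cannot jump over the interval
   ([orbit_enters]). All orbits have thus the same accumulation points
   ([accum_irrational]), none of which is isolated ([accum_perfect]). The contraction and
   the gap left by the jump make them nowhere dense ([accum_nowhere_dense]), so the limit
   set is compact, without isolated points and zero dimensional: a Cantor set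
   ([exc_union_cantor]).

   If it is the fraction [p / q], the map [F^q - p] has bounded orbits which are monotone
   in time, so every orbit converges to a cycle ([orbit_residues_cvg]). By contraction,
   an orbit either ends up following the orbit of the right side of the discontinuity, or
   keeps passing the discontinuity closer and closer on its right; in the latter case the
   discontinuity is periodic from the right, and is followed as well
   ([accum_rational]). The limit points and signs are then periodic, and concatenating
   the excursions gives the periodic orbit ([exc_union_periodic]).

   The limit set attracts a whole neighborhood, since the points near the lines that
   carry it either lie in the polygon or on singular rays or start an excursion
   soon ([captured_trap]). It is unique because the rectangles contain points whose forward
   orbit is regular ([regular_start]): it is the omega-limit set of any of them. *)

Set Implicit Arguments.
Unset Strict Implicit.
Unset Printing Implicit Defensive.

Import Order.TTheory GRing.Theory Num.Theory.
Import numFieldNormedType.Exports.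

Local Open Scope classical_set_scope.
Local Open Scope ring_scope.

(** * Monotone lifts of degree one *)

Definition fpart (R : realType) (x : R) : R := x - (Num.floor x)%:~R.

Section MonotoneLifts.
Context {R : realType}.
Implicit Types (F : R -> R) (x y r : R).

Definition monotone_lift F :=
  (forall x y, x < y -> F x < F y) /\ (forall x, F (x + 1) = F x + 1).

Lemma fpart_ge0 x : 0 <= fpart x.
Proof. by rewrite subr_ge0 floor_le. Qed.

Lemma fpart_lt1 x : fpart x < 1.
Proof. by have := floorD1_gt x; rewrite intrD ltrBlDl. Qed.

Lemma nat_gt x : exists n : nat, x < n%:R.
Proof.
exists (Num.bound `|x|); apply: (le_lt_trans (ler_norm x)).
exact: archi_boundP.
Qed.

Lemma floorDint x (k : int) : Num.floor (x + k%:~R) = Num.floor x + k.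
Proof. by rewrite floorDrz ?intrKfloor// intr_int. Qed.

Lemma fpartDint x (k : int) : fpart (x + k%:~R) = fpart x.
Proof. by rewrite /fpart floorDint intrD; ring. Qed.

Lemma floor_eqP x y : Num.floor x = Num.floor y -> x - y = fpart x - fpart y.
Proof. by rewrite /fpart => ->; ring. Qed.

Section FixedLift.
Context (F : R -> R) (liftF : monotone_lift F).

Lemma iter_lift_lt n x y : x < y -> iter n F x < iter n F y.
Proof. by move=> xy; elim: n => //= n; apply: liftF.1. Qed.

Lemma iter_lift_le n x y : x <= y -> iter n F x <= iter n F y.
Proof. by rewrite !le_eqVlt => /predU1P[->|/(iter_lift_lt n) ->]; rewrite ?eqxx ?orbT. Qed.

Lemma lift_le x y : x <= y -> F x <= F y.
Proof. exact: (@iter_lift_le 1). Qed.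

Lemma lift_addn x (k : nat) : F (x + k%:R) = F x + k%:R.
Proof.
elim: k => [|k IH]; first by rewrite !addr0.
by rewrite -natr1 addrA liftF.2 IH addrA.
Qed.

Lemma lift_addz x (k : int) : F (x + k%:~R) = F x + k%:~R.
Proof.
case: k => k; first exact: lift_addn.
rewrite NegzE intrN -{2}(subrK (k.+1%:R) x).
by rewrite (lift_addn (x - k.+1%:R)) addrK.
Qed.

Lemma iter_addz n x (k : int) : iter n F (x + k%:~R) = iter n F x + k%:~R.
Proof. by elim: n => //= n ->; rewrite lift_addz. Qed.

Lemma iter_subz n x (k : int) : iter n F (x - k%:~R) = iter n F x - k%:~R.
Proof. by rewrite -intrN iter_addz. Qed.

Lemma iter_fpart n x : iter n F (fpart x) = iter n F x - (Num.floor x)%:~R.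
Proof. exact: iter_subz. Qed.

(** Up to an integer translation [y] lies between [x] and [x + 1], and so do the
   iterates. *)
Lemma displacement_close n x y :
  `|(iter n F x - x) - (iter n F y - y)| <= 1.
Proof.
pose k := Num.floor (y - x).
have /andP[k1 k2] := floor_itv (y - x); rewrite -/k intrD in k1 k2.
have xy : x <= y - k%:~R by lra.
have yx : y - k%:~R <= x + 1%:~R by lra.
have := iter_lift_le n xy; have := iter_lift_le n yx.
rewrite iter_subz iter_addz ler_norml => h1 h2; apply/andP; split; lra.
Qed.

Definition displaces r := forall n x, `|iter n F x - x - n%:R * r| <= 2.

(** The displacement of the iterates is additive in time up to an error 1, so it
   stays within bounded distance of a linear function: this gives the rotation
   number together with a uniform bound on the error. *)
Lemma displaces_exists : exists r, displaces r.
Proof.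
pose u n := iter n F 0.
have uD n m : `|u (n + m)%N - u m - u n| <= 1.
  have := displacement_close n (u m) 0.
  by rewrite subr0 -iterD.
have uM n m : `|u (n.+1 * m)%N - n.+1%:R * u m| <= n%:R.
  elim: n => [|n IH]; first by rewrite mul1n mul1r subrr normr0.
  have := uD m (n.+1 * m)%N; rewrite -mulSn => h.
  move: h IH; rewrite !ler_norml -![in _ * u m]natr1 -!natr1 => /andP[h1 h2] /andP[h3 h4].
  by apply/andP; split; lra.
have uC n m : n.+1%:R * u m.+1 <= m.+1%:R * u n.+1 + (n.+1%:R + m.+1%:R).
  have := uM n m.+1; have := uM m n.+1; rewrite mulnC.
  rewrite !ler_norml => /andP[h1 h2] /andP[h3 h4].
  have -> : n.+1%:R = n%:R + 1 :> R by rewrite natr1.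
  have -> : m.+1%:R = m%:R + 1 :> R by rewrite natr1.
  move: h1 h2 h3 h4.
  rewrite -!natr1 => *; lra.
(* By [uC] every quotient [(u m - 1) / m] is at most every [(u n + 1) / n]: the
   supremum of the former is within [1 / n] of [u n / n] for all [n]. *)
pose S := [set (u n.+1 - 1) / n.+1%:R | n in [set: nat]].
have ubS n : ubound S ((u n.+1 + 1) / n.+1%:R).
  move=> _ [m _ <-].
  rewrite ler_pdivrMr ?ltr0Sn// mulrAC ler_pdivlMr ?ltr0Sn//.
  have := uC n m; lra.
have S0 : S !=set0 by exists ((u 1 - 1) / 1%:R); exists 0%N.
exists (sup S) => -[|n] x; first by rewrite /= mul0r !subrr normr0.
have h1 : sup S <= (u n.+1 + 1) / n.+1%:R by apply: ge_sup.
have h2 : (u n.+1 - 1) / n.+1%:R <= sup S.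
  by apply: ub_le_sup; [exists ((u 1 + 1) / 1%:R); exact: ubS|exists n].
move: h1 h2; rewrite ler_pdivlMr ?ltr0Sn// ler_pdivrMr ?ltr0Sn// mulrC => h1 h2.
have := displacement_close n.+1 x 0; rewrite subr0 -/(u n.+1) !ler_norml.
by move=> /andP[h3 h4]; apply/andP; split; lra.
Qed.

Lemma displaces_cvg r x : displaces r ->
  (iter n F x - x) / n%:R @[n --> \oo] --> r.
Proof.
move=> dr; apply/cvgrPdist_le => /= e e0.
near=> n.
have n0 : 0 < n%:R :> R by rewrite ltr0n; near: n; exists 1%N.
have -> : r - (iter n F x - x) / n%:R = - ((iter n F x - x - n%:R * r) / n%:R).
  by field; rewrite gt_eqF.
rewrite normrN normrM normfV (gtr0_norm n0) ler_pdivrMr//.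
apply: (le_trans (dr n x)).
rewrite -ler_pdivrMl// mulrC; apply: ltW; near: n.
exact: nbhs_infty_gtr.
Unshelve. all: by end_near. Qed.

End FixedLift.
End MonotoneLifts.

Section LiftOrbits.
Context {R : realType} (F : R -> R) (liftF : monotone_lift F).
Implicit Types (x y z r e : R) (b : bool).

Definition orb y n : R := fpart (iter n F y).

Definition wraps y : bool := 1 <= F (fpart y).

Lemma wrapsE y : wraps y = ((Num.floor y + 1)%:~R <= F y).
Proof.
rewrite /wraps /fpart -intrN lift_addz// intrN intrD lerBrDl addrC.
by congr (_ <= _); rewrite addrC.
Qed.

Lemma wrapsDint y (k : int) : wraps (y + k%:~R) = wraps y.
Proof. by rewrite /wraps fpartDint. Qed.

Lemma orb_fpart y k n : orb (fpart (iter k F y)) n = orb y (n + k).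
Proof. by rewrite /orb iter_fpart// -iterD -intrN fpartDint. Qed.

(** The symbol is recorded along with the point because an orbit can approach a
   discontinuity from either side, and what follows the limit depends on the side. *)
Definition accum y z b :=
  forall e, 0 < e -> forall N, exists2 n, (N <= n)%N &
    `|orb y n - z| < e /\ wraps (iter n F y) = b.

Lemma accum_eq_near y y' : (forall e, 0 < e -> exists N, forall n, (N <= n)%N ->
    `|orb y n - orb y' n| < e /\ wraps (iter n F y) = wraps (iter n F y')) ->
  accum y = accum y'.
Proof.
have sub w w' : (forall e, 0 < e -> exists N, forall n, (N <= n)%N ->
      `|orb w n - orb w' n| < e /\ wraps (iter n F w) = wraps (iter n F w')) ->
    forall z b, accum w z b -> accum w' z b.
  move=> H z b A e e0 N; have e20 : 0 < e / 2 by lra.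
  have [M HM] := H _ e20; have [n nN [h1 h2]] := A _ e20 (maxn N M).
  exists n; first by apply: leq_trans nN; rewrite leq_maxl.
  have [|h3 h4] := HM n; first by apply: leq_trans nN; rewrite leq_maxr.
  split; last by rewrite -h4.
  by move: h1 h3; rewrite !ltr_norml => /andP[? ?] /andP[? ?]; apply/andP; split; lra.
move=> H; apply/funext => z; apply/funext => b; apply/propext.
split; first exact: sub.
apply: sub => e /H[N HN]; exists N => n /HN[h1 h2].
by rewrite distrC.
Qed.

Lemma wraps_iter_fpart y k n :
  wraps (iter n F (fpart (iter k F y))) = wraps (iter (n + k) F y).
Proof. by rewrite iter_fpart// -iterD -intrN wrapsDint. Qed.

Lemma accum_fpart_iter y k : accum (fpart (iter k F y)) = accum y.
Proof.
apply/funext => z; apply/funext => b; apply/propext; split=> A e e0 N.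
- have [n nN [h1 h2]] := A _ e0 N.
  by exists (n + k)%N; [lia|rewrite -orb_fpart -wraps_iter_fpart].
- have [n nN [h1 h2]] := A _ e0 (N + k)%N.
  exists (n - k)%N; first lia.
  by rewrite orb_fpart wraps_iter_fpart subnK//; lia.
Qed.

(** ** Irrational rotation number *)

(** Write [u' = iter r F u - c]. As the rotation number is irrational, the increasing
   map [iter r F - c] drifts in one direction along every orbit; it cannot carry a point
   over the interval between [u] and its own image [u'] without stopping inside. *)
Lemma orbit_enters rho x n n' (k k' : int) : displaces F rho -> irrational rho ->
  (n < n')%N ->
  let u := iter n F x - k%:~R in let u' := iter n' F x - k'%:~R in
  forall y N, exists2 j, (N <= j)%N & exists c : int,
    Num.min u u' <= iter j F y - c%:~R <= Num.max u u'.
Proof.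
move=> dF irr nn' u u' y N.
pose r := (n' - n)%N; have [c Ec] : exists c : int, c = k' - k by exists (k' - k).
pose H z := iter r F z - c%:~R.
have Hu : H u = u'.
  rewrite /H /u iter_subz// -iterD /u' /r subnK ?(ltnW nn')//.
  by rewrite Ec intrB; ring.
have Hlt z w : z < w -> H z < H w.
  by move=> zw; rewrite /H ltrD2r; exact: iter_lift_lt.
have iterH j z : iter j H z = iter (r * j) F z - (c *+ j)%:~R.
  elim: j => [|j IH]; first by rewrite muln0 mulr0n subr0.
  by rewrite iterS IH /H iter_subz// -iterD mulnS (mulrSr c) intrD opprD addrA.
pose d := r%:R * rho - c%:~R.
have r0 : (0 < r)%N by rewrite subn_gt0.
have d0 : d != 0.
  apply/eqP => d0; apply: irr; exists (c%:~R / r%:R) => //.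
  rewrite fmorph_div /= ratr_int ratr_nat.
  have : r%:R != 0 :> R by rewrite pnatr_eq0 -lt0n.
  by move=> rn; apply: (mulIf rn); rewrite divfK// mulrC; move: d0; rewrite /d; lra.
have drift j z : `|iter j H z - z - j%:R * d| <= 2.
  have := dF (r * j)%N z; rewrite iterH /d natrM.
  by congr (`|_| <= _); rewrite rmorphMn /= -mulr_natl; ring.
have conc j (K : int) : Num.min u u' <= iter j H (iter N F y - K%:~R) <= Num.max u u' ->
    exists2 j, (N <= j)%N & exists c : int, Num.min u u' <= iter j F y - c%:~R <= Num.max u u'.
  move=> h; exists (r * j + N)%N; first exact: leq_addl.
  exists (K + c *+ j); move: h; rewrite iterH iter_subz// -iterD intrD.
  by rewrite opprD addrA.
have [dp|dn] := ltP 0 d.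
(* Start far on the side of [u] from which the drift [d] comes, and stop as soon as [u]
   is reached: the previous point was short of [u], so this one is short of [u']. *)
- pose K := Num.floor (iter N F y - u) + 1.
  have zu : iter N F y - K%:~R < u.
    by have := floorD1_gt (iter N F y - u); rewrite -/K; lra.
  set z := iter N F y - K%:~R in zu.
  have ex : exists j, u <= iter j H z.
    have [j] := nat_gt ((u - z + 2) / d); rewrite ltr_pdivrMr// => hj.
    by exists j; have := drift j z; rewrite ler_norml => /andP[]; lra.
  case: (ex_minnP ex) => -[|j] hj min; first by move: hj zu => /=; lra.
  have {min}jz : iter j H z < u by rewrite ltNge; apply/negP => /min; rewrite ltnn.
  have {}jz := Hlt _ _ jz; rewrite Hu in jz.
  by apply: (conc j.+1 K); rewrite -/z ge_min hj/= le_max (ltW jz) orbT.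
- have {}dn : 0 < - d by rewrite oppr_gt0 lt_neqAle d0.
  pose K := Num.floor (iter N F y - u) - 1.
  have zu : u < iter N F y - K%:~R.
    by have := floor_le (iter N F y - u); rewrite /K intrB; lra.
  set z := iter N F y - K%:~R in zu.
  have ex : exists j, iter j H z <= u.
    have [j] := nat_gt ((z - u + 2) / - d); rewrite ltr_pdivrMr// => hj.
    by exists j; have := drift j z; rewrite ler_norml => /andP[]; lra.
  case: (ex_minnP ex) => -[|j] hj min; first by move: hj zu => /=; lra.
  have {min}jz : u < iter j H z by rewrite ltNge; apply/negP => /min; rewrite ltnn.
  have {}jz := Hlt _ _ jz; rewrite Hu in jz.
  by apply: (conc j.+1 K); rewrite -/z le_max hj/= ge_min (ltW jz) orbT.
Qed.

(** Both the integer part and the symbol are monotone, hence constant between two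
   points where they agree. *)
Lemma arc_same_symbols (v w v' : R) : v <= w <= v' ->
  Num.floor v = Num.floor v' -> wraps v = wraps v' ->
  Num.floor w = Num.floor v /\ wraps w = wraps v.
Proof.
move=> /andP[vw wv'] fE; have fw : Num.floor w = Num.floor v.
  by apply/eqP; rewrite eq_le {1}fE !le_floor.
split=> //; move: H; rewrite !wrapsE fw -fE => bE.
apply/idP/idP => h; last by rewrite (le_trans h)// lift_le.
by rewrite bE (le_trans h)// lift_le.
Qed.

Lemma between_same_symbols b (u u' w : R) : 0 <= u < 1 -> 0 <= u' < 1 ->
  wraps u = b -> wraps u' = b -> Num.min u u' <= w <= Num.max u u' ->
  fpart w = w /\ wraps w = b.
Proof.
move=> u01 u'01 bu bu'.
have f0 v : 0 <= v < 1 -> Num.floor v = 0.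
  by move=> v01; apply: floor_def; rewrite add0r.
have key v v' : 0 <= v < 1 -> 0 <= v' < 1 -> wraps v = b -> wraps v' = b ->
    v <= w <= v' -> fpart w = w /\ wraps w = b.
  move=> v01 v'01 bv bv' vwv'.
  have [||fw ->] := arc_same_symbols vwv'; [by rewrite !f0|by rewrite bv|].
  by rewrite /fpart fw f0// subr0.
by case: (leP u u') => _; exact: key.
Qed.

Lemma orb_itv y n : 0 <= orb y n < 1.
Proof. by rewrite fpart_ge0 fpart_lt1. Qed.

Lemma wraps_fpart y : wraps (fpart y) = wraps y.
Proof. by rewrite -(wrapsDint _ (Num.floor y)) /fpart subrK. Qed.

(** Two visits of the orbit of [x] near an accumulation point bound an arc which the
   orbit of [y] enters as well. *)
Lemma accum_irrational rho x y : displaces F rho -> irrational rho ->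
  accum x = accum y.
Proof.
move=> dF irr.
suff sub x1 y1 z b : accum x1 z b -> accum y1 z b.
  by apply/funext => z; apply/funext => b; apply/propext; split; exact: sub.
move=> A e e0 N.
have [n _ [zn bn]] := A _ e0 0%N; have [n' nn' [zn' bn']] := A _ e0 n.+1.
have [j Nj [c h]] := orbit_enters x1 (Num.floor (iter n F x1))
  (Num.floor (iter n' F x1)) dF irr nn' y1 N.
exists j => //.
have [] := @between_same_symbols b (orb x1 n) (orb x1 n') (iter j F y1 - c%:~R).
- exact: orb_itv.
- exact: orb_itv.
- by rewrite wraps_fpart.
- by rewrite wraps_fpart.
- exact: h.
rewrite -intrN fpartDint wrapsDint -/(orb _ _) => orbE ->; split=> //.
rewrite intrN in orbE; rewrite -orbE in h.
have {}h : Num.min (orb x1 n) (orb x1 n') <= orb y1 j <= Num.max (orb x1 n) (orb x1 n') := h.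
move: h zn zn'; rewrite !ltr_norml.
by case: (leP (orb x1 n)) => _ /andP[? ?] /andP[? ?] /andP[? ?];
  apply/andP; split; lra.
Qed.

Lemma orb_inj rho x n n' : displaces F rho -> irrational rho ->
  (n < n')%N -> orb x n != orb x n'.
Proof.
move=> dF irr nn'; apply/eqP => E; apply: irr.
pose v := iter n F x; pose r := (n' - n)%N.
have r0 : (0 < r)%N by rewrite subn_gt0.
have [c Hv] : exists c : int, iter r F v = v + c%:~R.
  exists (Num.floor (iter n' F x) - Num.floor v).
  rewrite /v -iterD subnK ?(ltnW nn')// intrB.
  by move: E; rewrite /orb /fpart; lra.
have Hj j : iter (r * j) F v = v + j%:R * c%:~R.
  elim: j => [|j IH]; first by rewrite muln0 mul0r addr0.
  by rewrite mulnS addnC iterD Hv iter_addz// IH -natr1; ring.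
have [d0|d0] := eqVneq (c%:~R) (r%:R * rho).
  exists (c%:~R / r%:R) => //.
  rewrite fmorph_div /= ratr_int ratr_nat d0 mulrC mulKf//.
  by rewrite pnatr_eq0 -lt0n.
have {}d0 : 0 < `|c%:~R - r%:R * rho| by rewrite normr_gt0 subr_eq0.
have [j] := nat_gt (2 / `|c%:~R - r%:R * rho|).
rewrite ltr_pdivrMr// ltNge => /negP[].
have := dF (r * j)%N v; rewrite Hj natrM.
have -> : v + j%:R * c%:~R - v - r%:R * j%:R * rho = j%:R * (c%:~R - r%:R * rho) by ring.
by rewrite normrM normr_nat.
Qed.

Lemma seq_cluster_itv (v : nat -> R) (lo hi : R) :
  (forall n, lo <= v n <= hi) ->
  exists2 z, lo <= z <= hi & forall e, 0 < e -> forall N, exists2 n, (N <= n)%N &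
    `|v n - z| < e.
Proof.
move=> vI.
have [|z [zI /cluster_eventuallyP zC]] := @segment_compact R lo hi (v @ \oo).
  by exists 0%N => // n _; rewrite /= in_itv; exact: vI.
exists z; first by move: zI; rewrite /= in_itv.
move=> e e0 N; have [|n Nn h] := zC (e / 2) N; first lra.
by exists n => //; rewrite distrC; apply: (le_lt_trans h); lra.
Qed.

(** Among the infinitely many points of the orbit near [z] two lie on the same side of
   [z]: the arc that they bound avoids [z], and the orbit accumulates in it. *)
Lemma accum_perfect rho x z b e : displaces F rho -> irrational rho -> 0 < e ->
  accum x z b -> exists z', [/\ z' != z, `|z' - z| < e & accum x z' b].
Proof.
move=> dF irr e0 A; have e20 : 0 < e / 2 by lra.
have A' N : exists2 n, (N <= n)%N &
    [/\ `|orb x n - z| < e / 2, wraps (iter n F x) = b & orb x n != z].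
  have [n Nn [h1 h2]] := A _ e20 N.
  have [E|] := eqVneq (orb x n) z; last by exists n.
  have [n' nn' [h1' h2']] := A _ e20 n.+1.
  exists n'; first by apply: leq_trans Nn (ltnW nn').
  by split=> //; rewrite -E eq_sym (orb_inj x dF irr).
suff [n [n' [nn' [zn bn n0] [zn' bn' n0'] same]]] : exists n n', [/\ (n < n')%N,
    [/\ `|orb x n - z| < e / 2, wraps (iter n F x) = b & orb x n != z],
    [/\ `|orb x n' - z| < e / 2, wraps (iter n' F x) = b & orb x n' != z] &
    (orb x n < z) = (orb x n' < z)].
  have H N : exists j, (N <= j)%N /\ (wraps (iter j F x) = b /\
      Num.min (orb x n) (orb x n') <= orb x j <= Num.max (orb x n) (orb x n')).
    have [j Nj [c h]] := orbit_enters x (Num.floor (iter n F x))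
      (Num.floor (iter n' F x)) dF irr nn' x N.
    exists j; split=> //.
    have [] := @between_same_symbols b (orb x n) (orb x n') (iter j F x - c%:~R).
    - exact: orb_itv.
    - exact: orb_itv.
    - by rewrite wraps_fpart.
    - by rewrite wraps_fpart.
    - exact: h.
    by rewrite -intrN fpartDint wrapsDint -/(orb x j) intrN => -> ->.
  have [f Hf] := choice H.
  have [z' z'I Hz'] := @seq_cluster_itv (orb x \o f) _ _
      (fun N => (Hf N).2.2).
  exists z'; split.
  - apply/eqP => z'z; rewrite z'z in z'I.
    case: (ltgtP (orb x n) z) n0 same => // hn _;
      case: (ltgtP (orb x n') z) n0' => // hn' _ // _; move: z'I;
      by case: (leP (orb x n)) => _ /andP[]; lra.
  - move: z'I zn zn'; rewrite !ltr_norml.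
    by case: (leP (orb x n)) => _ /andP[? ?] /andP[? ?] /andP[? ?]; apply/andP; split; lra.
  - move=> e' e'0 N; have [m Nm h] := Hz' _ e'0 N.
    exists (f m); first by apply: leq_trans Nm _; have [] := Hf m.
    by split=> //; have [_ []] := Hf m.
(* Among three points different from [z] two are on the same side. *)
have [n1 _ h1] := A' 0%N; have [n2 n12 h2] := A' n1.+1; have [n3 n23 h3] := A' n2.+1.
have [s12|s12] := eqVneq (orb x n1 < z) (orb x n2 < z); first by exists n1, n2.
have [s23|s23] := eqVneq (orb x n2 < z) (orb x n3 < z); first by exists n2, n3.
exists n1, n3; split=> //; first by apply: ltn_trans n12 n23.
by move: s12 s23; do 3 case: (_ < z).
Qed.

(** ** Rational rotation number *)

Definition monotone_seq (u : nat -> R) :=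
  {homo u : n m / (n <= m)%N >-> n <= m} \/ {homo u : n m / (n <= m)%N >-> m <= n}.

Lemma monotone_seq_test (u : nat -> R) (P : R -> bool) :
  (forall x y, x <= y -> P x -> P y) -> monotone_seq u ->
  exists b N, forall n, (N <= n)%N -> P (u n) = b.
Proof.
move=> Ple [uI|uD].
- have [[N PN]|noP] := pselect (exists N, P (u N)).
    by exists true, N => n Nn; apply: Ple PN; exact: uI.
  exists false, 0%N => n _; apply/negbTE/negP => Pn.
  by apply: noP; exists n.
- have [[N PN]|noP] := pselect (exists N, ~~ P (u N)).
    exists false, N => n Nn; apply: contraNF PN; apply: Ple; exact: uD.
  exists true, 0%N => n _; apply/negPn/negP => Pn.
  by apply: noP; exists n.
Qed.

Lemma monotone_seq_floor (u : nat -> R) (B : R) :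
  (forall n, `|u n| <= B) -> monotone_seq u ->
  exists (k : int) N, forall n, (N <= n)%N -> Num.floor (u n) = k.
Proof.
move=> uB mu.
have [K BK] := nat_gt B.
(* Induction on the number of integers in the range: whether the next integer is passed
   is settled from some time on, as the sequence is monotone. *)
suff H d : forall (v : nat -> R) (lo : int), monotone_seq v ->
    (forall n, lo%:~R <= v n < (lo + d%:Z)%:~R) ->
    exists (k : int) N, forall n, (N <= n)%N -> Num.floor (v n) = k.
  apply: (H (K + K)%N u (- K%:Z)) => // n.
  have := uB n; rewrite ler_norml PoszD addrA addNr add0r intrN /= => /andP[h1 h2].
  by apply/andP; rewrite -!pmulrn; split; lra.
elim: d => [|d IH] v lo mv Hlo.
  by have := Hlo 0%N; rewrite addr0 => /andP[h1 h2]; have := le_lt_trans h1 h2; rewrite ltxx.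
have [|b [N HN]] := monotone_seq_test (P := fun x => (lo + 1)%:~R <= x) _ mv.
  by move=> x y xy /le_trans; apply.
case: b HN => HN; last first.
  exists lo, N => n /HN /negbT; rewrite -ltNge => h.
  by apply: floor_def; rewrite h andbT; have /andP[] := Hlo n.
have [||k [N' H]] := IH (fun n => v (n + N)%N) (lo + 1).
- by case: mv => h; [left|right] => n m nm; apply: h; lia.
- move=> n; have /andP[_] := Hlo (n + N)%N; rewrite intS addrA => ->.
  by rewrite HN// leq_addl.
exists k, (N' + N)%N => n Nn; rewrite -(subnK (_ : N <= n)%N); last lia.
by apply: H; lia.
Qed.

Lemma monotone_seq_cvg (u : nat -> R) (B : R) :
  (forall n, `|u n| <= B) -> monotone_seq u -> exists z, u @ \oo --> z.
Proof.
move=> uB [uI|uD].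
- exists (sup (range u)); apply: nondecreasing_cvgn => //.
  by exists B => _ [n _ <-]; have := uB n; rewrite ler_norml => /andP[].
- exists (inf (range u)); apply: nonincreasing_cvgn => //.
  by exists (- B) => _ [n _ <-]; have := uB n; rewrite ler_norml => /andP[].
Qed.

Section RationalRotation.
Context (p : int) (q : nat) (q_gt0 : (0 < q)%N)
  (dF : displaces F (p%:~R / q%:R)).

(** This map has rotation number 0: along each orbit its iterates are bounded, and they
   are monotone in time, whence the convergence of all orbits of [F] to cycles. *)
Definition first_return_lift y := iter q F y - p%:~R.
Notation H := first_return_lift.

Lemma iter_return n y : iter n H y = iter (n * q) F y - (p *+ n)%:~R.
Proof.
elim: n => [|n IH]; first by rewrite mul0n mulr0n subr0.
by rewrite iterS IH /H iter_subz// -iterD mulSn (mulrSr p) intrD opprD addrA.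
Qed.

Lemma return_le x y : x <= y -> H x <= H y.
Proof. by move=> xy; rewrite /H lerD2r; exact: iter_lift_le. Qed.

Lemma return_monotone_seq y : monotone_seq (fun n => iter n H y).
Proof.
have iH n x x' : x <= x' -> iter n H x <= iter n H x'.
  by move=> xx'; elim: n => //= n; exact: return_le.
have [yH|/ltW yH] := leP y (H y); [left|right].
- by apply: homo_leq => [//|? ? ?|n]; [exact: le_trans|rewrite iterSr iH].
- apply: (@homo_leq _ (fun n => iter n H y) (fun x x' => x' <= x)) => [//|? ? ? h1 h2|n].
    exact: le_trans h2 h1.
  by rewrite iterSr iH.
Qed.

Lemma return_bounded y n : `|iter n H y| <= `|y| + 2.
Proof.
have := dF (n * q)%N y; rewrite iter_return rmorphMn /= natrM.
have -> : n%:R * q%:R * (p%:~R / q%:R) = p%:~R *+ n :> R.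
  by rewrite -mulr_natl; field; rewrite pnatr_eq0 -lt0n.
move=> h; have -> : iter (n * q) F y - p%:~R *+ n =
    y + (iter (n * q) F y - y - p%:~R *+ n) by ring.
by rewrite (le_trans (ler_normD _ _))// lerD2l.
Qed.

Lemma orb_return n j y : orb y (n * q + j)%N = fpart (iter n H (iter j F y)).
Proof. by rewrite iter_return -intrN fpartDint -iterD. Qed.

Lemma wraps_return n j y :
  wraps (iter (n * q + j)%N F y) = wraps (iter n H (iter j F y)).
Proof. by rewrite iter_return -intrN wrapsDint -iterD. Qed.

Lemma orbit_residues_cvg y j : exists z b,
  (orb y (n * q + j)%N @[n --> \oo] --> z) /\ exists N, forall n, (N <= n)%N -> wraps (iter (n * q + j)%N F y) = b.
Proof.
set y' := iter j F y.
have mono := return_monotone_seq y'; have bnd := return_bounded y'.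
have [k [N HN]] := monotone_seq_floor bnd mono.
have [z Hz] := monotone_seq_cvg bnd mono.
have [|b [N' HN']] := monotone_seq_test (P := fun x => (k + 1)%:~R <= F x) _ mono.
  by move=> x x' xx' /le_trans; apply; exact: lift_le.
exists (z - k%:~R), b; split.
  have : iter n H y' - k%:~R @[n --> \oo] --> z - k%:~R by apply: cvgB => //; exact: cvg_cst.
  apply: cvg_trans; apply: near_eq_cvg; exists N => // n /= Nn.
  by rewrite orb_return /fpart HN.
exists (maxn N N') => n; rewrite geq_max => /andP[Nn N'n].
by rewrite wraps_return wrapsE// HN// HN'.
Qed.

End RationalRotation.

(** ** One discontinuity and contraction elsewhere *)

Section Contraction.
Context (kap : R) (kap_ge0 : 0 <= kap) (kap_lt1 : kap < 1)
  (contrF : forall x y, 0 <= x -> x <= y -> y < 1 -> F y - F x <= kap * (y - x)).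

Lemma contr_floor x y : x <= y -> Num.floor x = Num.floor y ->
  F y - F x <= kap * (y - x).
Proof.
move=> xy fxy; have := contrF (fpart_ge0 x) _ (fpart_lt1 y).
have subz z (k : int) : F (z - k%:~R) = F z - k%:~R by exact: (iter_subz liftF 1).
by rewrite /fpart -fxy !subz lerD2r => /(_ xy); lra.
Qed.

Lemma exprK_le1 n : kap ^+ n <= 1.
Proof. by apply: exprn_ile1 => //; exact: ltW. Qed.

Lemma exprK_lt e : 0 < e -> exists n, kap ^+ n < e.
Proof.
move=> e0; have : kap ^+ n @[n --> \oo] --> 0.
  by apply: cvg_expr; rewrite ger0_norm.
move=> /cvgrPdist_lt/(_ e e0)[N _ HN]; exists N.
by have := HN N (leqnn _); rewrite /= sub0r normrN ger0_norm// exprn_ge0.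
Qed.

Lemma exprK_anti n m : (n <= m)%N -> kap ^+ m <= kap ^+ n.
Proof. by move=> nm; apply: ler_wiXn2l => //; exact: ltW. Qed.

Lemma iter_contr n x y : x <= y ->
  (forall i, (i < n)%N -> Num.floor (iter i F x) = Num.floor (iter i F y)) ->
  iter n F y - iter n F x <= kap ^+ n * (y - x).
Proof.
move=> xy; elim: n => [|n IH] H; first by rewrite expr0 mul1r.
rewrite !iterS exprS -mulrA.
apply: le_trans (contr_floor _ (H n (ltnSn n))) _; first exact: iter_lift_le.
by rewrite ler_wpM2l// IH// => i ni; apply: H; exact: ltnW.
Qed.

Definition follows0 v := forall n, Num.floor (iter n F 0) = Num.floor (iter n F v).

Lemma follows0_accum v : 0 <= v -> follows0 v -> accum v = accum 0.
Proof.
move=> v0 fv; apply: accum_eq_near => e e0.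
have [N HN] : exists n, kap ^+ n < e / (v + 1) by apply: exprK_lt; rewrite divr_gt0//; lra.
exists N => n Nn; split; last by rewrite !wrapsE// -!iterS -!floor_ge_int -!fv.
rewrite /orb -floor_eqP//.
rewrite ger0_norm ?subr_ge0 ?iter_lift_le//.
have := @iter_contr n 0 v v0 (fun i _ => fv i); rewrite subr0.
move=> /le_lt_trans; apply.
have := exprK_anti Nn; move: HN; rewrite ltr_pdivlMr; last lra.
move=> h1 h2; have : kap ^+ n * v <= kap ^+ N * v by rewrite ler_wpM2r.
have : 0 <= kap ^+ N by exact: exprn_ge0.
lra.
Qed.

(** As long as no integer separates the orbit of [v] from that of 0 the two come
   closer; the first time one does, the orbit of [v] passes it at a distance
   smaller than [kap * v]. *)
Lemma follows0_or_closer v : 0 <= v < 1 ->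
  follows0 v \/ exists2 n, (0 < n)%N & fpart (iter n F v) <= kap * v.
Proof.
move=> v01; have /andP[v0 v1] := v01.
have [|nf] := pselect (follows0 v); [by left|right].
have ex : exists n, Num.floor (iter n F 0) != Num.floor (iter n F v).
  apply: contrapT => h; apply: nf => n; apply/eqP/negPn/negP => hn.
  by apply: h; exists n.
case: (ex_minnP ex) => n hn min.
have n0 : (0 < n)%N.
  case: n hn min => // + _; rewrite /= floor0 eq_sym.
  by rewrite (_ : Num.floor v = 0) ?eqxx//; apply: floor_def; rewrite add0r.
exists n => //.
have := @iter_contr n 0 v v0; rewrite subr0 => h.
apply: le_trans (le_trans (h _) _).
- have lt : Num.floor (iter n F 0) < Num.floor (iter n F v).
    by rewrite lt_neqAle hn le_floor// iter_lift_le.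
  by rewrite /fpart lerD2l lerN2 ltW// -floor_lt_int.
- move=> i ni; apply/eqP/negPn/negP => /min; lia.
- by rewrite ler_wpM2r// -[leRHS]expr1 exprK_anti.
Qed.

Lemma follows0_or_returns y :
  (exists N, follows0 (orb y N)) \/
  forall k, exists2 n, (k <= n)%N & orb y n <= kap ^+ k.
Proof.
have [|H] := pselect (exists N, follows0 (orb y N)); [by left|right].
elim=> [|k [n kn hn]]; first by exists 0%N => //; rewrite expr0 ltW// fpart_lt1.
have [h|[m m0 hm]] := follows0_or_closer (orb_itv y n).
  by exfalso; apply: H; exists n.
exists (m + n)%N; first lia.
rewrite -orb_fpart exprS; apply: le_trans hm _.
by rewrite ler_wpM2l.
Qed.

(** An increasing map that contracts on [[0, 1)] and its translates is continuous from
   the right at every point, integers included; an orbit that starts just to the right of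
   0 thus keeps the integer parts of that of 0 for a while. *)
Lemma iter_right_continuous n : exists2 eta, 0 < eta &
  forall v, 0 <= v < eta -> forall i, (i <= n)%N ->
    Num.floor (iter i F 0) = Num.floor (iter i F v).
Proof.
elim: n => [|n [eta eta0 H]].
  exists 1 => // v v01 i; rewrite leqn0 => /eqP -> /=.
  by rewrite floor0; apply/esym/floor_def; rewrite add0r.
pose f := Num.floor (iter n.+1 F 0).
have d0 : 0 < (f + 1)%:~R - iter n.+1 F 0 by rewrite subr_gt0 floorD1_gt.
exists (Num.min eta ((f + 1)%:~R - iter n.+1 F 0)); first by rewrite lt_min eta0.
move=> v; rewrite lt_min => /and3P[v0 ve vd] i.
rewrite leq_eqVlt ltnS => /orP[/eqP ->|ni]; last by apply: H; rewrite ?v0.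
apply/esym/floor_def; apply/andP; split.
  by apply: le_trans (floor_le _) _; exact: iter_lift_le.
have h : iter n.+1 F v - iter n.+1 F 0 <= kap ^+ n.+1 * (v - 0).
  by apply: iter_contr => // i' ni'; apply: H; rewrite ?v0// -ltnS.
rewrite subr0 in h.
have : kap ^+ n.+1 * v <= v by rewrite ler_piMl// exprK_le1.
by move: vd; rewrite -/f; lra.
Qed.

Lemma recurrent_residue y q : (0 < q)%N ->
  (forall k, exists2 n, (k <= n)%N & orb y n <= kap ^+ k) ->
  exists j, forall k, exists2 n, (k <= n)%N & orb y (n * q + j)%N <= kap ^+ k.
Proof.
move=> q0 H; apply: contrapT => nH.
have no j : exists k, forall n, (k <= n)%N -> kap ^+ k < orb y (n * q + j)%N.
  apply: contrapT => h; apply: nH; exists j => k; apply: contrapT => h'.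
  apply: h; exists k => n kn; rewrite ltNge; apply/negP => hn.
  by apply: h'; exists n.
have [f Hf] := choice no.
pose K := (\max_(j < q) f j)%N.
have [n Kn hn] := H (K.+1 * q)%N.
have jq : (n %% q < q)%N by rewrite ltn_mod.
have fK : (f (n %% q) <= K)%N by exact: (leq_bigmax (Ordinal jq)).
have := Hf (n %% q)%N (n %/ q)%N; rewrite -divn_eq ltNge => /(_ _)/negP; apply.
  by rewrite (leq_trans fK)// leq_divRL//; apply: leq_trans Kn; rewrite leq_mul2r leqnSn orbT.
apply: le_trans hn (exprK_anti _); apply: leq_trans fK _.
by apply: leq_trans (leqnSn _) _; rewrite leq_pmulr.
Qed.

(** Every orbit that does not follow that of 0 comes back to 0 from the right
   along one residue class of times; as it converges there, 0 is periodic from the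
   right and the orbit ends up following it. *)
Lemma accum_rational (p : int) q y : (0 < q)%N -> displaces F (p%:~R / q%:R) ->
  accum y = accum 0.
Proof.
move=> q0 dF.
suff [N /follows0_accum] : exists N, follows0 (orb y N).
  by rewrite accum_fpart_iter fpart_ge0; apply.
have [//|H] := follows0_or_returns y.
have [j Hj] := recurrent_residue q0 H.
set y' := iter j F y.
have mono := return_monotone_seq p q y'; have bnd := return_bounded q0 dF y'.
have [k [N HN]] := monotone_seq_floor bnd mono.
have [z [_ [zC _]]] := orbit_residues_cvg q0 dF y j.
have z0 : z = 0.
  apply: contrapT => /eqP z0; have e0 : 0 < `|z| / 2 by rewrite divr_gt0// normr_gt0.
  have [K HK] := exprK_lt e0.
  move/cvgrPdist_lt: zC => /(_ _ e0)[N1 _ HN1].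
  have [n nN hn] := Hj (maxn K N1).
  have {}hn := le_lt_trans (le_trans hn (exprK_anti (leq_maxl _ _))) HK.
  have := HN1 n (leq_trans (leq_maxr _ _) nN); rewrite /= => h.
  have := ler_normD (z - orb y (n * q + j)) (orb y (n * q + j)); rewrite subrK.
  by rewrite [X in _ + X]ger0_norm ?fpart_ge0//; move: h hn; rewrite /orb; lra.
pose w n := orb y (n * q + j)%N.
have [eta eta0 Heta] := iter_right_continuous q.
have [N' HN'] : exists N', forall n, (N' <= n)%N -> w n < eta.
  move/cvgrPdist_lt: zC => /(_ eta eta0)[N' _ h]; exists N' => n /h.
  by rewrite z0 /= sub0r normrN ger0_norm// fpart_ge0.
have wS n m : (N <= n)%N -> iter m (first_return_lift p q) (w n) = w (m + n)%N.
  move=> Nn; rewrite /w !(orb_return p) -/y' /fpart !HN//; last lia.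
  rewrite iterD; move: (iter n _ y') => v.
  by rewrite iter_return iter_subz// iter_return; ring.
pose n0 := maxn N N'.
(* By right continuity [iter q F 0 - p] is arbitrarily close to [w n.+1], which tends
   to 0. *)
have H0 : iter q F 0 = p%:~R.
  apply: contrapT => /eqP H0.
  have e0 : 0 < `|iter q F 0 - p%:~R| / 2 by rewrite divr_gt0// normr_gt0 subr_eq0.
  move/cvgrPdist_lt: (zC) => /(_ _ e0)[N1 _ HN1].
  have wlt n : (N1 <= n)%N -> w n < `|iter q F 0 - p%:~R| / 2.
    by move=> /HN1; rewrite z0 /= sub0r normrN ger0_norm// fpart_ge0.
  pose n := maxn n0 N1.
  have n0n : (n0 <= n)%N by exact: leq_maxl.
  have N1n : (N1 <= n)%N by exact: leq_maxr.
  have wn0 : 0 <= w n by exact: fpart_ge0.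
  have := wS n 1 (leq_trans (leq_maxl _ _) n0n).
  rewrite /= /first_return_lift add1n => wSn.
  have := @iter_contr q 0 (w n) wn0; rewrite subr0 => /(_ _)/le_trans h.
  have {}h : iter q F (w n) - iter q F 0 <= w n.
    apply: h; last by rewrite ler_piMl// exprK_le1.
    move=> i iq; apply: Heta; last exact: ltnW.
    by rewrite wn0 HN'//; apply: leq_trans n0n; exact: leq_maxr.
  have h2 : iter q F 0 <= iter q F (w n) by exact: iter_lift_le.
  have wSn0 : 0 <= w n.+1 by exact: fpart_ge0.
  have := wlt _ N1n; have := wlt n.+1 (leq_trans N1n (leqnSn _)).
  by case: ger0P; lra.
exists (n0 * q + j)%N => i; rewrite -/(w n0).
rewrite (divn_eq i q) addnC !iterD.
have wE : iter (i %/ q * q) F (w n0) = w (i %/ q + n0)%N + (p *+ (i %/ q))%:~R.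
  by rewrite -wS ?leq_maxl// iter_return subrK.
have E0 m : iter (m * q) F 0 = (p *+ m)%:~R.
  elim: m => [|m IH] //; rewrite mulSn addnC iterD H0 -[X in iter _ F X]add0r.
  by rewrite iter_addz// IH (mulrSr p) intrD.
rewrite wE E0 -[in LHS](add0r (_%:~R)) !iter_addz// !floorDint; congr (_ + _).
apply: Heta; last by rewrite ltnW// ltn_mod.
by rewrite fpart_ge0 HN'//; rewrite (leq_trans _ (leq_addl _ _))// leq_maxr.
Qed.

(** An interval without integer inside all its images shrinks; otherwise the jump
   at an integer leaves a hole in the image. *)
Lemma iter_range_nowhere_dense gam u v : 0 < gam ->
  (forall x, x < 1 -> F x <= F 1 - gam) -> u < v ->
  exists n u' v', [/\ u <= u', u' < v', v' <= v &
    forall x, ~ (u' < iter n F x < v')].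
Proof.
move=> gam0 jump uv; apply: contrapT => nH.
(* If the ranges of all iterates were dense in the interval, pick two points of the
   range of a high iterate near its two ends: their orbits never get separated by an
   integer, so these points are too close. *)
have dense n u' v' : u <= u' -> u' < v' -> v' <= v -> exists x, u' < iter n F x < v'.
  move=> h1 h2 h3; apply: contrapT => h; apply: nH; exists n, u', v'; split=> // x hx.
  by apply: h; exists x.
pose d := (v - u) / 3; have d0 : 0 < d by rewrite /d; lra.
have [n Hn] := exprK_lt d0.
have [||x /andP[x1 x2]] := dense n.+1 u (u + d) (lexx _); [rewrite /d; lra..|].
have [|||y /andP[y1 y2]] := dense n.+1 (v - d) v; [rewrite /d; lra..|].
have xy : x < y.
  rewrite ltNge; apply/negP => /(iter_lift_le liftF n.+1); move: x2 y1; rewrite /d; lra.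
have same j : (j < n.+1)%N -> Num.floor (iter j F x) = Num.floor (iter j F y).
  move=> jn; apply/eqP; rewrite eq_le; apply/andP; split.
    by rewrite le_floor// iter_lift_le// ltW.
  rewrite leNgt; apply/negP => lt.
  pose N := Num.floor (iter j F y).
  have FN : F N%:~R = F 1 + (N - 1)%:~R.
    by rewrite -lift_addz// intrB addrC subrK.
  have below w : w < N%:~R -> F w <= F N%:~R - gam.
    move=> wN; have := jump (w - (N - 1)%:~R); rewrite FN.
    have -> : F (w - (N - 1)%:~R) = F w - (N - 1)%:~R by exact: (iter_subz liftF 1).
    by rewrite ltrBlDr -{1}[1]/(1%:~R) -intrD addrC subrK => /(_ wN); lra.
  have E z : iter n.+1 F z = iter (n - j) F (F (iter j F z)).
    by rewrite -iterS -iterD addnS subnK.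
  have [|||z /andP[z1 z2]] := dense n.+1 (iter (n - j) F (F N%:~R - gam))
      (iter (n - j) F (F N%:~R)).
  - apply/ltW/(lt_le_trans x1); rewrite E; apply: iter_lift_le => //.
    by apply: below; rewrite -floor_lt_int.
  - by apply: iter_lift_lt => //; lra.
  - apply/ltW/(le_lt_trans _ y2); rewrite E; apply: iter_lift_le => //.
    by apply: lift_le => //; exact: floor_le.
  move: z1 z2; rewrite !E => z1 z2.
  have [zN|Nz] := ltP (iter j F z) N%:~R.
  - have := iter_lift_le liftF (n - j) (below _ zN); lra.
  - have := iter_lift_le liftF (n - j) (lift_le liftF Nz); lra.
have := iter_contr (ltW xy) same.
have yx1 : y - x < 1.
  by have /(floor_eqP) := same 0%N (ltn0Sn _); have := fpart_ge0 x; have := fpart_lt1 y; rewrite /=; lra.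
have : kap ^+ n.+1 * (y - x) <= kap ^+ n.
  have := exprK_anti (leqnSn n); have : 0 <= kap ^+ n.+1 by exact: exprn_ge0.
  nra.
move: x2 y1 Hn; rewrite /d; lra.
Qed.

Lemma accum_nowhere_dense gam u v : 0 < gam ->
  (forall x, x < 1 -> F x <= F 1 - gam) -> u < v ->
  exists u' v', [/\ u <= u', u' < v', v' <= v &
    forall y z b, accum y z b -> ~ (u' < z < v')].
Proof.
move=> gam0 jump uv.
have [n [u' [v' [uu' u'v' v'v H]]]] := iter_range_nowhere_dense gam0 jump uv.
exists u', v'; split=> // y z b A /andP[zu zv].
have [|m nm [hz _]] := A (Num.min (z - u') (v' - z)) _ n.
  by rewrite lt_min !subr_gt0 zu.
move: hz; rewrite lt_min !ltr_norml => /andP[/andP[? ?] /andP[? ?]].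
apply: (H (iter (m - n) F y - (Num.floor (iter m F y))%:~R)).
rewrite iter_subz// -iterD subnKC// -/(orb y m).
have -> : iter m F y - (Num.floor (iter m F y))%:~R = orb y m by [].
by apply/andP; split; lra.
Qed.

End Contraction.

Lemma accum_itv y z b : accum y z b -> 0 <= z <= 1.
Proof.
move=> A; apply/andP; split; rewrite leNgt; apply/negP => z0.
- have [|n _ [h _]] := A (- z) _ 0%N; first lra.
  by have := fpart_ge0 (iter n F y); move: h; rewrite /orb ltr_norml => /andP[]; lra.
- have [|n _ [h _]] := A (z - 1) _ 0%N; first lra.
  by have := fpart_lt1 (iter n F y); move: h; rewrite /orb ltr_norml => /andP[]; lra.
Qed.

End LiftOrbits.

(** The points that reach an integer form a countable set. *)
Lemma exists_aperiodic_itinerary {R : realType} (F : R -> R) :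
  monotone_lift F -> exists t, forall n (k : int), iter n F t != k%:~R.
Proof.
move=> liftF; apply: contrapT => H.
pose B (nk : nat * int) : set R := [set t | iter nk.1 F t = nk.2%:~R].
have cT : countable [set: R].
  have -> : [set: R] = \bigcup_(nk in [set: nat * int]) B nk.
    rewrite eqEsubset; split=> // t _; apply: contrapT => nt.
    apply: H; exists t => n k; apply/eqP => tk; apply: nt.
    by exists (n, k).
  apply: bigcup_countable => // nk _; apply: finite_set_countable.
  have [->|/set0P[t0 Bt0]] := eqVneq (B nk) set0; first exact: finite_set0.
  apply: (@sub_finite_set _ _ [set t0]); last exact: finite_set1.
  move=> t Bt; apply/eqP; move: Bt Bt0; rewrite /B /= => <- /eqP.
  by apply: contraTT => /lt_total/orP[] /(iter_lift_lt liftF nk.1) h;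
    rewrite ?(gt_eqF h) ?(lt_eqF h).
have c01 : countable (`[0, 1]%classic : set R).
  by apply: sub_countable cT; exact: subset_card_le.
have := countable_lebesgue_measure0 c01.
by rewrite lebesgue_measure_itv /= lte_fin ltr01 oppr0 adde0 => /eqP; rewrite onee_eq0.
Qed.

(** * Cantor sets in the plane *)

Section Homeomorphisms.
Context {S T U : topologicalType}.

Lemma homeomorphic_sets_sym (A : set S) (B : set T) :
  homeomorphic_sets A B -> homeomorphic_sets B A.
Proof. by case=> f [g [[fS gS] fK gK cf cg]]; exists g, f; split. Qed.

Lemma homeomorphic_sets_trans (A : set S) (B : set T) (C : set U) :
  homeomorphic_sets A B -> homeomorphic_sets B C -> homeomorphic_sets A C.
Proof.
case=> f [g [[fS gS] fK gK cf cg]] [h [k [[hS kS] hK kK ch ck]]].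
have comp (X Y Z : topologicalType) (P : set X) (Q : set Y) (u : X -> Y) (v : Y -> Z) :
    set_fun P Q u -> {within P, continuous u} -> {within Q, continuous v} ->
    {within P, continuous (v \o u)}.
  move=> PQ /subspace_continuousP cu /subspace_continuousP cv.
  apply/subspace_continuousP => x Px; apply: (cvg_comp _ _ _ (cv _ (PQ _ Px))).
  move=> W; rewrite withinE /= => -[V Vn VQ]; have := cu x Px V Vn.
  rewrite /= !nbhs_simpl /= /within /=; apply: filterS => y Hy Py.
  have : (V `&` Q) (u y) by split; [exact: Hy|exact: PQ].
  by rewrite -VQ => -[].
exists (h \o f), (g \o k); split.
- by split=> x Ax /=; [apply/hS/fS|apply/gS/kS].
- move=> x /set_mem Ax /=; rewrite hK ?fK//; first exact/mem_set.
  by apply/mem_set/fS.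
- move=> x /set_mem Cx /=; rewrite gK ?kK//; first exact/mem_set.
  by apply/mem_set/kS.
- exact: (comp _ _ _ _ B).
- exact: (comp _ _ _ _ B).
Qed.

End Homeomorphisms.

Definition isolated_free (R : realType) (M : pseudoMetricType R) (K : set M) :=
  forall w, K w -> forall e : R, 0 < e -> exists w', [/\ K w', w' <> w & ball w e w'].

Definition clopen_separated (M : topologicalType) (K : set M) :=
  forall w w', K w -> K w' -> w <> w' -> exists U V : set M,
    [/\ open U, open V, K `<=` U `|` V, K `&` (U `&` V) = set0 & U w /\ V w'].

(** With the subspace topology [K] is compact, perfect and zero dimensional, which
   characterizes the Cantor space up to homeomorphism. *)
Lemma cantor_space_homeomorphic (R : realType) (M : pseudoMetricType R) (K : set M) :
  hausdorff_space M -> K !=set0 -> compact K -> isolated_free K ->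
  clopen_separated K -> homeomorphic_sets [set: cantor_space] K.
Proof.
move=> hM [w0 Kw0] cK pK sK.
pose x0 : K := exist _ w0 (mem_set Kw0).
pose KT : pseudoMetricType R := set_type K.
pose T : pseudoPMetricType R := HB.pack (set_type K) KT (isPointed.Build (set_type K) x0).
have nbT (x : T) (B : set T) : nbhs x B <->
    exists2 B', nbhs (set_val x) B' & set_val @^-1` B' `<=` B.
  split.
    case=> _ /= [[W oW <-] Wx sWB]; exists W => //.
    exact: open_nbhs_nbhs.
  case=> B' nB' sB; rewrite nbhsE in nB'; case: nB' => W [oW Wx] WB'.
  exists (set_val @^-1` W); split=> //; first by exists W.
  by move=> y Wy; apply: sB; exact: WB'.
have val_K (x : T) : K (set_val x) by apply: set_mem; exact: (valP x).
have cT : @cantor_like T.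
  split.
  - apply/perfectTP => x ox.
    have /nbT[B' /nbhs_ballP[e /= e0 be] sB] : nbhs x [set x].
      by apply: open_nbhs_nbhs.
    have [w' [Kw' w'x bw']] := pK _ (val_K x) e e0.
    have := sB (exist _ w' (mem_set Kw')) (be _ bw').
    by move=> /(congr1 set_val).
  - move=> F FF _.
    have FK : F (set_val @^-1` K) by apply: (@filterS _ F _ setT) => [x _|]; [exact: val_K|exact: filterT].
    have [x [Kx cx]] := cK (set_val @ F) _ FK.
    exists (exist _ x (mem_set Kx)); split=> // A B FA /nbT[B' nB' sB].
    have FA' : F (set_val @^-1` (set_val @` A)).
      by apply: (@filterS _ F _ A) FA => a Aa; exists a.
    have [_ [[a Aa <-] B'a]] := cx (set_val @` A) B' FA' nB'.
    by exists a; split=> //; exact: sB.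
  - move=> x y cxy; apply: val_inj; apply: hM => A B nA nB.
    have nA' : nbhs x (set_val @^-1` A) by apply/(nbT x); exists A.
    have nB' : nbhs y (set_val @^-1` B) by apply/(nbT y); exists B.
    have [z [zA zB]] := cxy _ _ nA' nB'.
    by exists (set_val z).
  - move=> x y xy.
    have xy' : set_val x <> set_val y.
      by move=> E; move/eqP: xy; apply; exact: val_inj.
    have [U [V [oU oV KUV KUV0 [Ux Vy]]]] := sK _ _ (val_K x) (val_K y) xy'.
    exists (set_val @^-1` U); split => //.
      split; first by exists U.
      rewrite -openC; exists V => //; apply/seteqP; split=> z /= h.
        move=> Uz; have : (K `&` (U `&` V)) (set_val z) by split.
        by rewrite KUV0.
      by have [] := KUV _ (val_K z).
    move=> Uy; have : (K `&` (U `&` V)) (set_val y) by split.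
    by rewrite KUV0.
have [f [cf clf]] := homeomorphism_cantor_like cT.
have cfi : continuous (f^-1%FUN : T -> cantor_space).
  apply/continuous_closedP => A /clf; congr closed; apply/seteqP; split.
  - by move=> _ [z Az <-]; rewrite /= funK ?in_setT.
  - by move=> x /= Ax; exists (f^-1%FUN x) => //; rewrite invK ?in_setT.
pose g : M -> cantor_space := valL_ point (f^-1%FUN : K -> cantor_space).
have gE (x : K) : g (set_val x) = f^-1%FUN x.
  by have := congr1 (fun h => h x) (@valLK _ _ point K (f^-1%FUN : K -> cantor_space)).
exists (fun z => set_val (f z : K)), g; split.
- by split=> // z _; exact: (val_K (f z)).
- by move=> z _; rewrite gE funK ?in_setT.
- move=> w /set_mem Kw; have -> : w = set_val (exist _ w (mem_set Kw) : K) by [].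
  by rewrite gE invK ?in_setT.
- apply: continuous_subspaceT => z.
  apply: (@continuous_comp _ _ _ f (set_val : K -> M)); first exact: cf.
  exact: initial_continuous.
- exact/subspace_valL_continuousP'.
Qed.

Lemma separated_of_holes (R : realType) (K : set R) :
  (forall x x', K x -> K x' -> x < x' -> exists2 r, x < r < x' & ~ K r) ->
  clopen_separated K.
Proof.
move=> hole.
have cover r z : ~ K r -> K z -> z < r \/ r < z.
  move=> nKr Kz; case: (ltgtP z r) => [|| zr]; [by left|by right|].
  by exfalso; apply: nKr; rewrite -zr.
move=> w w' Kw Kw' /eqP; rewrite neq_lt => /orP[ww'|w'w].
- have [r /andP[wr rw'] nKr] := hole _ _ Kw Kw' ww'.
  exists [set z | z < r], [set z | r < z]; split=> //.
  + by move=> z Kz; have [] := cover _ _ nKr Kz; [left|right].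
  + by rewrite -subset0 => z [_ [/= h1 h2]]; have := lt_trans h1 h2; rewrite ltxx.
- have [r /andP[wr rw'] nKr] := hole _ _ Kw' Kw w'w.
  exists [set z | r < z], [set z | z < r]; split=> //.
  + by move=> z Kz; have [] := cover _ _ nKr Kz; [right|left].
  + by rewrite -subset0 => z [_ [/= h1 h2]]; have := lt_trans h1 h2; rewrite ltxx.
Qed.

Section MiddleThirds.
Context {R : realType}.
Local Notation C := (@middle_thirds R).
Local Notation thirds := (@thirds R).

Lemma thirds_itv n x : thirds n x -> 0 <= x <= 1.
Proof.
elim: n x => [//|n IH] x [y /IH /andP[y0 y1] [->|->]]; apply/andP; split; lra.
Qed.

Lemma thirdsS n x : thirds n.+1 x <-> thirds n (3 * x) \/ thirds n (3 * x - 2).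
Proof.
split=> [[y ty [->|->]]|[tx|tx]].
- by left; rewrite mulrCA divff ?mulr1// pnatr_eq0.
- by right; rewrite mulrCA divff ?mulr1 ?addrK// pnatr_eq0.
- by exists (3 * x) => //; left; field.
- by exists (3 * x - 2) => //; right; field.
Qed.

Lemma closed_thirds n : closed (thirds n).
Proof.
elim: n => [|n IH].
  have -> : thirds 0 = `[0, 1]%classic by apply/seteqP; split=> x; rewrite /= in_itv.
  exact: itv_closed.
have -> : thirds n.+1 = (fun x => 3 * x) @^-1` thirds n `|`
    (fun x => 3 * x - 2) @^-1` thirds n.
  by apply/seteqP; split=> x /thirdsS.
apply: closedU; apply: (iffLR (continuous_closedP _)) => // x.
- exact: mulrl_continuous.
- by apply: cvgB; [exact: mulrl_continuous|exact: cvg_cst].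
Qed.

Lemma middle_thirds_itv x : C x -> 0 <= x <= 1.
Proof. by move=> /(_ 0%N I). Qed.

Lemma compact_middle_thirds : compact C.
Proof.
apply: (subclosed_compact _ (@segment_compact R 0 1)).
- by apply: closed_bigI => n _; exact: closed_thirds.
- by move=> x /middle_thirds_itv; rewrite /= in_itv.
Qed.

Lemma middle_thirds_left x : C x -> C (x / 3).
Proof.
move=> Cx n _; case: n => [|n]; first by have := middle_thirds_itv Cx; rewrite /=; lra.
by exists x; [exact: Cx|left].
Qed.

Lemma middle_thirds_right x : C x -> C ((x + 2) / 3).
Proof.
move=> Cx n _; case: n => [|n]; first by have := middle_thirds_itv Cx; rewrite /=; lra.
by exists x; [exact: Cx|right].
Qed.

Lemma middle_thirdsP x : C x -> (x <= 1 / 3 /\ C (3 * x)) \/ (2 / 3 <= x /\ C (3 * x - 2)).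
Proof.
move=> Cx; have [x2|x2] := ltP x (1 / 2); [left|right].
- have H n : thirds n (3 * x).
    by have /thirdsS[//|/thirds_itv] := Cx n.+1 I; lra.
  by split=> [|n _]; [have := thirds_itv (H 0%N); lra|exact: H].
- have H n : thirds n (3 * x - 2).
    by have /thirdsS[/thirds_itv|//] := Cx n.+1 I; lra.
  by split=> [|n _]; [have := thirds_itv (H 0%N); lra|exact: H].
Qed.

Lemma middle_thirds0 : C 0.
Proof.
move=> n _; elim: n => [|n IH]; first by rewrite /= lexx ler01.
by apply/thirdsS; left; rewrite mulr0.
Qed.

Lemma middle_thirds1 : C 1.
Proof.
move=> n _; elim: n => [|n IH]; first by rewrite /= lexx ler01.
by apply/thirdsS; right; have -> : 3 * 1 - 2 = 1 :> R by ring.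
Qed.

Lemma third_lt (e : R) : 0 < e -> exists n, 3^-1 ^+ n < e :> R.
Proof.
by move=> e0; apply: exprK_lt e0; lra.
Qed.

(** The two end points 0 and 1 provide a second point at scale 1, and self-similarity
   carries it to all scales; the same induction gives the holes below. *)
Lemma middle_thirds_isolated_free : isolated_free C.
Proof.
have H n x : C x -> exists x', [/\ C x', x' <> x & `|x - x'| <= 3^-1 ^+ n].
  elim: n x => [|n IH] x Cx.
    have /andP[x0 x1] := middle_thirds_itv Cx; rewrite expr0.
    have [->|/eqP xn] := eqVneq x 0.
      by exists 1; split; [exact: middle_thirds1|lra|rewrite sub0r normrN normr1].
    exists 0; split; [exact: middle_thirds0|lra|by rewrite subr0 ger0_norm].
  have [[_ /IH]|[_ /IH]] := middle_thirdsP Cx => -[y [Cy yx xy]].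
  - exists (y / 3); split; [exact: middle_thirds_left|lra|].
    by move: xy; rewrite exprS !ler_norml; set p := _ ^+ n; lra.
  - exists ((y + 2) / 3); split; [exact: middle_thirds_right|lra|].
    by move: xy; rewrite exprS !ler_norml; set p := _ ^+ n; lra.
move=> x Cx e e0; have [n ne] := third_lt e0.
have [x' [Cx' x'x xx']] := H n x Cx; exists x'; split=> //.
by rewrite /ball /=; apply: le_lt_trans ne.
Qed.

Lemma middle_thirds_separated : clopen_separated C.
Proof.
apply: separated_of_holes.
have H n x x' : C x -> C x' -> 3^-1 ^+ n < x' - x -> exists2 r, x < r < x' & ~ C r.
  elim: n x x' => [|n IH] x x' Cx Cx' xx'.
    have := middle_thirds_itv Cx; have := middle_thirds_itv Cx'.
    by move: xx'; rewrite expr0; lra.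
  move: xx'; rewrite exprS => xx'.
  have p0 : 0 < 3^-1 ^+ n :> R by apply: exprn_gt0.
  have [[x3 C3x]|[x3 C3x]] := middle_thirdsP Cx; have [[x'3 C3x']|[x'3 C3x']] := middle_thirdsP Cx'.
  - have [|r /andP[r1 r2] nCr] := IH _ _ C3x C3x'; first by lra.
    have := middle_thirds_itv C3x; have := middle_thirds_itv C3x' => h1 h2.
    exists (r / 3); first by lra.
    move=> /middle_thirdsP[[_]|[]]; last by lra.
    by have -> : 3 * (r / 3) = r by field.
  - exists (1 / 2); first by lra.
    by move=> /middle_thirdsP[[]|[]]; lra.
  - by lra.
  - have [|r /andP[r1 r2] nCr] := IH _ _ C3x C3x'; first by lra.
    have := middle_thirds_itv C3x; have := middle_thirds_itv C3x' => h1 h2.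
    exists ((r + 2) / 3); first by lra.
    move=> /middle_thirdsP[[]|[_]]; first by lra.
    by have -> : 3 * ((r + 2) / 3) - 2 = r by field.
move=> x x' Cx Cx'; rewrite -subr_gt0 => /third_lt[n]; exact: H.
Qed.

End MiddleThirds.

(** Both [K] and the middle-thirds set are homeomorphic to the space of boolean
   sequences. *)
Lemma cantor_setI (R : realType) (K : set (R * R)) : K !=set0 -> compact K ->
  isolated_free K -> clopen_separated K -> cantor_set K.
Proof.
move=> K0 cK iK sK; apply: (@homeomorphic_sets_trans _ cantor_space _ _ [set: cantor_space]).
- apply/homeomorphic_sets_sym/cantor_space_homeomorphic.
  + exact: norm_hausdorff.
  + by exists 0; exact: middle_thirds0.
  + exact: compact_middle_thirds.
  + exact: middle_thirds_isolated_free.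
  + exact: middle_thirds_separated.
- apply: cantor_space_homeomorphic => //; exact: norm_hausdorff.
Qed.

(** * The outer billiard map near a tangent vertex *)

Section OuterBilliard.
Context {R : realType} {n : nat} (V : 'I_n -> R * R) (lam : R).
Implicit Types x : R * R.

Lemma vertex_polygon i : polygon V (V i).
Proof.
exists (fun j => (j == i)%:R); split.
- by move=> j; rewrite ler0n.
- by rewrite (bigD1 i)//= eqxx big1 ?addr0// => j /negbTE ->.
- rewrite (bigD1 i)//= eqxx scale1r big1 ?addr0// => j /negbTE ->.
  by rewrite scale0r.
Qed.

Lemma cross_convex (t : 'I_n -> R) (u x : R * R) : \sum_i t i = 1 ->
  cross u (\sum_i t i *: V i - x) = \sum_i t i * cross u (V i - x).
Proof.
move=> t1.
have fstE : (\sum_i t i *: V i).1 = \sum_i t i * (V i).1.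
  exact: (big_morph (fun p : R * R => p.1)).
have sndE : (\sum_i t i *: V i).2 = \sum_i t i * (V i).2.
  exact: (big_morph (fun p : R * R => p.2)).
rewrite /cross /= fstE sndE.
transitivity (u.1 * (\sum_i t i * (V i).2 - (\sum_i t i) * x.2) -
              u.2 * (\sum_i t i * (V i).1 - (\sum_i t i) * x.1)).
  by rewrite t1 !mul1r.
rewrite !mulr_suml -!sumrB !mulr_sumr -sumrB.
by apply: eq_bigr => i _; ring.
Qed.

Lemma outer_billiardE x i :
  (forall j, V j = V i \/ 0 < cross (V i - x) (V j - x)) ->
  outer_billiard V lam x = (1 + lam) *: V i - lam *: x.
Proof.
move=> Hi; rewrite /outer_billiard (_ : xget 0 (left_tangent V x) = V i)//.
apply: xget_unique.
  split; first by exists i.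
  move=> _ [t [t0 t1 ->]] /=; rewrite cross_convex//; apply: sumr_ge0 => j _.
  apply: mulr_ge0 => //; have [->|/ltW//] := Hi j.
  by rewrite /cross mulrC subrr.
move=> _ [[j _ <-] Hj]; have [//|ij] := Hi j.
exfalso; have /= := Hj _ (vertex_polygon i); move: ij; rewrite /cross; lra.
Qed.

End OuterBilliard.

(** * The quadrilateral *)

Section Quadrilateral.
Context {R : realType} (a : R) (ha : 3 / 10 <= a <= 6 / 10).
Local Notation lam := (4 / 5 : R).
Local Notation V := (quad a).
Local Notation T := (outer_billiard V lam).

Definition vA : 'I_4 := @Ordinal 4 0 isT.
Definition vB : 'I_4 := @Ordinal 4 1 isT.
Definition vC : 'I_4 := @Ordinal 4 2 isT.
Definition vD : 'I_4 := @Ordinal 4 3 isT.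

Lemma quadA : V vA = (0, 1). Proof. by []. Qed.
Lemma quadB : V vB = (a, 1). Proof. by []. Qed.
Lemma quadC : V vC = (1, 1 / 5). Proof. by []. Qed.
Lemma quadD : V vD = (0, 0). Proof. by []. Qed.

Lemma ordSA : ordS vA = vB. Proof. exact: val_inj. Qed.
Lemma ordSB : ordS vB = vC. Proof. exact: val_inj. Qed.
Lemma ordSC : ordS vC = vD. Proof. exact: val_inj. Qed.
Lemma ordSD : ordS vD = vA. Proof. exact: val_inj. Qed.

Lemma ord4P (P : 'I_4 -> Prop) : P vA -> P vB -> P vC -> P vD -> forall i, P i.
Proof.
move=> pA pB pC pD [[|[|[|[|//]]]] i4].
- by rewrite (_ : Ordinal i4 = vA)//; apply: val_inj.
- by rewrite (_ : Ordinal i4 = vB)//; apply: val_inj.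
- by rewrite (_ : Ordinal i4 = vC)//; apply: val_inj.
- by rewrite (_ : Ordinal i4 = vD)//; apply: val_inj.
Qed.

Lemma sum_ord4 (M : nmodType) (f : 'I_4 -> M) :
  \sum_i f i = f vA + f vB + f vC + f vD.
Proof.
by rewrite !big_ord_recr big_ord0 /= add0r; do 3?congr (_ + _); congr f; apply: val_inj.
Qed.

Lemma polygon_quad u v : polygon V (u, v) ->
  [/\ 0 <= u, v <= 1, u <= 5 * v & 4 / 5 * (u - a) + (1 - a) * (v - 1) <= 0].
Proof.
have /andP[a1 a2] := ha.
case=> t [t0]; rewrite !sum_ord4 quadA quadB quadC quadD => t1 [-> ->].
have [tA tB tC tD] := And4 (t0 vA) (t0 vB) (t0 vC) (t0 vD).
have tDE : t vD = 1 - t vA - t vB - t vC by lra.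
have taA : 0 <= a * t vA by nra.
have taD : 0 <= t vD * (1 - a / 5) by nra.
rewrite /GRing.scale /=; split; [nra|lra|nra|].
rewrite tDE in taD; nra.
Qed.

Lemma singular_quad u v : singular_set V (u, v) <->
  [\/ v = 1 /\ 0 <= u, a <= u /\ 4 / 5 * (u - a) + (1 - a) * (v - 1) = 0,
      u <= 1 /\ u = 5 * v | u = 0 /\ 0 <= v].
Proof.
have /andP[a1 a2] := ha; split.
- case=> i _; move: i; apply: ord4P => -[t t0]; rewrite ?ordSA ?ordSB ?ordSC ?ordSD
    ?quadA ?quadB ?quadC ?quadD => -[-> ->]; rewrite /GRing.scale /=.
  + by apply: Or41; split; nra.
  + by apply: Or42; split; nra.
  + by apply: Or43; split; nra.
  + by apply: Or44; split; nra.
- case=> [[-> u0]|[u0 uv]|[u0 uv]|[-> v0]].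
  + exists vA => //; exists (u / a); first by rewrite divr_ge0//; lra.
    rewrite ordSA quadA quadB; congr pair; rewrite /= /GRing.scale /=; [|by rewrite subrr mulr0 addr0].
    by rewrite subr0 add0r divfK//; apply/eqP; lra.
  + exists vB => //; exists ((u - a) / (1 - a)); first by rewrite divr_ge0//; lra.
    rewrite ordSB quadB quadC; congr pair; rewrite /= /GRing.scale /=; first by field; lra.
    have n0 : 1 - a != 0 by apply/eqP; lra.
    have := divfK n0 (u - a); set w := _ / _ => hw.
    by apply: (mulfI n0); lra.
  + exists vC => //; exists (1 - u); first lra.
    by rewrite ordSC quadC quadD; congr pair; rewrite /= /GRing.scale /=; lra.
  + exists vD => //; exists v => //.
    by rewrite ordSD quadD quadA; congr pair; rewrite /= /GRing.scale /=; lra.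
Qed.

Definition vertex_image (k : 'I_4) (x : R * R) : R * R := (1 + lam) *: V k - lam *: x.

Local Ltac tangency i := rewrite (@outer_billiardE _ _ _ _ _ i);
  [by []
  |apply: ord4P; rewrite ?quadA ?quadB ?quadC ?quadD;
   first [by left|right; rewrite /cross /=; nra]].

(** The lines of the sides cut the complement of the quadrilateral into the four
   regions where a given vertex is tangent, and where the map is affine. *)
Lemma region_D u v : u < 0 -> u < 5 * v ->
  defined_at V (u, v) /\ T (u, v) = vertex_image vD (u, v).
Proof.
have /andP[a1 a2] := ha; move=> u0 uv; split; last by tangency vD.
case=> [/polygon_quad[]|/singular_quad[]]; lra.
Qed.

Lemma region_A u v : 0 < u -> 1 < v ->
  defined_at V (u, v) /\ T (u, v) = vertex_image vA (u, v).
Proof.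
have /andP[a1 a2] := ha; move=> u0 v1; split; last by tangency vA.
case=> [/polygon_quad[]|/singular_quad[]]; nra.
Qed.

Lemma region_B u v : v < 1 -> 0 < 4 / 5 * (u - a) + (1 - a) * (v - 1) ->
  defined_at V (u, v) /\ T (u, v) = vertex_image vB (u, v).
Proof.
have /andP[a1 a2] := ha; move=> v1 uv; split; last by tangency vB.
case=> [/polygon_quad[]|/singular_quad[]]; nra.
Qed.

Lemma region_C u v : 5 * v < u -> 4 / 5 * (u - a) + (1 - a) * (v - 1) < 0 ->
  defined_at V (u, v) /\ T (u, v) = vertex_image vC (u, v).
Proof.
have /andP[a1 a2] := ha; move=> v1 uv; split; last by tangency vC.
case=> [/polygon_quad[]|/singular_quad[]]; nra.
Qed.

Lemma ball2P (w z : R * R) (r : R) :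
  ball w r z <-> `|w.1 - z.1| < r /\ `|w.2 - z.2| < r.
Proof. by []. Qed.

Lemma vertex_image_continuous k : continuous (vertex_image k).
Proof.
by move=> x; apply: cvgB; [exact: cvg_cst|apply: cvgZr; exact: cvg_id].
Qed.

(** A one-sided value is found by exhibiting a small ball in which the defined
   points on the given side all have the same tangent vertex. *)
Lemma T_value_side (i k : 'I_4) (b : bool) (w d : R * R) (r : R) :
  ray (V i) (V (ordS i)) w -> 0 < r -> `|d.1| <= 1 -> `|d.2| <= 1 ->
  let side := [set z | 0 < (-1) ^+ b * cross (V (ordS i) - V i) (z - w)] in
  (forall z, ball w r z -> side z -> defined_at V z -> T z = vertex_image k z) ->
  (forall t, 0 < t < r -> side (w.1 + t * d.1, w.2 + t * d.2) /\
     defined_at V (w.1 + t * d.1, w.2 + t * d.2)) ->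
  T_value V lam w (vertex_image k w).
Proof.
move=> rw r0 d1 d2 side HT Hd; right; split; first by exists i.
exists i, b; split=> //.
- move=> B /nbhs_ballP[e /= e0 eB].
  pose t := Num.min e r / 2.
  have m0 : 0 < Num.min e r by rewrite lt_min e0.
  have t0 : 0 < t by rewrite divr_gt0.
  have te : t < e.
    by rewrite ltr_pdivrMr// gt_min ltr_pMr// ltr1n.
  have tr : t < r.
    by rewrite ltr_pdivrMr// gt_min [X in _ || X]ltr_pMr// ltr1n orbT.
  have [|h1 h2] := Hd t; first by rewrite t0.
  exists (w.1 + t * d.1, w.2 + t * d.2); split=> //.
  have tE x y : `|x - (x + t * y)| = t * `|y|.
    by rewrite opprD addrA subrr sub0r normrN normrM (gtr0_norm t0).
  apply: eB; apply/ball2P; rewrite /= !tE.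
  by split; apply: le_lt_trans te; rewrite ler_piMr// ltW.
- apply: (@cvg_trans _ (vertex_image k z @[z --> within (side `&` defined_at V) (nbhs w)])).
    apply: near_eq_cvg; apply/nbhs_ballP; exists r => // z wz [sz dz].
    exact/esym/HT.
  by apply: cvg_within_filter; exact: vertex_image_continuous.
Qed.

Lemma polygon_corner_A u v : 0 <= u -> u <= a * v -> v <= 1 -> polygon V (u, v).
Proof.
have /andP[a1 a2] := ha; move=> u0 uv v1.
have ua : u / a <= v by rewrite ler_pdivrMr ?[v * a]mulrC//; lra.
have ua0 : 0 <= u / a by rewrite divr_ge0//; lra.
exists (fun i => if i == vA then v - u / a else if i == vB then u / a
  else if i == vC then 0 else 1 - v); split.
- by apply: ord4P => /=; lra.
- by rewrite sum_ord4 /=; ring.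
- rewrite sum_ord4 quadA quadB quadC quadD /=; congr pair; rewrite /= /GRing.scale /=.
    by rewrite divfK; [ring|apply/eqP; lra].
  by ring.
Qed.

Lemma T_value_defined x y : defined_at V x /\ T x = y -> T_value V lam x y.
Proof. by left. Qed.

(** At the vertex [A] the ray from [A] to [B] gives no one-sided value on its upper side,
   since two regions meet there; the ray from [D] to [A] separates them, and yields
   both values. *)
Lemma T_value_D u : u <= 0 -> T_value V lam (u, 1) (vertex_image vD (u, 1)).
Proof.
have /andP[a1 a2] := ha; rewrite le_eqVlt => /predU1P[->|u0].
- apply: (@T_value_side vD vD false (0, 1) (-1, 0) (1 / 10)).
  + exists 1 => //; rewrite ordSD quadD quadA.
    by congr pair; rewrite /= /GRing.scale /=; ring.
  + lra.
  + by rewrite /= normrN normr1.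
  + by rewrite /= normr0.
  + rewrite ordSD quadD quadA => -[u' v] /ball2P[/=]; rewrite !ltr_norml /cross /= => /andP[? ?] /andP[? ?] ? _.
    by apply: (region_D _ _).2 => //; lra.
  + rewrite ordSD quadD quadA => t tr /=; rewrite /cross /=; split; first lra.
    by apply: (region_D _ _).1; lra.
- by apply/T_value_defined/region_D => //; lra.
Qed.

Lemma T_value_A u : 0 <= u -> T_value V lam (u, 1) (vertex_image vA (u, 1)).
Proof.
have /andP[a1 a2] := ha; rewrite le_eqVlt => /predU1P[<-|u0].
- apply: (@T_value_side vD vA true (0, 1) (1, 1) (1 / 10)).
  + exists 1 => //; rewrite ordSD quadD quadA.
    by congr pair; rewrite /= /GRing.scale /=; ring.
  + lra.
  + by rewrite /= normr1.
  + by rewrite /= normr1.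
  + rewrite ordSD quadD quadA => -[u' v] /ball2P[/=].
    rewrite !ltr_norml /cross /= => /andP[? ?] /andP[? ?] ? dz.
    have [v1|v1] := ltP 1 v.
      by apply: (region_A _ _).2 => //; lra.
    by exfalso; apply: dz; left; apply: polygon_corner_A => //; nra.
  + rewrite ordSD quadD quadA => t tr /=; rewrite /cross /=; split; first lra.
    by apply: (region_A _ _).1; lra.
- apply: (@T_value_side vA vA false (u, 1) (0, 1) u) => //.
  + exists (u / a); first by rewrite divr_ge0//; lra.
    rewrite ordSA quadA quadB; congr pair; rewrite /= /GRing.scale /=; last by ring.
    by rewrite subr0 add0r divfK//; apply/eqP; lra.
  + by rewrite /= normr0.
  + by rewrite /= normr1.
  + rewrite ordSA quadB quadA => -[u' v] /ball2P[/=].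
    rewrite !ltr_norml /cross /= => /andP[? ?] /andP[? ?] h _.
    have v1 : 1 < v by nra.
    by apply: (region_A _ _).2 => //; lra.
  + rewrite ordSA quadB quadA => t tr /=; rewrite /cross /=; split; first nra.
    by apply: (region_A _ _).1; lra.
Qed.

Lemma T_value_B u : a < u -> T_value V lam (u, 1) (vertex_image vB (u, 1)).
Proof.
have /andP[a1 a2] := ha; move=> u0.
apply: (@T_value_side vA vB true (u, 1) (0, -1) ((u - a) / 3)) => //.
- exists (u / a); first by rewrite divr_ge0//; lra.
  rewrite ordSA quadA quadB; congr pair; rewrite /= /GRing.scale /=; last by ring.
  by rewrite subr0 add0r divfK//; apply/eqP; lra.
- lra.
- by rewrite /= normr0.
- by rewrite /= normrN normr1.
- rewrite ordSA quadB quadA => -[u' v] /ball2P[/=].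
  rewrite !ltr_norml /cross /= => /andP[? ?] /andP[? ?] h _.
  have v1 : v < 1 by nra.
  by apply: (region_B _ _).2 => //; nra.
- rewrite ordSA quadB quadA => t tr /=; rewrite /cross /=; split; first nra.
  by apply: (region_B _ _).1; nra.
Qed.

Lemma T_value_C u v : 5 * v < u -> 4 / 5 * (u - a) + (1 - a) * (v - 1) < 0 ->
  T_value V lam (u, v) (vertex_image vC (u, v)).
Proof.
by move=> h1 h2; exact/T_value_defined/region_C.
Qed.

(** ** Excursions from the line through the top side *)

(** The two one-sided values of [exc_end] at 0 are [sA] and [sA + len_circle]: excursions
   end between them. *)
Definition sA : R := 9 / 5 * a - 36 / 25.
Definition len_circle : R := 2304 / 3125.

Definition exc_len (b : bool) := if b then 4%N else 6%N.

Definition exc_vertex (b : bool) : nat -> 'I_4 :=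
  nth vA (if b then [:: vA; vD; vC; vB] else [:: vD; vC; vA; vD; vC; vB]).

Definition exc_pt0 (b : bool) : nat -> R * R :=
  nth 0 (if b then
    [:: (0, 1); (0, 1); (0, - (4 / 5)); (9 / 5, 1); (sA, 1)]
  else
    [:: (0, 1); (0, - (4 / 5)); (9 / 5, 1); (- (36 / 25), 1);
        (144 / 125, - (4 / 5)); (549 / 625, 1); (sA + len_circle, 1)]).

Definition exc_slope (b : bool) : nat -> R * R :=
  nth 0 (if b then
    [:: (1, 1); (- (4 / 5), - (4 / 5)); (16 / 25, 16 / 25);
        (- (64 / 125), - (64 / 125)); (256 / 625, 256 / 625)]
  else
    [:: (1, 1); (- (4 / 5), - (4 / 5)); (16 / 25, 16 / 25);
        (- (64 / 125), - (64 / 125)); (256 / 625, 256 / 625);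
        (- (1024 / 3125), - (1024 / 3125)); (4096 / 15625, 4096 / 15625)]).

(** The successive points of the orbit of [(s, 1 + h)] until it comes back just above
   the line through [A] and [B], when [b] tells whether [0 < s]: the coordinates
   are affine functions of [s] and [h]. *)
Definition exc (b : bool) (i : nat) (s h : R) : R * R :=
  ((exc_pt0 b i).1 + (exc_slope b i).1 * s, (exc_pt0 b i).2 + (exc_slope b i).2 * h).

Definition exc_end (b : bool) (s : R) : R :=
  if b then sA + 256 / 625 * s else sA + len_circle + 4096 / 15625 * s.

Lemma exc0 b s h : exc b 0 s h = (s, 1 + h).
Proof. by case: b; rewrite /exc /= add0r !mul1r. Qed.

Lemma exc_endE b s h :
  exc b (exc_len b) s h = (exc_end b s, 1 + (exc_slope b (exc_len b)).2 * h).
Proof. by case: b. Qed.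

Lemma exc_vertex_image b i s h : (i < exc_len b)%N ->
  exc b i.+1 s h = vertex_image (exc_vertex b i) (exc b i s h).
Proof.
by case: b i => -[|[|[|[|[|[|//]]]]]]//= _; rewrite /exc_vertex /vertex_image /=
  ?quadA ?quadB ?quadC ?quadD /exc /= /sA /len_circle;
  congr pair; rewrite /= /GRing.scale /=; field.
Qed.

Lemma ellE : ell lam a = 5 / 4 + (1 - a) * (25 / 16).
Proof. by rewrite /ell invf_div; field. Qed.

Lemma exc_defined b i s h : (i < exc_len b)%N -> b = (0 < s) -> s != 0 ->
  - ell lam a < s <= a -> 0 < h < 1 / 100 ->
  defined_at V (exc b i s h) /\ T (exc b i s h) = exc b i.+1 s h.
Proof.
have /andP[a1 a2] := ha; move=> ib bs s0; rewrite ellE => /andP[s1 s2] /andP[h1 h2].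
rewrite exc_vertex_image//.
have sb : if b then 0 < s else s < 0.
  by rewrite bs; case: ltgtP s0.
move: b i ib sb {bs s0} => -[] [|[|[|[|[|[|//]]]]]]//= _ sb;
  rewrite /exc_vertex /exc /=.
- by apply: region_A; lra.
- by apply: region_D; lra.
- by apply: region_C; nra.
- by apply: region_B; nra.
- by apply: region_D; lra.
- by apply: region_C; nra.
- by apply: region_A; lra.
- by apply: region_D; lra.
- by apply: region_C; nra.
- by apply: region_B; nra.
Qed.

Lemma exc_T_value b i z : (i < exc_len b)%N -> (if b then 0 <= z else z <= 0) ->
  sA <= z <= sA + len_circle ->
  T_value V lam (exc b i z 0) (exc b i.+1 z 0).
Proof.
have /andP[a1 a2] := ha; move=> ib zb; rewrite /sA /len_circle => /andP[z1 z2].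
rewrite exc_vertex_image//.
move: b i ib zb => -[] [|[|[|[|[|[|//]]]]]]//= _ zb;
  rewrite /exc_vertex /exc /= !mulr0 !addr0.
- by apply: T_value_A; lra.
- by apply: T_value_D; lra.
- by apply: T_value_C; nra.
- by apply: T_value_B; nra.
- by apply: T_value_D; lra.
- by apply: T_value_C; nra.
- by apply: T_value_A; lra.
- by apply: T_value_D; lra.
- by apply: T_value_C; nra.
- by apply: T_value_B; nra.
Qed.
End Quadrilateral.

(** * Orbits as concatenations of excursions *)

Lemma cluster_seqP (R : realType) (M : pseudoMetricType R) (u : nat -> M) (w : M) :
  cluster (u k @[k --> \oo]) w <->
  forall (e : R), 0 < e -> forall N, exists2 n, (N <= n)%N & ball w e (u n).
Proof.
split=> [cw e e0 N|H A B [N _ NA] /nbhs_ballP[e /= e0 eB]].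
- have [_ [[n /= Nn <-] bn]] := cw (u @` [set n | (N <= n)%N]) (ball w e)
    (ex_intro2 _ _ N I (fun n Nn => ex_intro2 _ _ n Nn erefl)) (nbhsx_ballx _ _ e0).
  by exists n.
- have [n Nn bn] := H e e0 N.
  by exists (u n); split; [exact: NA|exact: eB].
Qed.

Lemma pigeonhole_frequently (C : finType) (P : nat -> nat -> C -> Prop) :
  (forall k k' n c, (k <= k')%N -> P k' n c -> P k n c) ->
  (forall k, exists2 n, (k <= n)%N & exists c, P k n c) ->
  exists c, forall k, exists2 n, (k <= n)%N & P k n c.
Proof.
move=> Pmono H; apply: contrapT => nH.
have no c : exists k, forall n, (k <= n)%N -> ~ P k n c.
  apply: contrapT => h; apply: nH; exists c => k; apply: contrapT => h'.
  by apply: h; exists k => n kn Pn; apply: h'; exists n.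
have [f Hf] := choice no.
have [n Kn [c Pc]] := H (\max_c f c)%N.
have fK : (f c <= \max_c f c)%N by exact: leq_bigmax.
by apply: (Hf c n (leq_trans fK Kn)); exact: Pmono Pc.
Qed.

Lemma invn_lt (R : realType) (e : R) : 0 < e -> exists k : nat, k.+1%:R^-1 < e.
Proof.
move=> e0; have [k hk] := nat_gt e^-1; exists k.
rewrite invf_plt ?posrE ?ltr0Sn//; apply: (lt_le_trans hk).
by rewrite ler_nat.
Qed.

Section Schedule.
Context (b : nat -> bool).

(** Time [j] falls at step [(sched j).2] of excursion number [(sched j).1]. *)
Fixpoint sched (j : nat) : nat * nat :=
  if j is j'.+1 then
    let: (k, i) := sched j' in
    if (i.+1 < exc_len (b k))%N then (k, i.+1) else (k.+1, 0%N)
  else (0%N, 0%N).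

Lemma sched_lt j : ((sched j).2 < exc_len (b (sched j).1))%N.
Proof.
elim: j => [|j] /=; first by case: (b 0%N).
by case: (sched j) => k i /= _; case: ifP => //= _; case: (b k.+1).
Qed.

Lemma schedS j : let: (k, i) := sched j in
  ((i.+1 < exc_len (b k))%N /\ sched j.+1 = (k, i.+1)) \/
  (i.+1 = exc_len (b k) /\ sched j.+1 = (k.+1, 0%N)).
Proof.
have := sched_lt j; rewrite /=; case: (sched j) => k i /=.
rewrite leq_eqVlt => /orP[/eqP E|lt].
  by right; rewrite E ltnn.
by left; rewrite lt.
Qed.

Lemma sched_row j k i : sched j = (k, 0%N) -> (i < exc_len (b k))%N ->
  sched (j + i) = (k, i).
Proof.
move=> jk; elim: i => [|i IH] ik; first by rewrite addn0.
by rewrite addnS /= IH ?ik// ltnW.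
Qed.

Lemma sched_start k : exists2 j, (k <= j)%N & sched j = (k, 0%N).
Proof.
elim: k => [|k [j kj jk]]; first by exists 0%N.
have len0 : (0 < exc_len (b k))%N by case: (b k).
exists (j + exc_len (b k))%N; first lia.
have := @sched_row j k (exc_len (b k)).-1 jk.
rewrite prednK// leqnn => /(_ isT) h.
rewrite -[exc_len (b k)]prednK// addnS /= h prednK// ltnn //.
Qed.

Lemma sched_cover k i : (i < exc_len (b k))%N -> exists2 j, (k <= j)%N & sched j = (k, i).
Proof.
have [j kj jk] := sched_start k => ik.
by exists (j + i)%N; [lia|exact: sched_row].
Qed.

Lemma sched_mono j j' : (j <= j')%N -> ((sched j).1 <= (sched j').1)%N.
Proof.
move=> /subnK <-; elim: (j' - j)%N => // n IH; apply: (leq_trans IH).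
rewrite addSn; have := schedS (n + j); case: (sched (n + j)) => k i.
by move=> [[_ ->]|[_ ->]].
Qed.

Lemma sched_infty k : exists J, forall j, (J <= j)%N -> (k <= (sched j).1)%N.
Proof.
have [J _ Jk] := sched_start k; exists J => j /sched_mono.
by rewrite Jk.
Qed.

End Schedule.

Section OmegaLimit.
Context {R : realType} (a : R) (ha : 3 / 10 <= a <= 6 / 10).
Local Notation lam := (4 / 5 : R).
Local Notation V := (quad a).
Local Notation T := (outer_billiard V lam).
Local Notation exc := (exc a).
Local Notation len := (@len_circle R).
Local Notation slope := (@exc_slope R).

Definition circ_pt (t : R) : R := sA a + len * t.

Definition exc_union (L : R -> bool -> Prop) : set (R * R) :=
  [set w | exists b i z, [/\ (i < exc_len b)%N, L z b & w = exc b i (circ_pt z) 0]].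

Definition frequent (t : nat -> R) (b : nat -> bool) (z : R) (c : bool) :=
  forall e, 0 < e -> forall N, exists2 n, (N <= n)%N & `|t n - z| < e /\ b n = c.

Lemma exc_slope_bounds b i : (i < exc_len b)%N ->
  1 / 4 <= `|(slope b i).1| <= 1 /\ `|(slope b i).2| <= 1.
Proof.
by case: b i => -[|[|[|[|[|[|//]]]]]] //= _;
   rewrite ?normr1 ?normrN ?[`|_ / _|]ger0_norm; try lra; split; lra.
Qed.

Context (t h : nat -> R) (b : nat -> bool) (x : R * R).
Hypothesis itinerary : forall j, iter j T x =
  exc (b (sched b j).1) (sched b j).2 (circ_pt (t (sched b j).1)) (h (sched b j).1).
Hypothesis h_cvg0 : forall e, 0 < e -> exists N, forall n, (N <= n)%N -> `|h n| < e.

(** An accumulation point of the orbit is approached along a fixed step of excursions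
   with a fixed symbol; as this step is an injective affine function of the starting
   point, the starting points converge as well. *)
Lemma omega_exc_union : omega_limit V lam x = exc_union (frequent t b).
Proof.
have L0 : 0 < len < 1 by rewrite /len_circle; lra.
apply/seteqP; split=> w.
- move=> /cluster_seqP Hw.
  pose P (k j : nat) (ci : bool * 'I_6) :=
    [/\ (ci.2 < exc_len ci.1)%N, b (sched b j).1 = ci.1, (sched b j).2 = ci.2 &
        ball w (k.+1%:R^-1) (iter j T x)].
  have [k k' n c kk' [P1 P2 P3 P4]|k|[c i] Hc] := @pigeonhole_frequently _ P.
  + split=> //; apply: le_ball P4; rewrite lef_pV2 ?posrE ?ltr0Sn// ler_nat.
    by rewrite ltnS.
  + have [|n kn bn] := Hw (k.+1%:R^-1) _ k; first by rewrite invr_gt0 ltr0Sn.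
    exists n => //; have lt := sched_lt b n.
    have lt6 : ((sched b n).2 < 6)%N by apply: leq_trans lt _; case: (b _).
    by exists (b (sched b n).1, Ordinal lt6).
  have ic : (i < exc_len c)%N by have [n _ []] := Hc 0%N.
  have [/andP[sl1 sl2] sl3] := exc_slope_bounds ic.
  set sl := (slope c i).1 in sl1 sl2.
  have sl0 : sl != 0 by rewrite -normr_gt0; apply: lt_le_trans sl1; lra.
  pose z := ((w.1 - (exc_pt0 a c i).1) / sl - sA a) / len.
  have w1 : w.1 = (exc_pt0 a c i).1 + sl * circ_pt z.
    by rewrite /circ_pt /z; field; rewrite sl0 gt_eqF//; case/andP: L0.
  have near e N : 0 < e -> exists2 n, (N <= n)%N & [/\ b n = c,
      `|w.1 - ((exc_pt0 a c i).1 + sl * circ_pt (t n))| < e &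
      `|w.2 - ((exc_pt0 a c i).2 + (slope c i).2 * h n)| < e].
    move=> e0; have [k ke] := invn_lt e0.
    have [J HJ] := sched_infty b N.
    have [j kj [_ bj sj]] := Hc (maxn k J).
    rewrite itinerary bj sj => /ball2P[/= b1 b2].
    have mk : (maxn k J).+1%:R^-1 <= k.+1%:R^-1 :> R.
      by rewrite lef_pV2 ?posrE ?ltr0Sn// ler_nat ltnS leq_maxl.
    exists (sched b j).1; first by apply: HJ; apply: leq_trans kj; exact: leq_maxr.
    by split=> //; [apply: lt_trans (lt_le_trans b1 mk) ke|apply: lt_trans (lt_le_trans b2 mk) ke].
  exists c, i, z; split=> //.
  + move=> e e0 N.
    have /andP[l0 l1] := L0.
    have [|n Nn [bn n1 _]] := near (e * len / 4) N; first by apply: divr_gt0 => //; exact: mulr_gt0.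
    exists n => //; split=> //.
    move: n1; rewrite w1 /circ_pt.
    have -> : (exc_pt0 a c i).1 + sl * (sA a + len * z) -
      ((exc_pt0 a c i).1 + sl * (sA a + len * t n)) =
      - (sl * (len * (t n - z))) by ring.
    rewrite normrN normrM [`|len * _|]normrM (gtr0_norm l0).
    have := normr_ge0 (t n - z); set d := `|t n - z| => d0.
    move=> H; have H1 : 1 / 4 * (len * d) <= `|sl| * (len * d).
      by rewrite ler_wpM2r// mulr_ge0// ltW.
    rewrite -(ltr_pM2l l0); lra.
  + rewrite {1}[w]surjective_pairing /exc w1 mulr0 addr0; congr pair.
    apply: contrapT => /eqP w2.
    have d0 : 0 < `|w.2 - (exc_pt0 a c i).2| / 2.
      by rewrite divr_gt0// normr_gt0 subr_eq0.
    have [M HM] := h_cvg0 d0; have [n /HM hn [_ _]] := near _ M d0.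
    have hs : `|(slope c i).2 * h n| < `|w.2 - (exc_pt0 a c i).2| / 2.
      by rewrite normrM; apply: le_lt_trans hn; rewrite ler_piMl.
    have := ler_normD (w.2 - ((exc_pt0 a c i).2 + (slope c i).2 * h n)) ((slope c i).2 * h n).
    rewrite opprD addrA subrK; lra.
- move=> [c [i [z [ic fz ->]]]]; apply/cluster_seqP => e e0 N.
  have [/andP[sl1 sl2] sl3] := exc_slope_bounds ic.
  have [M HM] := h_cvg0 e0.
  have [n nN [tz bn]] := fz e e0 (maxn N M).
  rewrite -bn in ic sl1 sl2 sl3 *.
  have [j nj sj] := sched_cover ic.
  exists j; first by apply: leq_trans nj; apply: leq_trans nN; exact: leq_maxl.
  rewrite itinerary sj; apply/ball2P; rewrite /=; split.
  + rewrite /circ_pt.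
    have -> : (exc_pt0 a (b n) i).1 + (slope (b n) i).1 * (sA a + len * z) -
      ((exc_pt0 a (b n) i).1 + (slope (b n) i).1 * (sA a + len * t n)) =
      - ((slope (b n) i).1 * (len * (t n - z))) by ring.
    rewrite normrN normrM [`|len * _|]normrM; apply: le_lt_trans tz.
    have /andP[l0 l1] := L0; rewrite (gtr0_norm l0) mulrA ler_piMl//.
    by rewrite mulr_ile1// ltW.
  + rewrite mulr0 addr0 opprD addNKr normrN normrM.
    apply: le_lt_trans (HM n _); first by rewrite ler_piMl.
    by apply: leq_trans nN; exact: leq_maxr.
Qed.
End OmegaLimit.

(** * The first return as a circle map *)

Section QuadLift.
Context {R : realType} (a : R) (ha : 3 / 10 <= a <= 6 / 10).
Local Notation lam := (4 / 5 : R).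
Local Notation V := (quad a).
Local Notation T := (outer_billiard V lam).
Local Notation exc := (exc a).
Local Notation pt := (circ_pt a).
Local Notation len := (@len_circle R).
Local Notation kap := (256 / 625 : R).

Lemma len_gt0 : 0 < len. Proof. by rewrite /len_circle; lra. Qed.
Hint Resolve len_gt0 : core.

Definition branch (x : R) : R := if x <= 0 then 4096 / 15625 * x else kap * x.

(** The map on [[sA, sA + len]] sending the start of an excursion to its end is, after
   gluing the endpoints, continuous at 0 and discontinuous at the glued point only. *)
Definition quad_lift (x : R) : R :=
  1 + (Num.floor x)%:~R + branch (fpart x + sA a / len).
Local Notation F := quad_lift.

Lemma branch_slope x y : x < y -> 0 < branch y - branch x <= kap * (y - x).
Proof. by rewrite /branch => xy; case: (leP y 0) => ?; case: (leP x 0) => ?; lra. Qed.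

Lemma branch_slope_le x y : x <= y -> 0 <= branch y - branch x <= kap * (y - x).
Proof. by rewrite /branch => xy; case: (leP y 0) => ?; case: (leP x 0) => ?; lra. Qed.

Lemma branch_ge0 x : (0 <= branch x) = (0 <= x).
Proof. by rewrite /branch; case: (leP x 0) => x0; apply/idP/idP; lra. Qed.

Lemma sA_len : - (13 / 10) <= sA a / len <= - (1 / 4).
Proof.
have /andP[a1 a2] := ha.
by rewrite ler_pdivrMr// ler_pdivlMr//; rewrite /sA /len_circle; lra.
Qed.

Lemma quad_lift_lift : monotone_lift F.
Proof.
split=> [x y xy|x].
- have := le_floor (ltW xy); rewrite le_eqVlt => /predU1P[fE|flt].
    have := @branch_slope (fpart x + sA a / len) (fpart y + sA a / len).
    rewrite /quad_lift /fpart fE; lra.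
  have : (Num.floor x + 1)%:~R <= (Num.floor y)%:~R :> R by rewrite ler_int lezD1.
  rewrite intrD; have := fpart_lt1 x; have := fpart_ge0 y => y0 x1.
  have [h|h] := ltP (fpart x) (fpart y).
  - have := @branch_slope (fpart x + sA a / len) (fpart y + sA a / len); rewrite /quad_lift; lra.
  - have := @branch_slope_le (fpart y + sA a / len) (fpart x + sA a / len); rewrite /quad_lift; lra.
- have -> : x + 1 = x + 1%:~R by [].
  by rewrite /quad_lift floorDint fpartDint intrD; ring.
Qed.

Lemma quad_lift_contr x y : 0 <= x -> x <= y -> y < 1 -> F y - F x <= kap * (y - x).
Proof.
move=> x0 xy y1.
have fx : Num.floor x = 0 by apply: floor_def; rewrite add0r x0 (le_lt_trans xy).
have fy : Num.floor y = 0 by apply: floor_def; rewrite add0r (le_trans x0).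
have := @branch_slope_le (x + sA a / len) (y + sA a / len).
by rewrite /quad_lift /fpart fx fy !subr0; lra.
Qed.

Lemma quad_lift_jump x : x < 1 -> F x <= F 1 - (1 - kap).
Proof.
move=> x1.
have fx : (Num.floor x)%:~R <= 0 :> R by rewrite lerz0 floor_le0.
have f1 : fpart 1 = 0 :> R by rewrite /fpart floor1 subrr.
have := @branch_slope_le (0 + sA a / len) (fpart x + sA a / len).
have := fpart_ge0 x; have := fpart_lt1 x.
by rewrite /quad_lift f1 floor1; lra.
Qed.

Lemma circ_ptE t : pt t = len * (t + sA a / len).
Proof. by rewrite /circ_pt mulrDr [len * (_ / _)]mulrC divfK ?gt_eqF// addrC. Qed.

Lemma circ_pt_sign t : (0 <= pt t) = (0 <= t + sA a / len).
Proof. by rewrite circ_ptE pmulr_rge0. Qed.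

Lemma circ_pt_itv t : 0 <= t <= 1 -> sA a <= pt t <= sA a + len.
Proof.
have := len_gt0; rewrite /circ_pt; set l := len => l0 t01.
by apply/andP; split; nra.
Qed.

Lemma quad_lift_wraps y : wraps F y = (0 <= pt (fpart y)).
Proof.
rewrite /wraps circ_pt_sign -branch_ge0 /quad_lift.
have f0 : Num.floor (fpart y) = 0.
  by apply: floor_def; rewrite add0r fpart_ge0 fpart_lt1.
by rewrite {2}/fpart f0 subr0 addr0 lerDl.
Qed.

Lemma quad_lift_exc y : pt (fpart y) != 0 ->
  exc_end a (wraps F y) (pt (fpart y)) = pt (fpart (F y)).
Proof.
have := len_gt0 => l0; have /andP[s1 s2] := sA_len.
rewrite quad_lift_wraps circ_pt_sign => s0.
set s := fpart y + sA a / len.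
have f0 := fpart_ge0 y; have f1 := fpart_lt1 y.
have cs : pt (fpart y) = len * s by rewrite circ_ptE.
have sn0 : s != 0 by apply: contraNneq s0; rewrite cs => ->; rewrite mulr0.
rewrite cs /circ_pt; case: leP => h.
- have {}h : 0 < s by rewrite lt_neqAle eq_sym sn0.
  have bE : branch s = kap * s by rewrite /branch leNgt h.
  have -> : fpart (F y) = kap * s.
    have fl : Num.floor (F y) = Num.floor y + 1.
      by apply: floor_def; rewrite /quad_lift -/s bE !intrD; rewrite /s in h *; lra.
    by rewrite {1}/fpart fl /quad_lift -/s bE intrD; ring.
  by rewrite /exc_end; ring.
- have bE : branch s = 4096 / 15625 * s by rewrite /branch (ltW h).
  have -> : fpart (F y) = 1 + 4096 / 15625 * s.
    have fl : Num.floor (F y) = Num.floor y.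
      by apply: floor_def; rewrite /quad_lift -/s bE !intrD; rewrite /s in h *; lra.
    by rewrite {1}/fpart fl /quad_lift -/s bE; ring.
  by rewrite /exc_end; ring.
Qed.

End QuadLift.

(** * Orbits of regular points *)

Section RegularOrbits.
Context {R : realType} (a : R) (ha : 3 / 10 <= a <= 6 / 10).
Local Notation lam := (4 / 5 : R).
Local Notation V := (quad a).
Local Notation T := (outer_billiard V lam).
Local Notation exc := (exc a).
Local Notation pt := (circ_pt a).
Local Notation len := (@len_circle R).
Local Notation F := (quad_lift a).

Definition nonsingular (x : R * R) := forall j, ~ singular_set V (iter j T x).

Lemma nonsingular_iter k x : nonsingular x -> nonsingular (iter k T x).
Proof. by move=> nx j; rewrite -iterD. Qed.

Fixpoint height (b : nat -> bool) (h0 : R) (n : nat) : R :=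
  if n is m.+1 then (exc_slope (b m) (exc_len (b m))).2 * height b h0 m else h0.

Lemma height_bounds b h0 n : 0 < h0 ->
  0 < height b h0 n <= (1 / 2) ^+ n * h0.
Proof.
move=> h00; elim: n => [|n /andP[IH1 IH2]] /=; first by rewrite expr0 mul1r h00 lexx.
rewrite exprS -mulrA; set B := _ * h0 in IH2 *; set X := height b h0 n in IH1 IH2 *.
by case: (b n) => /=; lra.
Qed.

Lemma height_cvg0 b h0 : 0 < h0 ->
  forall e, 0 < e -> exists N, forall n, (N <= n)%N -> `|height b h0 n| < e.
Proof.
move=> h00 e e0; have d0 : 0 < e / h0 by rewrite divr_gt0.
have h12 : 0 <= 1 / 2 :> R by lra.
have h21 : 1 / 2 < 1 :> R by lra.
have [N HN] := exprK_lt h12 h21 d0; exists N => n Nn.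
have /andP[p1 p2] := height_bounds b n h00.
rewrite gtr0_norm//; apply: (le_lt_trans p2); rewrite -ltr_pdivlMr//.
by apply: le_lt_trans HN; exact: exprK_anti.
Qed.

Lemma pt_state t : 0 <= t < 1 -> - ell lam a < pt t <= a.
Proof.
have /andP[a1 a2] := ha; move=> /andP[t0 t1].
have t01 : 0 <= t <= 1 by rewrite t0 ltW.
have /andP[p1 p2] := circ_pt_itv a t01; move: p1 p2.
rewrite ellE /sA /len_circle => p1 p2.
by apply/andP; split; lra.
Qed.

Lemma exc_end_itv s : s != 0 -> - ell lam a < s <= a ->
  0 <= exc_end a (0 < s) s - sA a < len.
Proof.
have /andP[a1 a2] := ha; rewrite ellE /exc_end /len_circle => s0 /andP[s1 s2].
by set sA0 := sA a; case: (ltgtP 0 s) s0 => // s0 _; apply/andP; split; lra.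
Qed.

Section Itinerary.
Context (t0 h0 : R) (t0_itv : 0 <= t0 < 1) (h0_itv : 0 < h0 < 1 / 100).
Let x0 : R * R := (pt t0, 1 + h0).
Definition bits n := wraps F (iter n F t0).
Local Notation tt := (orb F t0).
Local Notation hh := (height bits h0).

Lemma bits_sign n : pt (tt n) != 0 -> bits n = (0 < pt (tt n)).
Proof.
by move=> p0; rewrite /bits quad_lift_wraps lt_neqAle eq_sym p0.
Qed.

Lemma itinerary_step :
  (forall j k, sched bits j = (k, 0%N) -> iter j T x0 = (pt (tt k), 1 + hh k) ->
    pt (tt k) != 0) ->
  forall j, iter j T x0 = exc (bits (sched bits j).1) (sched bits j).2
      (pt (tt (sched bits j).1)) (hh (sched bits j).1) /\
    pt (tt (sched bits j).1) != 0.
Proof.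
have /andP[h1 h2] := h0_itv.
move=> nz; elim=> [|j [IH nzj]].
  have E : iter 0 T x0 = (pt (tt 0), 1 + hh 0).
    have f0 : Num.floor t0 = 0 by apply: floor_def; rewrite add0r.
    by rewrite /= /x0 /orb /fpart /= f0 subr0.
  by split; [rewrite exc0; exact: E|exact: (nz 0%N 0%N erefl E)].
have := schedS bits j; have := sched_lt bits j.
move: IH nzj; case: (sched bits j) => k i /= IH nzk ik.
have hk : 0 < hh k < 1 / 100.
  have /andP[-> hk] := height_bounds bits k h1.
  apply: le_lt_trans hk _; apply: le_lt_trans h2.
  by apply: ler_piMl; [exact: ltW|apply: exprn_ile1; lra].
have [_ step] := exc_defined ha ik (bits_sign nzk) nzk (pt_state (orb_itv F t0 k)) hk.
rewrite -IH in step.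
case=> [[ik1 sj]|[ik1 sj]]; rewrite sj.
  by split.
have E : iter j.+1 T x0 = (pt (tt k.+1), 1 + hh k.+1).
  rewrite iterS step ik1 exc_endE; congr pair.
  by rewrite /bits quad_lift_exc.
by split; [rewrite exc0; exact: E|exact: (nz j.+1 k.+1 sj E)].
Qed.

(** An excursion starting at abscissa 0 would start on the ray from [D] through [A]. *)
Lemma nonsingular_itinerary : nonsingular x0 ->
  (forall j, iter j T x0 = exc (bits (sched bits j).1) (sched bits j).2
      (pt (tt (sched bits j).1)) (hh (sched bits j).1)) /\
  forall k, pt (tt k) != 0.
Proof.
move=> nx.
have nz j k : sched bits j = (k, 0%N) -> iter j T x0 = (pt (tt k), 1 + hh k) ->
    pt (tt k) != 0.
  move=> _ E; apply/eqP => p0; apply: (nx j); rewrite E p0.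
  apply/(singular_quad ha)/Or44; split=> //.
  have /andP[h1 h2] := h0_itv.
  by have /andP[] := height_bounds bits k h1; lra.
split=> [j|k]; first by have [] := itinerary_step nz j.
have [j _ sj] := sched_start bits k.
by have [_] := itinerary_step nz j; rewrite sj.
Qed.

Lemma nonzero_nonsingular : (forall k, pt (tt k) != 0) -> forall j, defined_at V (iter j T x0).
Proof.
move=> nz j; have [-> _] := @itinerary_step (fun _ k _ _ => nz k) j.
have /andP[h1 h2] := h0_itv; set k := (sched bits j).1.
have hk : 0 < hh k < 1 / 100.
  have /andP[-> hk] := height_bounds bits k h1.
  apply: le_lt_trans hk _; apply: le_lt_trans h2.
  by apply: ler_piMl; [exact: ltW|apply: exprn_ile1; lra].
by have [] := exc_defined ha (sched_lt bits j) (bits_sign (nz k)) (nz k) (pt_state (orb_itv F t0 k)) hk.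
Qed.

Lemma omega_nonsingular : nonsingular x0 -> omega_limit V lam x0 = exc_union a (accum F t0).
Proof.
have /andP[h1 _] := h0_itv => /nonsingular_itinerary[itin _].
by rewrite (omega_exc_union itin (height_cvg0 bits h1)).
Qed.

End Itinerary.

Lemma omega_limit_iter k x : omega_limit V lam (iter k T x) = omega_limit V lam x.
Proof.
apply/seteqP; split=> w /cluster_seqP H; apply/cluster_seqP => e e0 N.
- have [n Nn b] := H e e0 N; exists (n + k)%N; first lia.
  by rewrite iterD.
- have [n Nn b] := H e e0 (N + k)%N; exists (n - k)%N; first lia.
  by rewrite -iterD subnK//; lia.
Qed.

Lemma state_circ s h : -  ell lam a < s <= a -> 0 < h < 1 / 100 -> nonsingular (s, 1 + h) ->
  exists k t h', [/\ iter k T (s, 1 + h) = (pt t, 1 + h'), 0 <= t < 1 & 0 < h' < 1 / 100].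
Proof.
have /andP[a1 a2] := ha; move=> s_itv h_itv ns.
have /andP[h1 h2] := h_itv.
have s0 : s != 0.
  apply/eqP => s0; apply: (ns 0%N); rewrite /= s0; apply/(singular_quad ha)/Or44.
  by split=> //; lra.
pose b : bool := 0 < s.
have E i : (i <= exc_len b)%N -> iter i T (s, 1 + h) = exc b i s h.
  elim: i => [|i IH] il; first by rewrite exc0.
  by rewrite iterS IH ?(ltnW il)//; have [] := exc_defined ha il erefl s0 s_itv h_itv.
exists (exc_len b), ((exc_end a b s - sA a) / len), ((exc_slope b (exc_len b)).2 * h).
rewrite E// exc_endE; split.
- by congr pair; rewrite /circ_pt [len * _]mulrC divfK ?gt_eqF ?len_gt0//; ring.
- have l0 := @len_gt0 R; have /andP[e1 e2] := exc_end_itv s0 s_itv.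
  by rewrite divr_ge0 ?(ltW l0)//= ltr_pdivrMr// mul1r.
- by rewrite /b; case: (0 < s) => /=; lra.
Qed.

End RegularOrbits.

(** * The basin of attraction *)

Section Basin.
Context {R : realType} (a : R) (ha : 3 / 10 <= a <= 6 / 10).
Local Notation lam := (4 / 5 : R).
Local Notation V := (quad a).
Local Notation T := (outer_billiard V lam).
Local Notation exc := (exc a).
Local Notation pt := (circ_pt a).
Local Notation len := (@len_circle R).
Local Notation F := (quad_lift a).
Local Notation nonsingular := (nonsingular a).

Definition captured (x : R * R) := exists k s h,
  [/\ iter k T x = (s, 1 + h), - ell lam a < s <= a & 0 < h < 1 / 100].

Lemma captured_iter k x : captured (iter k T x) -> captured x.
Proof.
by move=> [j [s [h [E sI hI]]]]; exists (j + k)%N, s, h; rewrite iterD.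
Qed.

Lemma captured_omega x : nonsingular x -> captured x ->
  exists t, omega_limit V lam x = exc_union a (accum F t).
Proof.
move=> nx [k [s [h [E sI hI]]]].
have := nonsingular_iter (k := k) nx; rewrite E => nk.
have [j [t [h' [E' tI h'I]]]] := state_circ ha sI hI nk.
exists t; rewrite -(omega_nonsingular ha tI h'I).
  by rewrite -E' -E -iterD omega_limit_iter.
by rewrite -E'; exact: nonsingular_iter.
Qed.

Lemma regular_nonsingular x : regular_points V lam x -> nonsingular x.
Proof. by move=> nx j sj; apply: nx; right; exists j. Qed.

Lemma T_D u v : u < 0 -> u < 5 * v -> T (u, v) = (- (4 / 5) * u, - (4 / 5) * v).
Proof.
move=> h1 h2; have [_ ->] := region_D ha h1 h2; rewrite /vertex_image quadD.
by congr pair; rewrite /= /GRing.scale /=; ring.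
Qed.

Lemma T_A u v : 0 < u -> 1 < v -> T (u, v) = (- (4 / 5) * u, 9 / 5 - 4 / 5 * v).
Proof.
move=> h1 h2; have [_ ->] := region_A ha h1 h2; rewrite /vertex_image quadA.
by congr pair; rewrite /= /GRing.scale /=; field.
Qed.

Lemma T_B u v : v < 1 -> 0 < 4 / 5 * (u - a) + (1 - a) * (v - 1) ->
  T (u, v) = (9 / 5 * a - 4 / 5 * u, 9 / 5 - 4 / 5 * v).
Proof.
move=> h1 h2; have [_ ->] := region_B ha h1 h2; rewrite /vertex_image quadB.
by congr pair; rewrite /= /GRing.scale /=; field.
Qed.

Lemma T_C u v : 5 * v < u -> 4 / 5 * (u - a) + (1 - a) * (v - 1) < 0 ->
  T (u, v) = (9 / 5 - 4 / 5 * u, 9 / 25 - 4 / 5 * v).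
Proof.
move=> h1 h2; have [_ ->] := region_C ha h1 h2; rewrite /vertex_image quadC.
by congr pair; rewrite /= /GRing.scale /=; field.
Qed.

Lemma captured_above s y : 1 < y -> y < 101 / 100 -> - ell lam a < s -> s <= a ->
  captured (s, y).
Proof.
move=> y1 y2 s1 s2; exists 0%N, s, (y - 1).
rewrite /= s1 s2; split=> //; first by congr pair; ring.
by apply/andP; split; lra.
Qed.

Lemma nonsingular_axis v : nonsingular (0, v) -> v < 0.
Proof.
move=> nx; rewrite ltNge; apply/negP => v0; apply: (nx 0%N) => /=.
by apply/(singular_quad ha)/Or44.
Qed.

Lemma nonsingular_lineAB u : nonsingular (u, 1) -> u < 0.
Proof.
move=> nx; rewrite ltNge; apply/negP => v0; apply: (nx 0%N) => /=.
by apply/(singular_quad ha)/Or41.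
Qed.

(** Below the line [AB] one excursion from the rectangle leads above it, provided the
   second step stays on the right of the line [BC]: this is where the height of the
   rectangle has to be small compared with its distance to [E]. *)
Lemma rect2_excursion e p y : 0 < e < 1 / 10 -> - ell lam a + e <= p -> p < 0 ->
  1 - e ^+ 2 <= y -> y < 1 ->
  [/\ forall i, (i < 3)%N -> defined_at V (iter i T (p, y)),
      iter 1 T (p, y) = (- (4 / 5) * p, - (4 / 5) * y),
      iter 2 T (p, y) = (9 / 5 + 16 / 25 * p, 9 / 25 + 16 / 25 * y) &
      iter 3 T (p, y) = (sA a - 64 / 125 * p, 1 + 64 / 125 * (1 - y))].
Proof.
have /andP[a1 a2] := ha; move=> /andP[e0 e1]; rewrite ellE => p1 p2 y1 y2.
have ee : e ^+ 2 <= e / 10 by rewrite expr2; nra.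
have y9 : 9 / 10 < y by lra.
have d0 : (1 - a) * (1 - y) <= 7 / 10 * (e / 10) by nra.
have [dD TD] : defined_at V (p, y) /\ T (p, y) = (- (4 / 5) * p, - (4 / 5) * y).
  by split; [apply: (region_D ha _ _).1|apply: T_D]; lra.
have c1 : 5 * (- (4 / 5) * y) < - (4 / 5) * p by lra.
have c2 : 4 / 5 * (- (4 / 5) * p - a) + (1 - a) * (- (4 / 5) * y - 1) < 0.
  have -> : (1 - a) * (- (4 / 5) * y - 1) = 4 / 5 * ((1 - a) * (1 - y)) - 9 / 5 * (1 - a) by field.
  lra.
have [dC _] := region_C ha c1 c2.
have TC : T (- (4 / 5) * p, - (4 / 5) * y) = (9 / 5 + 16 / 25 * p, 9 / 25 + 16 / 25 * y).
  by rewrite T_C//; congr pair; field.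
have b1 : 9 / 25 + 16 / 25 * y < 1 by lra.
have b2 : 0 < 4 / 5 * (9 / 5 + 16 / 25 * p - a) + (1 - a) * (9 / 25 + 16 / 25 * y - 1).
  have -> : (1 - a) * (9 / 25 + 16 / 25 * y - 1) = - (16 / 25) * ((1 - a) * (1 - y)) by field.
  lra.
have [dB _] := region_B ha b1 b2.
have TB : T (9 / 5 + 16 / 25 * p, 9 / 25 + 16 / 25 * y) =
    (sA a - 64 / 125 * p, 1 + 64 / 125 * (1 - y)).
  by rewrite T_B// /sA; congr pair; field.
split; rewrite /= ?TD ?TC ?TB//.
by case=> [|[|[|//]]] _ /=; rewrite ?TD ?TC.
Qed.

Lemma captured_rect2 e p y : 0 < e < 1 / 10 -> - ell lam a + e <= p -> p < 0 ->
  1 - e ^+ 2 <= y -> y < 1 -> captured (p, y).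
Proof.
have /andP[a1 a2] := ha.
move=> e_itv p1 p2 y1 y2.
have [_ _ _ E] := rect2_excursion e_itv p1 p2 y1 y2.
apply: (@captured_iter 3); rewrite E.
have /andP[e0 e1] := e_itv; have ee : e ^+ 2 < 1 / 100 by rewrite expr2; nra.
move: p1; rewrite ellE => p1.
by apply: captured_above; rewrite ?ellE /sA; lra.
Qed.

Lemma captured_rects e x : 0 < e < 1 / 10 -> nonsingular x ->
  (rect1 lam a e `|` rect2 lam a e) x -> captured x.
Proof.
have /andP[a1 a2] := ha.
move=> e_itv; case: x => p y nx; have /andP[e0 e1] := e_itv.
have ee : e ^+ 2 < 1 / 100 by rewrite expr2; nra.
have notAB : y = 1 -> - ell lam a + e <= p -> p < 0 -> False.
  move=> y1; rewrite ellE => p1 p0; rewrite y1 in nx.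
  have T1 : T (p, 1) = (- (4 / 5) * p, - (4 / 5)) by rewrite T_D ?mulr1//; lra.
  have T2 : T (- (4 / 5) * p, - (4 / 5)) = (9 / 5 + 16 / 25 * p, 1).
    by rewrite T_C; [congr pair; field|lra|lra].
  have := nonsingular_iter (k := 2) nx; rewrite /= T1 T2 => /nonsingular_lineAB; lra.
have p0 : p <= 0 -> 0 < y -> p < 0.
  rewrite le_eqVlt => /predU1P[p0|//] y0.
  by have := nx; rewrite p0 => /nonsingular_axis; lra.
case=> -[/= /andP[p1 p2] /andP[y1 y2]].
- have {}p0 : p < 0 by apply: p0 => //; lra.
  move: y1; rewrite le_eqVlt => /predU1P[/esym/notAB h|y1]; first by exfalso; exact: h.
  apply: captured_above => //; lra.
- have {}p0 : p < 0 by apply: p0 => //; lra.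
  move: y2; rewrite le_eqVlt => /predU1P[/notAB h|y2]; first by exfalso; exact: h.
  exact: (captured_rect2 e_itv).
Qed.

(** The three boxes contain the parts of the excursions around [A] and to its left, to the
   right of [B], and below the polygon. *)
Definition trap : set (R * R) := [set x |
  [/\ - ell lam a + 1 / 20 < x.1 < 7 / 10 * a & 1 - 1 / 400 < x.2 < 1 + 1 / 400] \/
  [/\ 87 / 100 < x.1 < 2 & 1 - 1 / 400 < x.2 < 1 + 1 / 400] \/
  [/\ - (1 / 10) < x.1 < 116 / 100 & - (4 / 5) - 1 / 400 < x.2 < - (4 / 5) + 1 / 400]].

Lemma open_trap : open trap.
Proof.
have strip (p q r s : R) : open [set x : R * R | [/\ p < x.1 < q & r < x.2 < s]].
  have -> : [set x : R * R | [/\ p < x.1 < q & r < x.2 < s]] =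
      (fst @^-1` `]p, q[%classic) `&` (snd @^-1` `]r, s[%classic).
    by apply/seteqP; split=> x /=; rewrite !in_itv /= => -[? ?]; split.
  apply: openI; apply: open_comp => [x _|]; try exact: itv_open.
  - exact: cvg_fst.
  - exact: cvg_snd.
by apply: openU; [|apply: openU]; exact: strip.
Qed.

Lemma captured_trap x : regular_points V lam x -> trap x -> captured x.
Proof.
have /andP[a1 a2] := ha.
have e_itv : 0 < (1 / 20 : R) < 1 / 10 by lra.
have e2 : (1 / 20) ^+ 2 = 1 / 400 :> R by field.
have strip2 u v : nonsingular (u, v) -> 87 / 100 < u < 2 -> 1 - 1 / 400 < v < 1 + 1 / 400 ->
    captured (u, v).
  move=> nx /andP[u1 u2] /andP[v1 v2]; have [vl|vg|v1'] := ltgtP v 1.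
  - apply: (@captured_iter 1) => /=; rewrite T_B//; last nra.
    by apply: captured_above; rewrite ?ellE; lra.
  - apply: (@captured_iter 1) => /=; rewrite T_A//; last lra.
    by apply: (captured_rect2 e_itv); rewrite ?e2 ?ellE; lra.
  - by have := nx; rewrite v1' => /nonsingular_lineAB; lra.
case: x => u v rx; have nx := regular_nonsingular rx.
case=> [[/= /andP[u1 u2] /andP[v1 v2]]|[[]|[/= /andP[u1 u2] /andP[v1 v2]]]].
- have [u0|u0] := leP u 0.
    apply: (captured_rects e_itv nx); rewrite /rect1 /rect2 e2 /=.
    by have [vl|vg] := leP v 1; [right|left]; split; apply/andP; split; lra.
  have [vl|vg|v1'] := ltgtP v 1.
  - exfalso; apply: rx; left; apply: polygon_corner_A => //; nra.
  - by apply: captured_above => //; lra.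
  - by have := nx; rewrite v1' => /nonsingular_lineAB; lra.
- exact: strip2.
- have TC : T (u, v) = (9 / 5 - 4 / 5 * u, 9 / 25 - 4 / 5 * v).
    by apply: T_C; nra.
  apply: (@captured_iter 1); have := nonsingular_iter (k := 1) nx.
  by rewrite /= TC => n1; apply: strip2 => //; lra.
Qed.

End Basin.

(** * The structure of the limit set *)

Section LimitSet.
Context {R : realType} (a : R) (ha : 3 / 10 <= a <= 6 / 10).
Local Notation lam := (4 / 5 : R).
Local Notation V := (quad a).
Local Notation T := (outer_billiard V lam).
Local Notation exc := (exc a).
Local Notation pt := (circ_pt a).
Local Notation len := (@len_circle R).
Local Notation F := (quad_lift a).

Definition exc_ratio (b : bool) : R := if b then 256 / 625 else 4096 / 15625.

Definition circ_step (b : bool) (u : R) : R := (exc_end a b (pt u) - sA a) / len.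

Lemma exc_ratio_itv b : 1 / 4 <= exc_ratio b <= 1.
Proof. by case: b; rewrite /exc_ratio; lra. Qed.

Lemma pt_circ_step b u : pt (circ_step b u) = exc_end a b (pt u).
Proof. by rewrite /circ_pt /circ_step [len * _]mulrC divfK ?gt_eqF ?len_gt0//; ring. Qed.

Lemma circ_stepB b u v : circ_step b u - circ_step b v = exc_ratio b * (u - v).
Proof.
have : len != 0 by rewrite gt_eqF ?len_gt0.
by case: b; rewrite /circ_step /exc_end /exc_ratio /circ_pt; set l := len => l0; field.
Qed.

Lemma pt_inj u v : pt u = pt v -> u = v.
Proof.
rewrite /circ_pt => /addrI /mulfI; apply.
by rewrite gt_eqF ?len_gt0.
Qed.

Definition aperiodic (t : R) := forall k, pt (orb F t k) != 0.

Lemma aperiodic_exists : exists t, 0 < t < 1 /\ aperiodic t.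
Proof.
have [t' Ht'] := exists_aperiodic_itinerary (quad_lift_lift a).
exists (fpart t'); split.
  rewrite fpart_lt1 andbT lt_neqAle fpart_ge0 andbT; apply/eqP => E.
  by have /eqP := Ht' 0%N (Num.floor t'); apply; move: E; rewrite /= /fpart; lra.
move=> k; have -> : orb F (fpart t') k = orb F t' k.
  by have := orb_fpart (quad_lift_lift a) t' 0 k; rewrite addn0.
apply/eqP => p0; have /eqP := Ht' k.+1 (1 + Num.floor (iter k F t')); apply.
have s0 : fpart (iter k F t') + sA a / len = 0.
  have l0 : len != 0 by rewrite gt_eqF ?len_gt0.
  by apply: (mulfI l0); rewrite mulr0 -circ_ptE.
rewrite iterS; set y := iter k F t' in s0 *.
by rewrite /quad_lift s0 /branch lexx mulr0 addr0 intrD.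
Qed.

Lemma orb_step t n : aperiodic t ->
  orb F t n.+1 = circ_step (wraps F (iter n F t)) (orb F t n).
Proof.
by move=> nz; apply: pt_inj; rewrite pt_circ_step quad_lift_exc//; exact: nz.
Qed.

(** Every excursion passes once through the lower rectangle: going back from an
   aperiodic start to the previous passage gives a point there. *)
Lemma regular_start e : 0 < e < 1 / 10 ->
  exists2 x, regular_points V lam x & rect2 lam a e x.
Proof.
have /andP[a1 a2] := ha; move=> e_itv; have /andP[e0 e1] := e_itv.
have [t [/andP[t0 t1] nz]] := aperiodic_exists.
have e2 : 0 < e ^+ 2 by exact: exprn_gt0.
have e3 : e ^+ 2 < 1 / 100 by rewrite expr2; nra.
(* The abscissa from which the third iterate is at abscissa [pt t]. *)
pose p := - (36 / 25) * t; pose y := 1 - e ^+ 2.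
have p1 : - ell lam a + e <= p by rewrite ellE /p; lra.
have p0 : p < 0 by rewrite /p; lra.
have y0 : 1 - e ^+ 2 <= y by [].
have y1 : y < 1 by rewrite /y; lra.
have [def _ _ E3] := rect2_excursion ha e_itv p1 p0 y0 y1.
exists (p, y); last by rewrite /rect2 /= p1 y0 !ltW.
have h_itv : 0 < 64 / 125 * (1 - y) < 1 / 100 by rewrite /y; lra.
have t_itv : 0 <= t < 1 by rewrite ltW.
have E3' : iter 3 T (p, y) = (pt t, 1 + 64 / 125 * (1 - y)).
  by rewrite E3; congr pair; rewrite /p /circ_pt /len_circle; field.
case=> [/(polygon_quad ha)[]|[j _ sj]]; first lra.
have [j3|j3] := ltnP j 3; first by apply: (def j j3); right.
apply: (nonzero_nonsingular ha t_itv h_itv nz (j := j - 3)); right.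
by rewrite -E3' -iterD subnK.
Qed.

Lemma accum_sign y z b : accum F y z b -> if b then 0 <= pt z else pt z <= 0.
Proof.
move=> A; have l0 := @len_gt0 R.
case: b A => A; rewrite leNgt circ_ptE; apply/negP.
- rewrite pmulr_rlt0// => z0.
  have [|n _ [zn bn]] := A (- (z + sA a / len)) _ 0%N; first by rewrite oppr_gt0.
  move: bn; rewrite quad_lift_wraps circ_pt_sign -/(orb F y n).
  by move: zn; rewrite ltr_norml; lra.
- rewrite pmulr_rgt0// => z0.
  have [|n _ [zn bn]] := A (z + sA a / len) _ 0%N => //.
  move: bn; rewrite quad_lift_wraps circ_pt_sign -/(orb F y n) => /negbT; rewrite -ltNge.
  by move: zn; rewrite ltr_norml; lra.
Qed.

Lemma accum_forward t z b : aperiodic t -> accum F t z b ->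
  exists b', accum F t (circ_step b z) b'.
Proof.
move=> nz A.
have [k k' n c kk' [h1 h2]|k|c Hc] := @pigeonhole_frequently bool (fun k n c =>
    `|orb F t n.+1 - circ_step b z| < k.+1%:R^-1 /\ wraps F (iter n.+1 F t) = c).
- split=> //; apply: lt_le_trans h1 _.
  by rewrite lef_pV2 ?posrE ?ltr0Sn// ler_nat.
- have [|n kn [h1 h2]] := A k.+1%:R^-1 _ k; first by rewrite invr_gt0 ltr0Sn.
  exists n => //; exists (wraps F (iter n.+1 F t)); split=> //.
  rewrite orb_step// h2 circ_stepB normrM.
  apply: le_lt_trans h1; rewrite ler_piMl//.
  by have := exc_ratio_itv b => /andP[r1 r2]; rewrite ger0_norm//; lra.
- exists c => e e0 N; have [k ke] := invn_lt e0.
  have [n nk [h1 h2]] := Hc (maxn k N).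
  exists n.+1; first by rewrite ltnW// ltnS (leq_trans _ nk)// leq_maxr.
  split=> //; apply: lt_trans ke; apply: lt_le_trans h1 _.
  by rewrite lef_pV2 ?posrE ?ltr0Sn// ler_nat ltnS leq_maxl.
Qed.

Lemma accum_backward t z b : aperiodic t -> accum F t z b ->
  exists z' b', accum F t z' b' /\ circ_step b' z' = z.
Proof.
move=> nz A.
have [k k' n c kk' [h1 h2]|k|c Hc] := @pigeonhole_frequently bool (fun k n c =>
    `|orb F t n.+1 - z| < k.+1%:R^-1 /\ wraps F (iter n F t) = c).
- split=> //; apply: lt_le_trans h1 _.
  by rewrite lef_pV2 ?posrE ?ltr0Sn// ler_nat.
- have [|[//|n] kn [h1 h2]] := A k.+1%:R^-1 _ k.+1; first by rewrite invr_gt0 ltr0Sn.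
  by exists n => //; exists (wraps F (iter n F t)).
- have /andP[r1 r2] := exc_ratio_itv c.
  pose z' := (z - circ_step c 0) / exc_ratio c.
  have z'E : circ_step c z' = z.
    have E : exc_ratio c * z' = z - circ_step c 0.
      by rewrite /z' mulrC divfK// gt_eqF//; lra.
    by have := circ_stepB c z' 0; rewrite subr0 E => /addIr.
  exists z', c; split=> // e e0 N; have [k ke] := @invn_lt _ (e / 4) (divr_gt0 e0 (ltr0Sn _ 3)).
  have [n nk [h1 h2]] := Hc (maxn k N).
  exists n; first by rewrite (leq_trans _ nk)// leq_maxr.
  split=> //; have {}h1 : `|orb F t n.+1 - z| < e / 4.
    apply: lt_trans ke; apply: lt_le_trans h1 _.
    by rewrite lef_pV2 ?posrE ?ltr0Sn// ler_nat ltnS leq_maxl.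
  move: h1; rewrite orb_step// h2 -z'E circ_stepB normrM ger0_norm; last lra.
  have := normr_ge0 (orb F t n - z'); set d := `|_| => d0.
  have : 1 / 4 * d <= exc_ratio c * d by rewrite ler_wpM2r.
  lra.
Qed.

Lemma accum_nonempty y : exists z b, accum F y z b.
Proof.
have [|z _ Hz] := @seq_cluster_itv R (orb F y) 0 1.
  by move=> n; have /andP[-> /ltW] := orb_itv F y n.
have [k k' n c kk' [h1 h2]|k|c Hc] := @pigeonhole_frequently bool (fun k n c =>
    `|orb F y n - z| < k.+1%:R^-1 /\ wraps F (iter n F y) = c).
- split=> //; apply: lt_le_trans h1 _.
  by rewrite lef_pV2 ?posrE ?ltr0Sn// ler_nat.
- have [|n kn h1] := Hz k.+1%:R^-1 _ k; first by rewrite invr_gt0 ltr0Sn.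
  by exists n => //; exists (wraps F (iter n F y)).
- exists z, c => e e0 N; have [k ke] := invn_lt e0.
  have [n nk [h1 h2]] := Hc (maxn k N).
  exists n; first by rewrite (leq_trans _ nk)// leq_maxr.
  split=> //; apply: lt_trans ke; apply: lt_le_trans h1 _.
  by rewrite lef_pV2 ?posrE ?ltr0Sn// ler_nat ltnS leq_maxl.
Qed.

End LimitSet.

Section LimitSetProperties.
Context {R : realType} (a : R) (ha : 3 / 10 <= a <= 6 / 10).
Local Notation lam := (4 / 5 : R).
Local Notation V := (quad a).
Local Notation T := (outer_billiard V lam).
Local Notation exc := (exc a).
Local Notation pt := (circ_pt a).
Local Notation len := (@len_circle R).
Local Notation F := (quad_lift a).

Lemma accum_pt_itv y z b : accum F y z b -> sA a <= pt z <= sA a + len.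
Proof. by move=> /accum_itv; exact: circ_pt_itv. Qed.

Lemma exc_union_trap y : exc_union a (accum F y) `<=` trap a.
Proof.
have /andP[a1 a2] := ha; move=> _ [b [i [z [ib A ->]]]].
have := accum_sign A; have := accum_pt_itv A; set s := pt z.
rewrite /sA /len_circle => /andP[s1 s2] sb.
move: b i ib sb {A} => -[] [|[|[|[|[|[|//]]]]]]//= _ sb;
  rewrite /exc /trap /= !mulr0 !addr0 ellE.
- by left; split; lra.
- by left; split; lra.
- by right; right; split; lra.
- by right; left; split; lra.
- by left; split; lra.
- by right; right; split; lra.
- by right; left; split; lra.
- by left; split; lra.
- by right; right; split; lra.
- by right; left; split; lra.
Qed.

Lemma exc_last b z : exc b (exc_len b) (pt z) 0 = (pt (circ_step a b z), 1).
Proof. by rewrite exc_endE mulr0 addr0 pt_circ_step. Qed.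

Lemma accum_T_value y z b i : accum F y z b -> (i < exc_len b)%N ->
  T_value V lam (exc b i (pt z) 0) (exc b i.+1 (pt z) 0).
Proof. by move=> A ib; apply: (exc_T_value ha ib (accum_sign A)); exact: accum_pt_itv A. Qed.

Lemma closed_omega_limit x : closed (omega_limit V lam x).
Proof. by rewrite /omega_limit clusterE; apply: closed_bigI => A _; exact: closed_closure. Qed.

(** The successor of a point in an excursion is one of its values; the end of an
   excursion is the start of another one, and conversely. *)
Lemma exc_union_invariant t : aperiodic a t -> closed (exc_union a (accum F t)) ->
  invariant_set V lam (exc_union a (accum F t)).
Proof.
move=> nz cK; split=> //.
- move=> _ [b [i [z [ib A ->]]]]; exists (exc b i.+1 (pt z) 0); first exact: accum_T_value A ib.
  have [ib'|ib'] := ltnP i.+1 (exc_len b); first by exists b, i.+1, z.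
  have [b' A'] := accum_forward ha nz A.
  have -> : i.+1 = exc_len b by apply/eqP; rewrite eqn_leq ib.
  exists b', 0%N, (circ_step a b z); split=> //; first by case: (b').
  by rewrite exc_last exc0 addr0.
- move=> _ [b [[|i] [z [ib A ->]]]]; last first.
    exists (exc b i (pt z) 0); first exact: accum_T_value A (ltnW ib).
    by exists b, i, z; split=> //; exact: ltnW.
  have [z' [b' [A' <-]]] := accum_backward ha nz A.
  have l0 : ((exc_len b').-1 < exc_len b')%N by case: (b').
  exists (exc b' (exc_len b').-1 (pt z') 0); last by exists b', (exc_len b').-1, z'.
  have := accum_T_value A' l0.
  by rewrite prednK ?exc_last ?exc0 ?addr0//; case: (b').
Qed.

(** ** The limit set is nowhere dense on the lines that carry it *)

Definition nowhere_dense_line (S : set R) := forall u v, u < v ->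
  exists u' v', [/\ u <= u', u' < v', v' <= v & forall z, S z -> ~ (u' < z < v')].

Lemma nowhere_denseU (A B : set R) : nowhere_dense_line A -> nowhere_dense_line B ->
  nowhere_dense_line (A `|` B).
Proof.
move=> hA hB u v uv; have [u1 [v1 [h1 h2 h3 H1]]] := hA u v uv.
have [u2 [v2 [k1 k2 k3 H2]]] := hB u1 v1 h2.
exists u2, v2; split=> //; [exact: le_trans k1|exact: le_trans h3|].
move=> z [/H1 nz|/H2//] /andP[uz zv]; apply: nz.
by rewrite (le_lt_trans k1)//= (lt_le_trans zv).
Qed.

Lemma nowhere_dense_affine (A : set R) (p q : R) : q != 0 -> nowhere_dense_line A ->
  nowhere_dense_line [set p + q * z | z in A].
Proof.
move=> q0 hA u v uv.
have E w : p + q * ((w - p) / q) = w by field.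
have [qp|qn] := ltP 0 q.
- have [|u' [v' [h1 h2 h3 H]]] := hA ((u - p) / q) ((v - p) / q).
    by rewrite ltr_pM2r ?invr_gt0// ltrD2r.
  exists (p + q * u'), (p + q * v'); split.
  + by rewrite -{1}(E u) lerD2l ler_pM2l.
  + by rewrite ltrD2l ltr_pM2l.
  + by rewrite -[leRHS](E v) lerD2l ler_pM2l.
  + by move=> _ [z Az <-]; rewrite !ltrD2l !ltr_pM2l//; exact: H.
- have {}qn : q < 0 by rewrite lt_neqAle q0.
  have [|u' [v' [h1 h2 h3 H]]] := hA ((v - p) / q) ((u - p) / q).
    by rewrite ltr_nM2r ?invr_lt0// ltrD2r.
  exists (p + q * v'), (p + q * u'); split.
  + by rewrite -{1}(E u) lerD2l ler_nM2l.
  + by rewrite ltrD2l ltr_nM2l.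
  + by rewrite -[leRHS](E v) lerD2l ler_nM2l.
  + by move=> _ [z Az <-]; rewrite !ltrD2l !ltr_nM2l// andbC; exact: H.
Qed.

Lemma accum_nd y : nowhere_dense_line [set z | exists b, accum F y z b].
Proof.
move=> u v uv.
have k0 : 0 <= 256 / 625 :> R by lra.
have k1 : 256 / 625 < 1 :> R by lra.
have g0 : 0 < 1 - 256 / 625 :> R by lra.
have [u' [v' [h1 h2 h3 H]]] := accum_nowhere_dense (quad_lift_lift a) k0 k1
  (@quad_lift_contr R a) g0 (@quad_lift_jump R a) uv.
by exists u', v'; split=> // z [b A]; exact: H A.
Qed.

Lemma exc_union_fst_nd y :
  nowhere_dense_line (fst @` exc_union a (accum F y)).
Proof.
have piece b i : (i < exc_len b)%N ->
    nowhere_dense_line [set (exc b i (pt z) 0).1 | z in [set z | exists b, accum F y z b]].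
  move=> ib; have [/andP[s1 _] _] := @exc_slope_bounds R b i ib.
  have q0 : (@exc_slope R b i).1 * len != 0.
    have s0 : (@exc_slope R b i).1 != 0 by rewrite -normr_gt0; apply: lt_le_trans s1; lra.
    by apply: mulf_neq0 => //; rewrite gt_eqF// len_gt0.
  have := nowhere_dense_affine ((exc_pt0 a b i).1 + (@exc_slope R b i).1 * sA a) q0 (@accum_nd y).
  congr nowhere_dense_line; apply/seteqP; split=> _ [z zA <-]; exists z => //;
    by rewrite /exc /circ_pt /=; ring.
have big b n : (n <= exc_len b)%N -> nowhere_dense_line
    [set r | exists i z, [/\ (i < n)%N, exists b, accum F y z b & r = (exc b i (pt z) 0).1]].
  elim: n => [|n IH] nb.
    by move=> u v uv; exists u, v; split=> // z [i [z' []]].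
  have := nowhere_denseU (IH (ltnW nb)) (piece b n nb).
  congr nowhere_dense_line; apply/seteqP; split=> r.
  - case=> [[i [z [ni A ->]]]|[z A <-]]; first by exists i, z; split=> //; exact: ltnW.
    by exists n, z.
  - case=> i [z [+ A ->]]; rewrite ltnS leq_eqVlt => /predU1P[->|ni].
      by right; exists z.
    by left; exists i, z.
move=> u v uv.
have [u' [v' [h1 h2 h3 H]]] := nowhere_denseU (@big true _ (leqnn _)) (@big false _ (leqnn _)) uv.
exists u', v'; split=> // _ [_ [b [i [z [ib A ->]]]] <-]; apply: H.
by case: b ib A => ib A; [left|right]; exists i, z; split=> //; eexists; exact: A.
Qed.

(** Distinct points of the limit set are separated by their second coordinates, which
   only take two values, or by a vertical line missing the set. *)
Lemma exc_union_separated y : clopen_separated (exc_union a (accum F y)).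
Proof.
set K := exc_union _ _.
have level w : K w -> w.2 = 1 \/ w.2 = - (4 / 5).
  case=> b [i [z [ib _ ->]]]; move: b i ib => -[] [|[|[|[|[|[|//]]]]]]//= _;
    rewrite !mulr0 !addr0; first [by left|by right].
have cont1 : continuous (fst : R * R -> R) by move=> x; exact: cvg_fst.
have cont2 : continuous (snd : R * R -> R) by move=> x; exact: cvg_snd.
have halves (f : R * R -> R) r w w' : continuous f -> (forall w, K w -> f w != r) ->
    f w < r -> r < f w' ->
    (exists U W : set (R * R), [/\ open U, open W, K `<=` U `|` W, K `&` (U `&` W) = set0 & U w /\ W w']) /\
    (exists U W : set (R * R), [/\ open U, open W, K `<=` U `|` W, K `&` (U `&` W) = set0 & U w' /\ W w]).
  move=> cf Kr h1 h2.
  have o1 : open (f @^-1` [set s | s < r]) by apply: open_comp => // x _; exact: cf.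
  have o2 : open (f @^-1` [set s | r < s]) by apply: open_comp => // x _; exact: cf.
  split.
  - exists (f @^-1` [set s | s < r]), (f @^-1` [set s | r < s]); split=> //.
      by move=> z /Kr; rewrite neq_lt => /orP[|]; [left|right].
    by rewrite -subset0 => z [_ [/= k1 k2]]; have := lt_trans k1 k2; rewrite ltxx.
  - exists (f @^-1` [set s | r < s]), (f @^-1` [set s | s < r]); split=> //.
      by move=> z /Kr; rewrite neq_lt => /orP[|]; [right|left].
    by rewrite -subset0 => z [_ [/= k1 k2]]; have := lt_trans k1 k2; rewrite ltxx.
move=> w w' Kw Kw' ww'.
have lev0 w1 : K w1 -> w1.2 != 0 by move=> /level[|] ->; apply/eqP; lra.
have [E2|N2] := eqVneq w.2 w'.2; last first.
  have sep u u' : K u -> K u' -> u.2 < u'.2 -> u.2 < 0 /\ 0 < u'.2.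
    by move=> /level[->|->] /level[->|->]; lra.
  move: N2; rewrite neq_lt => /orP[lt|lt].
  - have [h1 h2] := sep _ _ Kw Kw' lt.
    by have [] := halves snd 0 w w' cont2 lev0 h1 h2.
  - have [h1 h2] := sep _ _ Kw' Kw lt.
    by have [_] := halves snd 0 w' w cont2 lev0 h1 h2.
have N1 : w.1 != w'.1.
  apply/eqP => E1; apply: ww'; rewrite [w]surjective_pairing [w']surjective_pairing.
  by rewrite E1 E2.
have hole u v : u < v -> exists2 r, u < r < v & forall w, K w -> w.1 != r.
  move=> uv; have [u' [v' [h1 h2 h3 H]]] := @exc_union_fst_nd y u v uv.
  exists ((u' + v') / 2); first lra.
  move=> z Kz; apply/eqP => E; apply: (H z.1); [by exists z|lra].
move: N1; rewrite neq_lt => /orP[/hole|/hole] [r /andP[r1 r2] Hr].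
- by have [] := halves fst r w w' cont1 Hr r1 r2.
- by have [_] := halves fst r w' w cont1 Hr r1 r2.
Qed.

End LimitSetProperties.

(** ** A periodic orbit or a Cantor set *)

Section LimitSetTypes.
Context {R : realType} (a : R) (ha : 3 / 10 <= a <= 6 / 10).
Local Notation lam := (4 / 5 : R).
Local Notation V := (quad a).
Local Notation T := (outer_billiard V lam).
Local Notation exc := (exc a).
Local Notation pt := (circ_pt a).
Local Notation len := (@len_circle R).
Local Notation F := (quad_lift a).

Lemma exc_union_cantor rho y : displaces F rho -> irrational rho ->
  closed (exc_union a (accum F y)) -> cantor_set (exc_union a (accum F y)).
Proof.
have /andP[a1 a2] := ha.
move=> dF irr cK; apply: cantor_setI.
- have [z [b A]] := accum_nonempty a y.
  by exists (exc b 0%N (pt z) 0), b, 0%N, z; split=> //; case: (b).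
- apply: (subclosed_compact cK (compact_setX (@segment_compact R (-3) 3) (@segment_compact R (-3) 3))).
  move=> x /(exc_union_trap ha); rewrite /trap ellE /= !in_itv /=.
  by case=> [[/andP[? ?] /andP[? ?]]|[[/andP[? ?] /andP[? ?]]|[/andP[? ?] /andP[? ?]]]];
    split; apply/andP; split; lra.
- move=> _ [b [i [z [ib A ->]]]] e e0.
  have [z' [z'z ze A']] := accum_perfect (quad_lift_lift a) dF irr e0 A.
  have [/andP[s1 s2] _] := @exc_slope_bounds R b i ib.
  have l0 := @len_gt0 R; have l1 : len <= 1 by rewrite /len_circle; lra.
  have s0 : (@exc_slope R b i).1 != 0 by rewrite -normr_gt0; apply: lt_le_trans s1; lra.
  have dE : (exc b i (pt z) 0).1 - (exc b i (pt z') 0).1 =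
      (@exc_slope R b i).1 * (len * (z - z')).
    by rewrite /exc /circ_pt /=; ring.
  exists (exc b i (pt z') 0); split; first by exists b, i, z'.
  + move=> E; move: dE; rewrite E subrr => /esym/eqP.
    rewrite mulf_eq0 (negbTE s0)/= mulf_eq0 gt_eqF//= subr_eq0 eq_sym.
    exact/negP.
  + apply/ball2P; split; last by rewrite subrr normr0.
    rewrite dE normrM [`|len * _|]normrM (gtr0_norm l0) distrC.
    by apply: le_lt_trans ze; rewrite mulrA ler_piMl// mulr_ile1// ltW.
- exact: exc_union_separated.
Qed.

Lemma shift_period (u : nat -> R) q (z z' : R) j :
  u (n * q + j)%N @[n --> \oo] --> z -> u (n * q + (q + j))%N @[n --> \oo] --> z' -> z = z'.
Proof.
move=> uz uz'; have : u (n.+1 * q + j)%N @[n --> \oo] --> z.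
  by have := uz; rewrite -(cvg_shiftS (fun n => u (n * q + j)%N)).
have -> : (fun n => u (n.+1 * q + j)%N) = (fun n => u (n * q + (q + j))%N).
  by apply/funext => n; congr u; rewrite mulSn; lia.
by move=> /(cvg_unique _ uz') ->.
Qed.

(** The residue classes of times give limit points and limit symbols, which follow each
   other periodically: concatenating the corresponding excursions yields the periodic
   orbit. *)
Lemma exc_union_periodic (p : int) q t : (0 < q)%N -> displaces F (p%:~R / q%:R) ->
  aperiodic a t -> exists m (w : 'I_m.+1 -> R * R),
    periodic_tuple V lam w /\ exc_union a (accum F t) = range w.
Proof.
move=> q0 dF nz.
have H j : exists zb : R * bool,
    (orb F t (n * q + j)%N @[n --> \oo] --> zb.1) /\
    exists N, forall n, (N <= n)%N -> wraps F (iter (n * q + j)%N F t) = zb.2.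
  have [z [b Hzb]] := orbit_residues_cvg (quad_lift_lift a) q0 dF t j.
  by exists (z, b).
have [zb Hzb] := choice H; pose z j := (zb j).1; pose b j := (zb j).2.
have zq j : z (q + j)%N = z j.
  by apply/esym; exact: (shift_period (Hzb j).1 (Hzb (q + j)%N).1).
have bq j : b (q + j)%N = b j.
  have [_ [N HN]] := Hzb j; have [_ [N' HN']] := Hzb (q + j)%N.
  rewrite /b -(HN (maxn N N').+1); last by rewrite leqW// leq_maxl.
  rewrite -(HN' (maxn N N')) ?leq_maxr//.
  by congr (wraps F (iter _ F t)); rewrite mulSn; lia.
have zS j : z j.+1 = circ_step a (b j) (z j).
  have [zc [N HN]] := Hzb j; have [zc' _] := Hzb j.+1.
  apply: (cvg_unique _ zc'); first exact: norm_hausdorff.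
    have lin u : circ_step a (b j) u = circ_step a (b j) 0 + exc_ratio (b j) * u.
      by have := circ_stepB a (b j) u 0; rewrite subr0; lra.
    have : circ_step a (b j) 0 + exc_ratio (b j) * orb F t (n * q + j)%N @[n --> \oo] -->
        circ_step a (b j) 0 + exc_ratio (b j) * z j.
      by apply: cvgD; [exact: cvg_cst|apply: cvgMr].
    move=> h; rewrite -lin in h; move: h; apply: cvg_trans; apply: near_eq_cvg; exists N => // n /= /HN bn.
    by rewrite -lin addnS orb_step// bn.
have accumE c r : accum F t r c <-> exists j, r = z j /\ c = b j.
  split=> [A|[j [-> ->]] e e0 N]; last first.
    have [/cvgrPdist_lt/(_ e e0)[N1 _ HN1] [N2 HN2]] := Hzb j.
    pose n := maxn N (maxn N1 N2).
    exists (n * q + j)%N.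
      by rewrite (leq_trans (leq_maxl N (maxn N1 N2)))// -/n (leq_trans (leq_pmulr n q0))// leq_addr.
    split; last by apply: HN2; rewrite /n !leq_max leqnn !orbT.
    by rewrite distrC; apply: HN1; rewrite /= /n !leq_max leqnn !orbT.
  have [k k' n i kk' [h1 h2 h3]|k|i Hi] := @pigeonhole_frequently 'I_q (fun k n i =>
      [/\ (n %% q)%N = i, `|orb F t n - r| < k.+1%:R^-1 & wraps F (iter n F t) = c]).
  - split=> //; apply: lt_le_trans h2 _.
    by rewrite lef_pV2 ?posrE ?ltr0Sn// ler_nat.
  - have [|n kn [h1 h2]] := A k.+1%:R^-1 _ k; first by rewrite invr_gt0 ltr0Sn.
    have nq : (n %% q < q)%N by rewrite ltn_mod.
    by exists n => //; exists (Ordinal nq).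
  exists i; have [zc [N HN]] := Hzb i.
  have large e M : 0 < e -> exists2 n, (M <= n)%N &
      `|orb F t (n * q + i)%N - r| < e /\ wraps F (iter (n * q + i)%N F t) = c.
    move=> e0; have [k ke] := invn_lt e0.
    have [n nk [nqi h1 h2]] := Hi (maxn k (M * q))%N.
    exists (n %/ q)%N.
      by rewrite leq_divRL// (leq_trans _ nk)// leq_maxr.
    rewrite -nqi -divn_eq; split=> //; apply: lt_trans ke; apply: lt_le_trans h1 _.
    by rewrite lef_pV2 ?posrE ?ltr0Sn// ler_nat ltnS leq_maxl.
  split; last first.
    by have [n Nn [_ <-]] := large 1 N ltr01; rewrite HN.
  apply: contrapT => /eqP rz; have d0 : 0 < `|r - z i| / 2.
    by rewrite divr_gt0// normr_gt0 subr_eq0.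
  move/cvgrPdist_lt: zc => /(_ _ d0)[M _ HM].
  have [n Mn [h1 _]] := large _ M d0.
  have := HM n Mn; rewrite /= -/(z i) => h2.
  have := ler_normD (r - orb F t (n * q + i)%N) (orb F t (n * q + i)%N - z i).
  by rewrite addrA subrK; move: h1 h2; rewrite distrC [`|z i - _|]distrC; lra.
have Az j : accum F t (z j) (b j) by apply/accumE; exists j.
pose W j := let: (k, i) := sched b j in exc (b k) i (pt (z k)) 0.
have WT j : T_value V lam (W j) (W j.+1).
  have := schedS b j; have := sched_lt b j; rewrite /W.
  case: (sched b j) => k i /= ik [[ik' ->]|[ik' ->]]; first exact: accum_T_value (Az k) ik.
  have -> : exc (b k.+1) 0 (pt (z k.+1)) 0 = exc (b k) i.+1 (pt (z k)) 0.
    by rewrite ik' exc_last exc0 addr0 zS.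
  exact: accum_T_value (Az k) ik.
(* Time [Q] begins excursion number [q], when symbols and points start over. *)
have [Q Qq sQ] := sched_start b q.
have Q0 : (0 < Q)%N by exact: leq_trans Qq.
have sQj j : sched b (Q + j) = ((q + (sched b j).1)%N, (sched b j).2).
  elim: j => [|j IH]; first by rewrite addn0 sQ addn0.
  rewrite addnS /= IH; case: (sched b j) => k i /=.
  by rewrite bq; case: ifP => //; rewrite addnS.
have WQ j : W (Q + j)%N = W j.
  by rewrite /W sQj; case: (sched b j) => k i /=; rewrite bq zq.
have WQn n j : W (n * Q + j)%N = W j.
  by elim: n => // n IH; rewrite mulSn -addnA WQ.
have Wmod j : W (j %% Q)%N = W j by rewrite {2}(divn_eq j Q) WQn.
have Wmod1 j : W (j %% Q.-1.+1)%N = W j by rewrite prednK.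
exists Q.-1, (fun i => W i); split.
- move=> i; have -> : W (ordS i) = W i.+1 by exact: Wmod1.
  exact: WT.
- apply/seteqP; split=> x.
  + case=> c [i [r [ic /accumE[k [-> ck]] ->]]].
    rewrite ck in ic *; have [j _ sj] := sched_cover ic.
    have jQ : (j %% Q < Q.-1.+1)%N by rewrite prednK// ltn_mod.
    by exists (Ordinal jQ) => //=; rewrite Wmod /W sj.
  + case=> i _ <-; rewrite /W; have := sched_lt b i; case: (sched b i) => k l /= kl.
    by exists (b k), l, (z k).
Qed.

End LimitSetTypes.

(** * The rotation number *)

Section FirstReturnMap.
Context {R : realType} (a : R) (ha : 3 / 10 <= a <= 6 / 10).
Local Notation lam := (4 / 5 : R).
Local Notation V := (quad a).
Local Notation T := (outer_billiard V lam).
Local Notation exc := (exc a).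
Local Notation ellR := (ell lam a).

(** The end of the excursion that passes just below [EA] at abscissa [p]. *)
Definition excursion_start (p : R) : R := sA a - 64 / 125 * p.
Local Notation start := excursion_start.

Definition return_pt (p : R) : R :=
  if 0 < start p then - (4 / 5) * start p else - (36 / 25) - 64 / 125 * start p.

Lemma first_return_unique A x y y' :
  first_return V lam A x y -> first_return V lam A x y' -> y = y'.
Proof.
move=> [_ [k [k0 _ kA Ak ->]]] [_ [k' [k'0 _ k'A Ak' ->]]].
have [lt|lt|-> //] := ltngtP k k'.
- by exfalso; apply: (k'A k) => //; rewrite k0.
- by exfalso; apply: (kA k') => //; rewrite k'0.
Qed.

Lemma near_right0_ex (P Q : R -> Prop) : (\forall e \near 0^'+, P e) ->
  (\forall e \near 0^'+, Q e) -> exists e, P e /\ Q e.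
Proof.
move=> nP nQ.
exact: (@filter_ex _ _ (at_right_proper_filter (0 : R)) _ (filterI nP nQ)).
Qed.

Lemma g_value_unique p q q' : g_value lam a p q -> g_value lam a p q' -> q = q'.
Proof.
move=> gq gq'.
have [e [He He']] := near_right0_ex gq gq'.
have [d [[y yr ->] [y' y'r ->]]] := near_right0_ex He He'.
by rewrite (first_return_unique yr y'r).
Qed.

Section Return.
Context (p e d : R) (e_itv : 0 < e < 1 / 10) (d_itv : 0 < d <= e ^+ 2)
  (p1 : - ellR + e <= p) (p0 : p < 0).

Lemma excursion_start_itv : - ellR < start p <= a.
Proof.
have /andP[a1 a2] := ha; have /andP[e0 e1] := e_itv.
move: p1 p0; rewrite ellE /start /sA => h1 h2.
by clear - a1 a2 e0 h1 h2; apply/andP; split; lra.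
Qed.

Let y0 : 1 - e ^+ 2 <= 1 - d. Proof. by have /andP[] := d_itv; lra. Qed.
Let y1 : 1 - d < 1. Proof. by have /andP[] := d_itv; lra. Qed.
Let h_itv : 0 < 64 / 125 * d < 1 / 100.
Proof.
have /andP[d0 d1] := d_itv; have /andP[e0 e1] := e_itv.
by have : e ^+ 2 < 1 / 100; [rewrite expr2; nra|lra].
Qed.

Lemma iter_return_start : iter 3 T (p, 1 - d) = (start p, 1 + 64 / 125 * d).
Proof.
have [_ _ _ ->] := rect2_excursion ha e_itv p1 p0 y0 y1.
by congr pair; ring.
Qed.

Lemma iter_return_exc i : (i <= exc_len (0 < start p)%R)%N -> start p != 0 ->
  iter (i + 3) T (p, 1 - d) = exc (0 < start p) i (start p) (64 / 125 * d).
Proof.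
rewrite iterD iter_return_start => + s0; elim: i => [|i IH] il; first by rewrite exc0.
rewrite iterS IH ?(ltnW il)//.
by have [] := exc_defined ha il erefl s0 excursion_start_itv h_itv.
Qed.

Lemma not_rect2_early i : (0 < i <= 3)%N -> ~ rect2 lam a e (iter i T (p, 1 - d)).
Proof.
have /andP[a1 a2] := ha; have [_ E1 E2 E3] := rect2_excursion ha e_itv p1 p0 y0 y1.
move: p1 p0; rewrite ellE => p1' p0'; have /andP[e0 e1] := e_itv; have /andP[d0 _] := d_itv.
case: i => [|[|[|[|//]]]] // _; rewrite ?E1 ?E2 ?E3 /rect2 /= => -[/andP[_ h1] /andP[_ h2]];
  clear - a1 a2 e0 e1 d0 p0' p1' h1 h2; lra.
Qed.

Lemma return_first_return : start p != 0 ->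
  exists2 y, first_return V lam (rect2 lam a e) (p, 1 - d) y & return_pt p = y.1.
Proof.
move=> s0; have /andP[a1 a2] := ha; have p0' := p0; have p1' := p1.
have [def _ _ _] := rect2_excursion ha e_itv p1 p0 y0 y1.
have /andP[d0 d1] := d_itv; have /andP[e0 e1] := e_itv.
have sI := excursion_start_itv; have itE := iter_return_exc _ s0.
have sD i (il : (i < exc_len (0 < start p)%R)%N) : defined_at V (iter (i + 3) T (p, 1 - d)).
  rewrite itE ?(ltnW il)//.
  by have [] := exc_defined ha il erefl s0 sI h_itv.
pose k := if 0 < start p then 1%N else 3%N.
have kl : (k <= exc_len (0 < start p)%R)%N by rewrite /k; case: (0 < start p).
have kE : iter (k + 3) T (p, 1 - d) =
    (return_pt p, 1 - (if 0 < start p then 4 / 5 else 64 / 125) * (64 / 125 * d)).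
  rewrite itE// /k /return_pt /exc; case: (0 < start p) => /=; congr pair; ring.
exists (iter (k + 3) T (p, 1 - d)); last by rewrite kE.
have sI' := sI; move: sI'; rewrite ellE => /andP[s1 s2].
have s3 : sA a < start p by rewrite /start; lra.
have sA1 : - 1 < sA a by rewrite /sA; lra.
split.
  by rewrite /rect2 /= p1 y0 !ltW.
exists (k + 3)%N; split=> //.
- by rewrite addn3.
- move=> i ik; have [i3|i3] := ltnP i 3; first exact: def.
  rewrite -(subnK i3); apply: sD.
  by apply: leq_trans kl; rewrite ltn_subLR// addnC.
- move=> i /andP[i0 ik]; have [i3|i3] := leqP i 3; first by apply: not_rect2_early; rewrite i0.
  have il : (i - 3 < k)%N by rewrite ltn_subLR// ?(ltnW i3)// addnC.
  rewrite -(subnK (ltnW i3)) itE; last by rewrite (leq_trans (ltnW il)).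
  have i3' : (0 < i - 3)%N by rewrite subn_gt0.
  move: il i3'; move: (i - 3)%N => j; rewrite /k.
  case: ltP => s0'; case: j => [|[|[|//]]] // _ _; rewrite /exc /rect2 /= => -[/andP[? ?] /andP[? ?]]; lra.
- rewrite kE /rect2 /return_pt ellE /=.
  by case: ltP => s0'; split; apply/andP; split; lra.
Qed.

(** At the discontinuity the orbit hits the ray from [D] through [A] before coming back. *)
Lemma no_first_return : start p = 0 -> forall y,
  ~ first_return V lam (rect2 lam a e) (p, 1 - d) y.
Proof.
move=> s0 y [_ [k [k0 kdef _ kA _]]].
have /andP[d0 d1] := d_itv.
have [k3|k3] := leqP k 3; first by apply: (not_rect2_early _ kA); rewrite k0.
apply: (kdef 3%N k3); right; rewrite iter_return_start s0.
by apply/(singular_quad ha)/Or44; split=> //; lra.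
Qed.

End Return.

Lemma g_valueP p q : - ellR < p < 0 ->
  g_value lam a p q <-> start p != 0 /\ q = return_pt p.
Proof.
move=> /andP[p1 p0].
have e_near : \forall e \near 0^'+, 0 < e < 1 / 10 /\ - ellR + e <= p.
  near=> e; split.
    apply/andP; split; first by near: e; exact: nbhs_right_gt.
    by near: e; apply: nbhs_right_lt; lra.
  rewrite -lerBrDl opprK; near: e; apply: nbhs_right_le; lra.
have d_near (e : R) : 0 < e -> \forall d \near 0^'+, 0 < d <= e ^+ 2.
  move=> e0; near=> d; apply/andP; split; first by near: d; exact: nbhs_right_gt.
  by near: d; apply: nbhs_right_le; exact: exprn_gt0.
have ex : start p != 0 -> g_value lam a p (return_pt p).
  move=> s0; rewrite /g_value; apply: filterS e_near => e [e_itv pe].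
  have /andP[e0 _] := e_itv.
  apply: filterS (d_near e e0) => d d_itv.
  exact: (return_first_return e_itv d_itv).
split=> [gq|[s0 ->]]; last exact: ex.
have s0 : start p != 0.
  apply/eqP => s0.
  have [e [He [e_itv pe]]] := near_right0_ex gq e_near.
  have /andP[e0 _] := e_itv.
  have [d [[y yr _] d_itv]] := near_right0_ex He (d_near e e0).
  exact: (no_first_return e_itv d_itv pe p0 s0 yr).
by split=> //; exact: g_value_unique gq (ex s0).
Unshelve. all: by end_near. Qed.

End FirstReturnMap.

Section RotationNumber.
Context {R : realType} (a : R) (ha : 3 / 10 <= a <= 6 / 10).
Local Notation lam := (4 / 5 : R).
Local Notation pt := (circ_pt a).
Local Notation ellR := (ell lam a).
Local Notation start := (excursion_start a).
Local Notation coord := (EA_coord lam a).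
Local Notation F := (quad_lift a).

Lemma ell_bounds : 15 / 8 <= ellR <= 12 / 5.
Proof. by have /andP[a1 a2] := ha; rewrite ellE; lra. Qed.

Lemma ell_gt0 : 0 < ellR.
Proof. by have /andP[] := ell_bounds; lra. Qed.

Lemma coord_lt p p' : (coord p < coord p') = (p < p').
Proof. by rewrite /EA_coord ltr_pM2r ?invr_gt0 ?ell_gt0// ltrD2r. Qed.

Lemma coord_inv p : ellR * (coord p - 1) = p.
Proof. by rewrite /EA_coord; field; rewrite gt_eqF// ell_gt0. Qed.

Lemma coord_itv p : - ellR < p < 0 -> 0 < coord p < 1.
Proof.
have l0 := ell_gt0; move=> /andP[p1 p2]; rewrite /EA_coord; apply/andP; split.
  by rewrite divr_gt0//; lra.
by rewrite ltr_pdivrMr//; lra.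
Qed.

Definition return_lift0 (p : R) : R :=
  coord (return_pt a p) + (if 0 < start p then 0 else 1).

Definition return_lift (x : R) : R :=
  return_lift0 (ellR * (fpart x - 1)) + (Num.floor x)%:~R.

Lemma return_lift0_lt p p' : - ellR <= p -> p < p' -> p' <= 0 ->
  return_lift0 p < return_lift0 p' < return_lift0 p + 1.
Proof.
have /andP[a1 a2] := ha; have l0 := ell_gt0.
have lE := ellE a; set l := ellR in l0 lE *.
rewrite /return_lift0 /return_pt /EA_coord -/l => p1 pp' p2.
have s1 : start p' < start p by rewrite /excursion_start; lra.
have s2 : start p <= a by rewrite /excursion_start /sA; lra.
have s3 : sA a <= start p' by rewrite /excursion_start; lra.
have E (x : R) : x / l + 1 = (x + l) / l by field; rewrite gt_eqF.
move: s1 s2 s3; rewrite /sA; set s := start p; set s' := start p' => s1 s2 s3.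
case: (ltP 0 s) => hs; case: (ltP 0 s') => hs'; rewrite ?addr0 ?E ?ltr_pM2r ?invr_gt0//;
  apply/andP; split; lra.
Qed.

Lemma return_lift_lift : monotone_lift return_lift.
Proof.
have l0 := ell_gt0.
have dom x : - ellR <= ellR * (fpart x - 1) <= 0.
  have := fpart_ge0 x; have := fpart_lt1 x => x1 x0.
  by apply/andP; split; nra.
split=> [x y xy|x].
- rewrite /return_lift; have := le_floor (ltW xy); rewrite le_eqVlt => /predU1P[fE|flt].
    rewrite fE ltrD2r.
    have /andP[d1 d2] := dom x; have /andP[d3 d4] := dom y.
    have [|//] := andP (return_lift0_lt d1 _ d4).
    by rewrite ltr_pM2l// ltrD2r; move: xy; rewrite /fpart fE ltrD2r.
  have : (Num.floor x + 1)%:~R <= (Num.floor y)%:~R :> R by rewrite ler_int lezD1.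
  rewrite intrD => f1.
  suff : return_lift0 (ellR * (fpart x - 1)) < return_lift0 (ellR * (fpart y - 1)) + 1 by lra.
  have /andP[d1 d2] := dom x; have /andP[d3 d4] := dom y.
  have [lt|lt|->] := ltgtP (ellR * (fpart x - 1)) (ellR * (fpart y - 1)).
  + by have /andP[] := return_lift0_lt d1 lt d4; lra.
  + by have /andP[] := return_lift0_lt d3 lt d2; lra.
  + by lra.
- have -> : x + 1 = x + 1%:~R by [].
  by rewrite /return_lift floorDint fpartDint intrD addrA.
Qed.

Lemma return_lift_coord p : - ellR < p < 0 ->
  return_lift (coord p) = return_lift0 p.
Proof.
move=> /coord_itv /andP[c0 c1].
have f0 : Num.floor (coord p) = 0 by apply: floor_def; rewrite add0r (ltW c0).
by rewrite /return_lift /fpart f0 subr0 addr0 coord_inv.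
Qed.

Lemma g_map_return p : - ellR < p < 0 -> start p != 0 -> g_map lam a p = return_pt a p.
Proof.
move=> pI s0; apply: xget_unique.
  by apply/(g_valueP ha _ pI); split.
by move=> q /(g_valueP ha _ pI)[_ ->].
Qed.

Lemma is_lift_return_lift : is_lift lam a return_lift.
Proof.
split; [exact: return_lift_lift.1|exact: return_lift_lift.2|].
move=> p pI /nbhs_singleton[q /(g_valueP ha _ pI)[s0 _]] _.
rewrite g_map_return// return_lift_coord// /return_lift0.
by case: (0 < start p); [exists 0|exists 1].
Qed.

(** The explicit lift shows that the rotation number exists. *)
Lemma rotation_numberP : is_rotation_number lam a (rotation_number lam a).
Proof.
have [r dr] := displaces_exists return_lift_lift.
apply: (xgetPex 0); exists (fpart r); split; first by rewrite fpart_ge0 fpart_lt1.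
exists return_lift, (Num.floor r); split; first exact: is_lift_return_lift.
by move=> x; rewrite subrK; exact: displaces_cvg.
Qed.

(** A lift is determined by the circle map up to an integer constant: two
   increasing lifts cannot differ by integers that vary along the circle. *)
Lemma lift_eq_return G : is_lift lam a G -> exists k0 : int, forall p,
  - ellR < p < 0 -> start p != 0 -> G (coord p) = return_lift0 p + k0%:~R.
Proof.
have /andP[a1 a2] := ha; have l0 := ell_gt0.
move=> [Gmono GD Gval].
have ex p : - ellR < p < 0 -> start p != 0 -> exists k : int, G (coord p) = return_lift0 p + k%:~R.
  move=> pI s0; have /andP[p1 p2] := pI.
  have nearp : \forall p' \near p, - ellR < p' < 0 /\ (0 < start p') = (0 < start p) /\ start p' != 0.
    pose r := Num.min (Num.min (p + ellR) (- p)) `|start p|.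
    have r0 : 0 < r by rewrite !lt_min normr_gt0 s0 andbT; apply/andP; split; lra.
    apply/nbhs_ballP; exists r => // p'; rewrite /ball /= !lt_min => /andP[/andP[h1 h2] h3].
    move: h1 h2; rewrite !ltr_norml => /andP[h1 h1'] /andP[h2 h2'].
    split; first by apply/andP; split; lra.
    have -> : start p' = start p + 64 / 125 * (p - p') by rewrite /excursion_start; ring.
    move: s0 h3; set s := start p; set d := p - p'; rewrite neq_lt => /orP[hs|hs].
    + rewrite (ltr0_norm hs) ltr_norml => /andP[h3 h4].
      have ds : s + 64 / 125 * d < 0 by lra.
      by rewrite !ltNge (ltW ds) (ltW hs) lt_eqF.
    + rewrite (gtr0_norm hs) ltr_norml => /andP[h3 h4].
      have ds : 0 < s + 64 / 125 * d by lra.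
      by rewrite ds hs gt_eqF.
  have [||k Hk] := Gval p pI.
  - apply: filterS nearp => p' [p'I [_ s0']].
    by exists (return_pt a p'); apply/(g_valueP ha _ p'I).
  - have lin : \forall p' \near p, (if 0 < start p then - (4 / 5) * start p'
        else - (36 / 25) - 64 / 125 * start p') = g_map lam a p'.
      by apply: filterS nearp => p' [p'I [sE s0']]; rewrite g_map_return// /return_pt sE.
    have cs : start x @[x --> p] --> start p.
      by apply: cvgB; [exact: cvg_cst|apply: cvgMr; exact: cvg_id].
    apply: (cvg_trans (near_eq_cvg lin)); rewrite g_map_return// /return_pt.
    case: (0 < start p); first by apply: cvgMr.
    by apply: cvgB; [exact: cvg_cst|apply: cvgMr].
  rewrite Hk g_map_return// /return_lift0; case: (0 < start p).
    by exists k; rewrite addr0.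
  by exists (k - 1); rewrite intrB; ring.
have same p p' k k' : - ellR < p -> p < p' -> p' < 0 ->
    G (coord p) = return_lift0 p + k%:~R -> G (coord p') = return_lift0 p' + k'%:~R -> k = k'.
  move=> p1 pp' p2 E E'.
  have g1 : G (coord p) < G (coord p') by apply: Gmono; rewrite coord_lt.
  have g2 : G (coord p') < G (coord p) + 1.
    rewrite -GD; apply: Gmono.
    have /andP[_ c1] : 0 < coord p' < 1 by apply: coord_itv; rewrite p2 andbT; lra.
    have /andP[c0 _] : 0 < coord p < 1 by apply: coord_itv; rewrite p1/=; lra.
    lra.
  have /andP[r1 r2] := return_lift0_lt (ltW p1) pp' (ltW p2).
  have d1 : k'%:~R < k%:~R + 1 :> R by lra.
  have d2 : k%:~R < k'%:~R + 1 :> R by lra.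
  move: d1 d2; rewrite -[1]/(1%:~R) -!intrD !ltr_int !ltzD1 => d1 d2.
  by apply/eqP; rewrite eq_le d1 d2.
pose p0 : R := - (1 / 100).
have p0I : - ellR < p0 < 0 by have /andP[] := ell_bounds; rewrite /p0; lra.
have s0 : start p0 != 0 by rewrite /excursion_start /sA /p0; apply/eqP; lra.
have [k0 Hk0] := ex p0 p0I s0; exists k0 => p pI sp.
have [k Hk] := ex p pI sp.
have /andP[q1 q2] := p0I; have /andP[p1 p2] := pI.
have [lt|lt|pE] := ltgtP p p0; last by rewrite pE.
- by rewrite -(same p p0 k k0).
- by rewrite (same p0 p k0 k).
Qed.

(** The first return to [R2] and the map on excursion starts are conjugate by a
   decreasing affine map, so that the rotation numbers are opposite. *)
Lemma rotation_number_excursions rho : is_rotation_number lam a rho ->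
  exists j : int, displaces F (j%:~R - rho).
Proof.
have /andP[a1 a2] := ha; have l0 := ell_gt0; have /andP[l1 l2] := ell_bounds.
move=> [_ [G [k [GL Gcvg]]]].
have [t [/andP[t0 t1] nz]] := aperiodic_exists a.
have [k0 Hk0] := lift_eq_return GL.
have liftG : monotone_lift G by case: GL.
pose u n := orb F t n; pose p n := - (36 / 25) * u n.
pose bit n : bool := wraps F (iter n F t).
have uS n : u n.+1 = circ_step a (bit n) (u n) by exact: orb_step.
have bitE n : bit n = (0 < pt (u n)).
  by rewrite /bit quad_lift_wraps lt_neqAle eq_sym nz.
have ptI n : sA a <= pt (u n) <= sA a + len_circle.
  by apply: circ_pt_itv; have /andP[-> /ltW] := orb_itv F t n.
have u_itv n : 0 < u n < 1.
  case: n => [|n].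
    have f0 : Num.floor t = 0 by apply: floor_def; rewrite add0r (ltW t0).
    by rewrite /u /orb /fpart /= f0 subr0 t0.
  have /andP[u0 ->] := orb_itv F t n.+1; rewrite andbT lt_neqAle u0 andbT.
  apply/eqP => E; have := pt_circ_step a (bit n) (u n); rewrite -uS -E.
  have := ptI n; have := nz n; rewrite -/(u n) bitE; set s := pt (u n).
  rewrite /circ_pt mulr0 addr0 /exc_end /len_circle /sA.
  by case: (ltgtP 0 s) => // hs _ /andP[? ?]; lra.
have pI n : - ellR < p n < 0 by have := u_itv n; rewrite /p => /andP[? ?]; lra.
have startE n : start (p n) = pt (u n).
  by rewrite /excursion_start /p /circ_pt /len_circle; field.
have s0 n : start (p n) != 0 by rewrite startE; exact: nz.
have retE n : return_pt a (p n) = p n.+1.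
  rewrite /return_pt startE -bitE /p uS /circ_step /exc_end /len_circle.
  by case: (bit n); field.
have FS n : iter n.+1 F t = iter n F t - u n + u n.+1 + (if bit n then 1 else 0).
  rewrite iterS {1}/quad_lift uS.
  have -> : (Num.floor (iter n F t))%:~R = iter n F t - u n by rewrite /u /orb /fpart; ring.
  have lc := @len_gt0 R.
  have -> : fpart (iter n F t) + sA a / len_circle = pt (u n) / len_circle.
    by rewrite circ_ptE mulrAC divff ?gt_eqF// mul1r.
  have := nz n; rewrite -/(u n) /branch ler_pdivrMr// mul0r leNgt -bitE.
  rewrite /circ_step /exc_end; case: (bit n) => _ /=; field; rewrite gt_eqF//.
(* The two lifts count complementary events, a start on the left and on the right of
   the ray [DA], so their integer parts add up to a multiple of time. *)
have key n : exists K : int, iter n G (coord (p 0)) = coord (p n) + K%:~R /\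
    iter n F t = u n + (n%:R * (k0 + 1)%:~R - K%:~R).
  elim: n => [|n [K [IG IF]]].
    exists 0; rewrite addr0 mul0r subrr addr0; split=> //=.
    have f0 : Num.floor t = 0 by apply: floor_def; rewrite add0r (ltW t0).
    by rewrite /u /orb /fpart /= f0 subr0.
  exists (K + k0 + (if bit n then 0 else 1)); split.
    rewrite iterS IG lift_addz// Hk0// /return_lift0 retE startE -bitE.
    by rewrite !intrD; case: (bit n); ring.
  by rewrite FS IF -natr1 !intrD; case: (bit n); ring.
have [rG dG] := displaces_exists liftG.
have [rF dF] := displaces_exists (quad_lift_lift a).
have rGE : rG = rho + k%:~R.
  by apply: (cvg_unique _ (displaces_cvg (coord (p 0)) dG) (Gcvg _)); exact: norm_hausdorff.
exists (k0 + 1 - k).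
suff -> : (k0 + 1 - k)%:~R - rho = rF by [].
apply/eqP; rewrite -subr_eq0; apply/eqP; set D := (X in X = 0).
apply: contrapT => /eqP D0.
have {}D0 : 0 < `|D| by rewrite normr_gt0.
(* Both displacements are within 2 of linear ones, and the remaining terms lie in the
   unit interval. *)
have [n] := nat_gt (8 / `|D|); rewrite ltr_pdivrMr// => hn.
have [K [EG EF]] := key n.
have := dG n (coord (p 0)); have := dF n t; rewrite EG EF.
have /andP[c1 c2] := coord_itv (pI n); have /andP[c3 c4] := coord_itv (pI 0%N).
have /andP[u1 u2] := u_itv n.
have DE : D = (k0 + 1)%:~R - rG - rF by rewrite /D rGE intrB; ring.
have nD : n%:R * `|D| = `|n%:R * D| by rewrite normrM normr_nat.
move: hn; rewrite nD ltNge => /negP hn; rewrite !ler_norml => /andP[h1 h2] /andP[h3 h4].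
apply: hn; rewrite ler_norml DE.
have -> : n%:R * ((k0 + 1)%:~R - rG - rF) = n%:R * (k0 + 1)%:~R - n%:R * rG - n%:R * rF by ring.
by apply/andP; split; lra.
Qed.

End RotationNumber.

(** * Asymptotic behavior *)

Section Asymptotics.
Context {R : realType} (a : R) (ha : 3 / 10 <= a <= 6 / 10).
Local Notation lam := (4 / 5 : R).
Local Notation V := (quad a).
Local Notation F := (quad_lift a).
Local Notation K := (exc_union a (accum F 0)).

Lemma rational_fraction (x : R) : rational x ->
  exists (p : int) (q : nat), (0 < q)%N /\ x = p%:~R / q%:R.
Proof.
case=> r _ <-; exists (numq r), `|denq r|%N; split.
  by rewrite absz_gt0 denq_neq0.
by rewrite /ratr; congr (_ / _); rewrite pmulrn absz_denq.
Qed.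

Lemma rational_intB (j : int) (x : R) : rational x -> rational (j%:~R - x).
Proof. by case=> r _ <-; exists (j%:~R - r) => //; rewrite rmorphB /= ratr_int. Qed.

Lemma accum_quad_rational y : rational (rotation_number lam a) -> accum F y = accum F 0.
Proof.
have [j dF] := rotation_number_excursions ha (rotation_numberP ha).
move=> /(rational_intB j)/rational_fraction[p [q [q0 E]]]; rewrite E in dF.
have k0 : 0 <= 256 / 625 :> R by lra.
have k1 : 256 / 625 < 1 :> R by lra.
exact: (accum_rational (quad_lift_lift a) k0 k1 (@quad_lift_contr R a) y q0 dF).
Qed.

Context (accum_const : forall y, accum F y = accum F 0).

Lemma captured_asymptotic x : regular_points V lam x -> captured a x ->
  asymptotic_to V lam x K.
Proof.
move=> rx cx; have [t xt] := captured_omega ha (regular_nonsingular rx) cx.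
by split; rewrite -(accum_const t) -xt; [exact: closed_omega_limit|].
Qed.

Lemma rects_asymptotic e x : 0 < e < 1 / 10 ->
  (regular_points V lam `&` (rect1 lam a e `|` rect2 lam a e)) x ->
  asymptotic_to V lam x K.
Proof.
move=> e_itv [rx xe]; apply: captured_asymptotic => //.
exact: captured_rects e_itv (regular_nonsingular rx) xe.
Qed.

Lemma limit_set_unique e K' : 0 < e < 1 / 10 ->
  (forall x, (regular_points V lam `&` (rect1 lam a e `|` rect2 lam a e)) x ->
     asymptotic_to V lam x K') -> K = K'.
Proof.
move=> e_itv H; have [x rx xe] := regular_start ha e_itv.
have xI : (regular_points V lam `&` (rect1 lam a e `|` rect2 lam a e)) x by split=> //; right.
by have [_ <-] := H x xI; have [_ <-] := rects_asymptotic e_itv xI.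
Qed.

Lemma closed_limit_set : closed K.
Proof.
have e_itv : 0 < (1 / 20 : R) < 1 / 10 by lra.
have [x rx xe] := regular_start ha e_itv.
by have [] : asymptotic_to V lam x K by apply: (rects_asymptotic e_itv); split=> //; right.
Qed.

Lemma attracting_limit_set : attracting V lam K.
Proof.
exists (trap a); split; [exact: open_trap|exact: exc_union_trap|].
by move=> x [tx rx]; apply: captured_asymptotic => //; exact: captured_trap.
Qed.

End Asymptotics.

Theorem theorem1 (R : realType) (a : R) (ha : 3 / 10 <= a <= 6 / 10) :
  let lam : R := 4 / 5 in
  let V := quad a in
  \forall eps \near 0^'+,
    (rational (rotation_number lam a) ->
       exists! K : set (R * R),
         attracting_periodic_orbit V lam K /\
         forall x, (regular_points V lam `&`
                    (rect1 lam a eps `|` rect2 lam a eps)) x ->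
           asymptotic_to V lam x K) /\
    (irrational (rotation_number lam a) ->
       exists! K : set (R * R),
         [/\ invariant_set V lam K, cantor_set K &
             forall x, (regular_points V lam `&`
                        (rect1 lam a eps `|` rect2 lam a eps)) x ->
               asymptotic_to V lam x K]).
Proof.
move=> lam V; near=> eps.
have e_itv : 0 < eps < 1 / 10.
  apply/andP; split; first by near: eps; exact: nbhs_right_gt.
  by near: eps; apply: nbhs_right_lt; lra.
have [t [_ nz]] := aperiodic_exists a.
have [j dF] := rotation_number_excursions ha (rotation_numberP ha).
pose K := exc_union a (accum (quad_lift a) 0).
split=> rat; exists K; split.
- have ac y := accum_quad_rational ha y rat.
  split; last by move=> x; exact: rects_asymptotic.
  have [p [q [q0 E]]] := rational_fraction (rational_intB j rat); rewrite E in dF.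
  have [m [w [pw Kw]]] := exc_union_periodic ha q0 dF nz.
  exists m, w; split=> //; first by rewrite /K -(ac t).
  exact: attracting_limit_set.
- move=> K' [_ H]; apply: (limit_set_unique ha _ e_itv H).
  by move=> y; exact: accum_quad_rational.
- have irr : irrational (j%:~R - rotation_number lam a).
    by move=> /(rational_intB j); rewrite opprB addrC subrK.
  have ac y : accum (quad_lift a) y = accum (quad_lift a) 0.
    exact: (accum_irrational (quad_lift_lift a) _ _ dF irr).
  have cK : closed K by exact: closed_limit_set.
  split.
  + by rewrite /K -(ac t) in cK *; exact: exc_union_invariant.
  + exact: exc_union_cantor dF irr cK.
  + by move=> x; exact: rects_asymptotic.
- have irr : irrational (j%:~R - rotation_number lam a).
    by move=> /(rational_intB j); rewrite opprB addrC subrK.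
  move=> K' [_ _ H]; apply: (limit_set_unique ha _ e_itv H) => y.
  exact: (accum_irrational (quad_lift_lift a) _ _ dF irr).
Unshelve. all: by end_near. Qed.
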